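(* Let $\delta\in[0,1]$ and let $v$ be a function on $\Omega$ with $\|v\|_B<\infty$, vanishing on $\{R=R_0\}$ and on $\{\omega=0\}$. Then $$\iint r^\delta|\partial_R(rv)|^2\lesssim\iint r^\delta|\partial_R(rv)|^2+\iint r^\delta\Big(\frac{rv}{u_s}\Big)^2u_su_{sRR}+\theta_0\|v\|_B^2,$$ with an implicit constant independent of $\varepsilon$, of small $\theta_0$, and of $v$. (The second integral on the right need not be nonnegative.)
   Context: Geometry. $R_0>0$, $\theta_0>0$ small, $0<\varepsilon\le1$ small relative to $\theta_0$, $\Omega=(0,\theta_0)\times(R_0,\infty)\ni(\omega,R)$; $r=r(R)=R_0+\sqrt\varepsilon(R-R_0)$; $\iint=\int_0^{\theta_0}\int_{R_0}^\infty\cdot\,dR\,d\omega$. Functions with subscript $e$ are functions of $(\omega,r)$, all others of $(\omega,R)$. $\|v\|_B^2=\iint(r^\delta|\partial_R(rv)|^2+\varepsilon v_\omega^2r^\delta+\varepsilon v^2r^\delta)$. Profile. $u_s=u_e^0+u_p^0+\sqrt\varepsilon u_e^1$, with $\min u_s>0$, constructed from the following data. $u_b>0$ constant; $u_e^0=u_e^0(r)$ smooth, bounded below by a positive constant, with $\partial_r^ku_e^0$ ($k\ge1$) exponentially decaying; $u_e:=u_e^0(R_0)$; $\bar u_0(R),u_b^1(r),V_{b0}(r),V_{b1}(r)$ smooth with exponential decay (with derivatives); $\min\{u_b,\inf_R(u_e+\bar u_0)\}>0$; $|V_{b0}-V_{b1}|+|\partial_r(V_{b0}-V_{b1})|\lesssim\theta_0$;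 $V_{b0}(R_0)=-v_p^0(0,R_0)$, $V_{b1}(R_0)=-v_p^0(\theta_0,R_0)$. Prandtl-0: $(u_e+u_p^0)u^0_{p\omega}+(rv_p^0-R_0v_p^0(\omega,R_0))u^0_{pR}=R_0u^0_{pRR}$, $rv_p^0=\int_R^\infty u^0_{p\omega}$, $u_p^0(\omega,R_0)=u_b-u_e$, $u_p^0(0,R)=\bar u_0(R)$, $u_p^0\to0$ as $R\to\infty$. Euler-1: $Lv=-r\Delta v+(\frac{ru^0_{err}}{u_e^0}+\frac{u^0_{er}}{u_e^0})v-2v_r-\frac2rv$, $\Delta=\partial_r^2+\frac1r\partial_r+\frac1{r^2}\partial_\omega^2$; $\mathcal B=(1-\frac\omega{\theta_0})\frac{v_p^0(\omega,R_0)}{v_p^0(0,R_0)}V_{b0}(r)+\frac\omega{\theta_0}\frac{v_p^0(\omega,R_0)}{v_p^0(\theta_0,R_0)}V_{b1}(r)$; $F=L\mathcal B$; $E_b=\chi_0(\frac\omega\varepsilon)F(0,r)+\chi_0(\frac{\theta_0-\omega}\varepsilon)F(\theta_0,r)$, $\chi_0$ a smooth cutoff supported in $[0,1]$, equal to $1$ near $0$. $Lv_e^1=E_b$, $v_e^1(\omega,R_0)=-v_p^0(\omega,R_0)$, $v_e^1(0,r)=V_{b0}$, $v_e^1(\theta_0,r)=V_{b1}$, $v_e^1\to0$ as $r\to\infty$; $u_e^1=u_b^1(r)-\int_0^\omega\partial_r(rv_e^1)d\omega'$. *)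

(* Defs.v *)
From HB Require Import structures.
From mathcomp Require Import all_boot all_order all_algebra.
From mathcomp Require Import all_classical all_reals all_analysis.

Set Implicit Arguments.
Unset Strict Implicit.
Unset Printing Implicit Defensive.

Import Order.TTheory GRing.Theory Num.Theory.
Import numFieldNormedType.Exports.

Local Open Scope classical_set_scope.
Local Open Scope ring_scope.

(* Two-variable functions are curried: first argument the angle omega, second
   argument the radial variable (R, or r for the Euler profiles). *)

Section calculus.
Context {R : realType}.
Implicit Types (f : R -> R) (g : R -> R -> R) (a b : R).

Definition d1 g : R -> R -> R := fun w x => derive1 (fun w' => g w' x) w.
Definition d2 g : R -> R -> R := fun w x => derive1 (g w) x.

Fixpoint class_C (k : nat) f : Prop :=
  continuous f /\
  match k with
  | 0%N => True
  | j.+1 => (forall x, derivable f x 1) /\ class_C j (derive1 f)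
  end.

Definition smooth f : Prop := forall k, class_C k f.

Fixpoint class_C2 (k : nat) g : Prop :=
  continuous (fun z : R * R => g z.1 z.2) /\
  match k with
  | 0%N => True
  | j.+1 => [/\ forall w x : R, derivable (fun w' => g w' x) w 1,
                forall w x : R, derivable (g w) x 1,
                class_C2 j (d1 g) & class_C2 j (d2 g)]
  end.

(* Functions of class C^k up to the boundary of a half-line, segment, strip or
   rectangle are represented by C^k extensions to the whole line or plane;
   every other condition below is imposed on the original domain only. *)

Definition exp_decay (R0 : R) f : Prop :=
  exists A a : R, 0 < a /\ forall x, R0 <= x -> `|f x| <= A * expR (- a * x).

Definition smooth_exp_decay (R0 : R) f : Prop :=
  smooth f /\ forall k, exp_decay R0 (derive1n k f).

(* Absolute continuity on [a, b], in the form given by Lebesgue's fundamental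
   theorem of calculus. *)
Definition abs_cont (a b : R) f : Prop :=
  (@lebesgue_measure R).-integrable `[a, b] (EFin \o derive1 f) /\
  forall x, a <= x <= b ->
    f x = f a + \int[@lebesgue_measure R]_(y in `[a, x]) derive1 f y.

Definition iint (R0 th : R) g : \bar R :=
  let I : set R := `]0, th[%classic in
  let J : set R := `]R0, +oo[%classic in
  (\int[@lebesgue_measure R]_(w in I)
     \int[@lebesgue_measure R]_(x in J) (g w x)%:E)%E.

End calculus.

Section profile.
Context {R : realType}.
Variables (R0 ub : R).

(* The change of variables r(R). *)
Definition r_of (eps x : R) : R := R0 + Num.sqrt eps * (x - R0).

Definition euler0 (ue0 : R -> R) : Prop :=
  [/\ smooth ue0,
      exists c : R, 0 < c /\ forall r, R0 <= r -> c <= ue0 r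
    & forall k, (0 < k)%N -> exp_decay R0 (derive1n k ue0)].

(* r v_p^0 = int_R^oo d_omega u_p^0; unlike v_p^0 itself, this does not depend
   on eps. *)
Definition rvp0 (up : R -> R -> R) (w x : R) : R :=
  \int[@lebesgue_measure R]_(y in `[x, +oo[) d1 up w y.

(* Classical solutions of the Prandtl-0 problem on [0, thb] x [R0, +oo[, with
   trace vp0 = v_p^0(., R0) (where r = R0). *)
Record prandtl0 (thb : R) (ue0 ubar0 : R -> R)
    (up : R -> R -> R) (vp0 : R -> R) : Prop := Prandtl0 {
  prandtl0_class : class_C2 3 up ;
  prandtl0_bounded : exists M : R, forall w x : R, 0 <= w <= thb -> R0 <= x ->
    `|d1 up w x| <= M /\ `|d2 up w x| <= M ;
  prandtl0_integrable : forall w : R, 0 <= w <= thb ->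
    (@lebesgue_measure R).-integrable `[R0, +oo[ (EFin \o d1 up w) ;
  prandtl0_trace_class : class_C 2 vp0 ;
  prandtl0_trace : forall w : R, 0 <= w <= thb -> R0 * vp0 w = rvp0 up w R0 ;
  prandtl0_eq : forall w x : R, 0 < w < thb -> R0 < x ->
    (ue0 R0 + up w x) * d1 up w x + (rvp0 up w x - R0 * vp0 w) * d2 up w x
    = R0 * d2 (d2 up) w x ;
  prandtl0_bottom : forall w : R, 0 <= w <= thb -> up w R0 = ub - ue0 R0 ;
  prandtl0_initial : forall x, R0 <= x -> up 0 x = ubar0 x ;
  prandtl0_infty : forall w : R, 0 <= w <= thb -> up w x @[x --> +oo] --> (0 : R)
}.

(* L, with (r u'' / u + u' / u) v the zeroth-order term *)
Definition euler1_op (ue0 : R -> R) (v : R -> R -> R) (w r : R) : R :=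
  - r * (d2 (d2 v) w r + r^-1 * d2 v w r + (r ^+ 2)^-1 * d1 (d1 v) w r)
  + (r * derive1n 2 ue0 r / ue0 r + derive1 ue0 r / ue0 r) * v w r
  - 2 * d2 v w r - 2 / r * v w r.

(* The quotients are the intended ones when vp0 0 and vp0 th are nonzero. *)
Definition euler1_bdry (th : R) (vp0 Vb0 Vb1 : R -> R) (w r : R) : R :=
  (1 - w / th) * (vp0 w / vp0 0) * Vb0 r + w / th * (vp0 w / vp0 th) * Vb1 r.

Definition euler1_source (th eps : R) (ue0 vp0 Vb0 Vb1 chi : R -> R)
    (w r : R) : R :=
  let F := euler1_op ue0 (euler1_bdry th vp0 Vb0 Vb1) in
  chi (w / eps) * F 0 r + chi ((th - w) / eps) * F th r.

(* chi is only ever evaluated on [0, +oo[. *)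
Definition cutoff (chi : R -> R) : Prop :=
  [/\ smooth chi,
      exists a : R, 0 < a /\ forall s, 0 <= s <= a -> chi s = 1
    & forall s, 1 <= s -> chi s = 0].

(* K is the constant implicit in |V_b0 - V_b1| + |d_r(V_b0 - V_b1)| <~ th. *)
Record euler1_data (th K : R) (vp0 Vb0 Vb1 : R -> R) : Prop := Euler1Data {
  euler1_Vb0 : smooth_exp_decay R0 Vb0 ;
  euler1_Vb1 : smooth_exp_decay R0 Vb1 ;
  euler1_close : forall r, R0 <= r ->
    `|Vb0 r - Vb1 r| + `|derive1 Vb0 r - derive1 Vb1 r| <= K * th ;
  euler1_corner0 : Vb0 R0 = - vp0 0 ;
  euler1_corner1 : Vb1 R0 = - vp0 th
}.

(* C^3 up to the boundary is the regularity needed for d_RR u_s and the one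
   allowed at the corners by the construction of the source. *)
Record euler1 (th eps : R) (ue0 vp0 Vb0 Vb1 chi : R -> R)
    (ve1 : R -> R -> R) : Prop := Euler1 {
  euler1_class : class_C2 3 ve1 ;
  euler1_eq : forall w r : R, 0 < w < th -> R0 < r ->
    euler1_op ue0 ve1 w r = euler1_source th eps ue0 vp0 Vb0 Vb1 chi w r ;
  euler1_bottom : forall w : R, 0 <= w <= th -> ve1 w R0 = - vp0 w ;
  euler1_left : forall r, R0 <= r -> ve1 0 r = Vb0 r ;
  euler1_right : forall r, R0 <= r -> ve1 th r = Vb1 r ;
  euler1_infty : forall e : R, 0 < e ->
    \forall r \near +oo, forall w : R, 0 <= w <= th -> `|ve1 w r| <= e
}.

Definition ue1 (ub1 : R -> R) (ve1 : R -> R -> R) (w r : R) : R :=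
  ub1 r - \int[@lebesgue_measure R]_(w' in `[0, w])
            d2 (fun a s => s * ve1 a s) w' r.

Definition us (eps : R) (ue0 ub1 : R -> R) (up ve1 : R -> R -> R)
    (w x : R) : R :=
  ue0 (r_of eps x) + up w x + Num.sqrt eps * ue1 ub1 ve1 w (r_of eps x).

(* r v *)
Definition mul_r (eps : R) (v : R -> R -> R) (w x : R) : R :=
  r_of eps x * v w x.

Definition normB2 (th eps delta : R) (v : R -> R -> R) : \bar R :=
  iint R0 th (fun w x =>
    r_of eps x `^ delta * `|d2 (mul_r eps v) w x| ^+ 2
    + eps * (d1 v w x) ^+ 2 * r_of eps x `^ delta
    + eps * (v w x) ^+ 2 * r_of eps x `^ delta).

(* Functions v on Omega with finite B-norm vanishing on {R = R0} and
   {omega = 0}.  As for Sobolev functions, v is absolutely continuous on almost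
   every coordinate line, so that d_R(rv) and d_omega v are defined almost
   everywhere as classical derivatives. *)
Record spaceB0 (th eps delta : R) (v : R -> R -> R) : Prop := SpaceB0 {
  spaceB0_meas :
    measurable_fun (`]0, th[ `*` `]R0, +oo[) (fun z : R * R => v z.1 z.2) ;
  spaceB0_meas1 :
    measurable_fun (`]0, th[ `*` `]R0, +oo[) (fun z : R * R => d1 v z.1 z.2) ;
  spaceB0_meas2 :
    measurable_fun (`]0, th[ `*` `]R0, +oo[)
      (fun z : R * R => d2 (mul_r eps v) z.1 z.2) ;
  spaceB0_ac2 : {ae @lebesgue_measure R, forall w : R, 0 < w < th ->
    forall b, R0 < b -> abs_cont R0 b (mul_r eps v w)} ;
  spaceB0_ac1 : {ae @lebesgue_measure R, forall x, R0 < x ->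
    abs_cont 0 th (fun w => v w x)} ;
  spaceB0_bottom : forall w : R, 0 < w < th -> v w R0 = 0 ;
  spaceB0_left : forall x, R0 < x -> v 0 x = 0 ;
  spaceB0_norm : (normB2 th eps delta v < +oo)%E
}.

End profile.

(* Main.v *)
Require Import Defs.
From HB Require Import structures.
From mathcomp Require Import all_boot all_order all_algebra.
From mathcomp Require Import all_classical all_reals all_analysis.
From mathcomp Require Import measurable_realfun ring lra.

(** Write [q = r v], [rho = r^delta] and [kappa = d_R u_s / u_s].  Since
    [d_RR u_s / u_s = kappa' + kappa^2], integration by parts along a ray gives
      int rho (q' - kappa q)^2
        = int rho q'^2 + int rho (q / u_s)^2 u_s d_RR u_s + int rho' kappa q^2,
    and the left-hand side is [int rho u_s^2 ((q / u_s)')^2].  As [kappa] decays, a Hardy-type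
    estimate of [q / u_s] shows that it controls [int rho q'^2].  In the error term
    [rho' = O(sqrt eps)]; the part of [kappa] of size [sqrt eps] gives [eps rho v^2], whose
    integral is [O(th^2) ||v||_B^2] by the Poincare inequality in [omega], and the other part
    gives [O(sqrt eps)] times the dissipation.

    What this needs is a lower bound on [u_s] and
      |d_R u_s| <= A (sqrt eps (1 + r - R0)^-4 + (1 + R - R0)^-4)
    with constants independent of [eps] and of the angle, and some decay of [d_RR u_s] with no
    uniformity.  For the Prandtl part both come from the maximum principle with polynomial
    barriers, applied to [d_R u_p] and to [R0 d_RR u_p / (u_e + u_p)].  For the Euler corrector,
    [e^t v(omega, e^t)] solves an elliptic equation on a thin half-strip, where
    [e^(- N t) (2 - (omega / th)^2)] is a supersolution; translations in [t] change only the
    bounded zeroth-order coefficient and the source, so that difference quotients satisfy the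
    same kind of bounds, uniformly in [eps]. *)

Set Implicit Arguments.
Unset Strict Implicit.
Unset Printing Implicit Defensive.

Import Order.TTheory GRing.Theory Num.Theory.
Import numFieldNormedType.Exports.

Local Open Scope classical_set_scope.
Local Open Scope ring_scope.

(** * Derivatives and maximum principles *)

(** The cutoffs in the source of the corrector vary on the angular scale [eps], so its angular
    derivatives are not bounded uniformly. They do not depend on [r], however, and every estimate
    differentiates in [t = ln r] only. Multiplied by [r^2] and written for [r v], the Euler operator
    has no first-order term, and a thin sector makes its zeroth-order term harmless whatever its
    sign. At the bottom of the strip the first [t]-derivative comes from a barrier and the second
    from the equation, since the datum fixes the angular derivatives there. The third is bounded for
    each solution separately; this is enough, because [d_RR u_s] has to be small only for the
    potential to be integrable.

    The order of the choices matters. The bounds on the corrector depend on [th], [Vb0] and [Vb1],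
    but always carry a factor [sqrt eps], which is taken small after them. The final constant thus
    involves only [R0], the lower bound of [u_s] and the constant [A], all fixed before [th]. *)

Section derivatives.
Context {R : realType}.
Implicit Types (f g : R -> R) (x a b c l : R).

Definition der f x l : Prop := is_derive x 1 f l.

Lemma der_eq f x a b : der f x a -> a = b -> der f x b.
Proof. by move=> h <-. Qed.

Lemma der_derivable f x l : der f x l -> derivable f x 1.
Proof. by move=> h; exact: (@ex_derive _ _ _ _ _ _ _ h). Qed.

Lemma der_derive1 f x l : der f x l -> derive1 f x = l.
Proof. by move=> h; rewrite derive1E; exact: derive_val. Qed.

Lemma derivable_der f x : derivable f x 1 -> der f x (derive1 f x).
Proof. by move=> h; rewrite derive1E; exact: derivableP. Qed.

Lemma der_unique f x a b : der f x a -> der f x b -> a = b.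
Proof. by move=> /der_derive1 <- /der_derive1. Qed.

Lemma der_continuous f x l : der f x l -> {for x, continuous f}.
Proof. by move=> /der_derivable h; apply/differentiable_continuous/derivable1_diffP. Qed.

Lemma derD f g x a b : der f x a -> der g x b -> der (fun y => f y + g y) x (a + b).
Proof. exact: is_deriveD. Qed.
Lemma derB f g x a b : der f x a -> der g x b -> der (fun y => f y - g y) x (a - b).
Proof. exact: is_deriveB. Qed.
Lemma derN f x a : der f x a -> der (fun y => - f y) x (- a).
Proof. exact: is_deriveN. Qed.
Lemma derM f g x a b : der f x a -> der g x b ->
  der (fun y => f y * g y) x (a * g x + f x * b).
Proof.
move=> fa gb; rewrite addrC; have := is_deriveM fa gb.
by rewrite /GRing.scale /= (mulrC (g x)).
Qed.
Lemma der_cst c x : der (fun=> c) x 0.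
Proof. exact: is_derive_cst. Qed.
Lemma der_id x : der (fun y => y) x 1.
Proof. exact: is_derive_id. Qed.
Lemma der_comp f g x a b : der f (g x) a -> der g x b ->
  der (fun y => f (g y)) x (b * a).
Proof. move=> fa gb. have := @is_derive1_comp R f g x a b fa gb. by rewrite mulrC. Qed.
Lemma derX f n x a : der f x a -> der (fun y => f y ^+ n) x (n%:R * f x ^+ n.-1 * a).
Proof.
move=> fa; have := @is_deriveX R _ f n x 1 a fa.
by have -> : f ^+ n = (fun y => f y ^+ n) by apply/funext => y; rewrite fctE.
Qed.
Lemma derV f x a : der f x a -> f x != 0 -> der (fun y => (f y)^-1) x (- a / f x ^+ 2).
Proof.
move=> fa fx0; apply: (der_eq (@is_deriveV R f x a 1 fx0 fa)).
by rewrite /GRing.scale /= !mulNr mulrC.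
Qed.
Lemma derZ f x c a : der f x a -> der (fun y => c * f y) x (c * a).
Proof.
by move=> fa; apply: (der_eq (derM (der_cst c x) fa)); rewrite mul0r add0r.
Qed.
Lemma der_div f g x a b : der f x a -> der g x b -> g x != 0 ->
  der (fun y => f y / g y) x ((a * g x - f x * b) / g x ^+ 2).
Proof.
move=> fa gb gx0; apply: (der_eq (derM fa (derV gb gx0))).
by field.
Qed.
Lemma der_exp f x a : der f x a -> der (fun y => expR (f y)) x (a * expR (f x)).
Proof. by move=> fa; apply: der_comp => //; exact: is_derive_expR. Qed.

Lemma der_near f g x a : (\near x, f x = g x) -> der f x a -> der g x a.
Proof. exact: near_eq_is_derive. Qed.

Lemma der_congr_gt f g c x a : c < x -> (forall y, c < y -> f y = g y) ->
  der f x a -> der g x a.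
Proof.
move=> cx fg; apply: der_near; near=> y; apply: fg.
by near: y; exact: lt_nbhsr.
Unshelve. all: by end_near. Qed.

Lemma der_congr_oo f g c d x a : c < x < d -> (forall y, c < y < d -> f y = g y) ->
  der f x a -> der g x a.
Proof.
move=> /andP[cx xd] fg; apply: der_near; near=> y; apply: fg.
by apply/andP; split; near: y; [exact: lt_nbhsr|exact: lt_nbhsl].
Unshelve. all: by end_near. Qed.

Lemma der_mvt f (df : R -> R) a b : a < b ->
  (forall x, a < x < b -> der f x (df x)) -> {within `[a, b], continuous f} ->
  exists2 c, a < c < b & f b - f a = df c * (b - a).
Proof.
move=> ab fd fc; have [|c] := @MVT R f df a b ab _ fc.
  by move=> x; rewrite in_itv /=; exact: fd.
by rewrite in_itv /= => cab e; exists c.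
Qed.

Lemma der_mvt' f (df : R -> R) a b : a < b ->
  (forall x, a <= x <= b -> der f x (df x)) ->
  exists2 c, a < c < b & f b - f a = df c * (b - a).
Proof.
move=> ab fd; apply: der_mvt => //.
  by move=> x /andP[ax xb]; apply: fd; rewrite !ltW.
by apply: derivable_within_continuous => x; rewrite in_itv /= => /fd /der_derivable.
Qed.

Lemma der_at_max f p l e : 0 < e -> (forall x, `|x - p| < e -> f x <= f p) ->
  (forall x, `|x - p| < e -> derivable f x 1) -> der f p l -> l = 0.
Proof.
move=> e0 fm fd fl; apply: (der_unique fl).
apply: (@derive1_at_max R f (p - e) (p + e)).
- by lra.
- by move=> t; rewrite in_itv /= => ht; apply: fd; rewrite ltr_distl.
- by rewrite in_itv /=; apply/andP; split; lra.
- by move=> t; rewrite in_itv /= => ht; apply: fm; rewrite ltr_distl.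
Qed.

(** A positive [l] would make [df] positive just to the right of [p], and the mean value theorem
    would then produce values of [f] larger than [f p]. *)
Lemma der2_at_max f (df : R -> R) p l e : 0 < e ->
  (forall x, `|x - p| < e -> f x <= f p) ->
  (forall x, `|x - p| < e -> der f x (df x)) -> der df p l -> df p = 0 /\ l <= 0.
Proof.
move=> e0 fm fd fl.
have df0 : df p = 0.
  apply: (@der_at_max f p (df p) e) => //.
    by move=> x /fd /der_derivable.
  by apply: fd; rewrite subrr normr0.
split=> //; rewrite leNgt; apply/negP => l0.
have : \forall x \near p^'+, 0 < df x.
  have h : (fun h => h^-1 *: (df (h *: 1 + p) - df p)) @ 0^' --> l.
    by case: fl => h1 h2; rewrite -h2; exact: h1.
  have hl : \forall h \near (0 : R)^', 0 < h^-1 *: (df (h *: 1 + p) - df p).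
    by apply: (h [set y | 0 < y]); exact: lt_nbhsr.
  have /nbhs_ballP[d /= d0 hd] : nbhs (0 : R)
      (fun h => h != 0 -> 0 < h^-1 *: (df (h *: 1 + p) - df p)) := hl.
  apply/nbhs_ballP; exists d => //= x.
  rewrite /ball /= => xd px.
  have := hd (x - p); rewrite /ball /= sub0r normrN distrC => /(_ xd).
  rewrite /GRing.scale /= mulr1 subrK df0 subr0 => /(_ _).
  by rewrite pmulr_rgt0 ?invr_gt0 ?subr_gt0//; apply; rewrite subr_eq0 gt_eqF.
move=> hr; have /nbhs_ballP[d /= d0 hd] : nbhs p (fun x => p < x -> 0 < df x) := hr.
pose x := p + Num.min d e / 2.
have m0 : 0 < Num.min d e by rewrite lt_min d0 e0.
have md : Num.min d e <= d by rewrite ge_min lexx.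
have me : Num.min d e <= e by rewrite ge_min lexx orbT.
have px : p < x by rewrite /x; lra.
have [y /andP[py yx] E] : exists2 c, p < c < x & f x - f p = df c * (x - p).
  apply: der_mvt' => // y /andP[py yx]; apply: fd.
  by rewrite ger0_norm; move: yx; rewrite /x; lra.
have : f x <= f p.
  by apply: fm; rewrite ger0_norm /x; lra.
apply/negP; rewrite -ltNge -subr_gt0 E mulr_gt0 ?subr_gt0//.
apply: hd => //; rewrite /ball /= distrC ger0_norm; move: yx; rewrite /x; lra.
Qed.

Lemma der_at_max_right f p l a : a < p -> (forall x, a < x <= p -> f x <= f p) ->
  der f p l -> 0 <= l.
Proof.
move=> ap fm fl; rewrite leNgt; apply/negP => l0.
have h : (fun h => h^-1 *: (f (h *: 1 + p) - f p)) @ 0^' --> l.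
  by case: fl => h1 h2; rewrite -h2; exact: h1.
have hl : \forall h \near (0 : R)^', h^-1 *: (f (h *: 1 + p) - f p) < 0.
  by apply: (h [set y | y < 0]); exact: lt_nbhsl.
have /nbhs_ballP[d /= d0 hd] : nbhs (0 : R)
    (fun h => h != 0 -> h^-1 *: (f (h *: 1 + p) - f p) < 0) := hl.
pose h0 := - (Num.min d (p - a) / 2).
have m0 : 0 < Num.min d (p - a) by rewrite lt_min d0 subr_gt0.
have md : Num.min d (p - a) <= d by rewrite ge_min lexx.
have me : Num.min d (p - a) <= p - a by rewrite ge_min lexx orbT.
have := hd h0; rewrite /ball /= sub0r normrN.
have -> : `|h0| < d by rewrite ler0_norm /h0; lra.
have h00 : h0 < 0 by rewrite /h0; lra.
move=> /(_ erefl) /(_ _); rewrite lt_eqF// => /(_ erefl).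
rewrite /GRing.scale /= mulr1 nmulr_rlt0 ?invr_lt0// subr_gt0.
apply/negP; rewrite -leNgt; apply: fm; rewrite /h0; apply/andP; split; lra.
Qed.

End derivatives.

(** * Comparison by touching with a multiple of the barrier *)

Section maximum_principles.
Context {R : realType}.
Implicit Types (z phi g : R -> R -> R).

(** First and second derivatives at the single point [x], the first one existing in a neighbourhood.
    Solutions and barriers can then be compared at a touching point without formulas for their
    derivatives elsewhere. *)
Definition twice (f : R -> R) (x l1 l2 : R) : Prop :=
  exists e (df : R -> R), [/\ 0 < e, forall y, `|y - x| < e -> der f y (df y),
    df x = l1 & der df x l2].

Lemma twiceB (f g : R -> R) x a a' b b' : twice f x a a' -> twice g x b b' ->
  twice (fun y => f y - g y) x (a - b) (a' - b').
Proof.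
move=> [e [df [e0 fd <- fd2]]] [e' [dg [e0' gd <- gd2]]].
exists (Num.min e e'), (fun y => df y - dg y); split => //.
- by rewrite lt_min e0.
- by move=> y; rewrite lt_min => /andP[ye ye']; apply: derB; [exact: fd|exact: gd].
- exact: derB.
Qed.

Lemma twiceZ (f : R -> R) x k a a' : twice f x a a' -> twice (fun y => k * f y) x (k * a) (k * a').
Proof.
move=> [e [df [e0 fd <- fd2]]]; exists e, (fun y => k * df y); split => //.
- by move=> y ye; apply: derZ; exact: fd.
- exact: derZ.
Qed.

Lemma twice_max (f : R -> R) x a a' e : twice f x a a' -> 0 < e ->
  (forall y, `|y - x| < e -> f y <= f x) -> a = 0 /\ a' <= 0.
Proof.
move=> [e' [df [e0' fd <- fd2]]] e0 fm.
apply: (@der2_at_max _ f df x a' (Num.min e e')) => //.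
- by rewrite lt_min e0.
- by move=> y; rewrite lt_min => /andP[ye _]; exact: fm.
- by move=> y; rewrite lt_min => /andP[_ ye]; exact: fd.
Qed.

Lemma twice_der (f : R -> R) x a a' : twice f x a a' -> der f x a.
Proof. by move=> [e [df [e0 fd <- _]]]; apply: fd; rewrite subrr normr0. Qed.

Definition cont2 g (w x : R) : Prop :=
  {for (w, x), continuous (fun q : R * R => g q.1 q.2)}.

(** [k] is the maximum of the quotient of [z] by [phi] over the rectangle. Comparing with a multiple
    of the barrier, rather than through a difference, later allows zeroth-order coefficients of
    either sign. *)
Lemma touching a b c d z phi :
  (forall w x, a <= w <= b -> c <= x <= d -> cont2 z w x) ->
  (forall w x, a <= w <= b -> c <= x <= d -> cont2 phi w x) ->
  (forall w x, a <= w <= b -> c <= x <= d -> 0 < phi w x) ->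
  forall w0 x0, a <= w0 <= b -> c <= x0 <= d -> phi w0 x0 < z w0 x0 ->
  exists k w x, [/\ 1 < k, a <= w <= b, c <= x <= d, z w x = k * phi w x &
    forall w' x', a <= w' <= b -> c <= x' <= d -> z w' x' <= k * phi w' x'].
Proof.
move=> zc pc p0 w0 x0 hw0 hx0 zp0.
pose A : set (R * R) := `[a, b] `*` `[c, d].
have A0 : A !=set0 by exists (w0, x0); split; rewrite /= in_itv.
have cA : compact A by apply: compact_setX; exact: segment_compact.
have cf : {within A, continuous (fun q : R * R => z q.1 q.2 / phi q.1 q.2)}.
  apply: continuous_in_subspaceT => -[w x]; rewrite inE /A /= !in_itv /= => -[hw hx].
  apply: cvgM; first exact: zc.
  by apply: cvgV; [rewrite gt_eqF// p0|exact: pc].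
have [[w x]] := compact_EVT_max A0 cA cf.
rewrite inE /A /= !in_itv /= => -[hw hx] m.
exists (z w x / phi w x), w, x; split => //.
- apply: (@lt_le_trans _ _ (z w0 x0 / phi w0 x0)).
    by rewrite ltr_pdivlMr ?mul1r// p0.
  by apply: (m (w0, x0)); rewrite inE /A /=; split; rewrite /= in_itv.
- by rewrite divfK// gt_eqF// p0.
- move=> w' x' hw' hx'; rewrite -ler_pdivrMr ?p0//.
  by apply: (m (w', x')); rewrite inE /A /=; split; rewrite /= in_itv.
Qed.

(** At an interior touching point the operator applied to [z] is at least [k] times its value on
    [phi]. That value is positive and [k > 1], which contradicts the assumed inequality between the
    two. *)
Lemma elliptic_comparison a b c d z phi :
  (forall w x, a <= w <= b -> c <= x <= d -> cont2 z w x) ->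
  (forall w x, a <= w <= b -> c <= x <= d -> cont2 phi w x) ->
  (forall w x, a <= w <= b -> c <= x <= d -> 0 < phi w x) ->
  (forall w x, a <= w <= b -> c <= x <= d ->
     [|| w == a, w == b, x == c | x == d] -> z w x <= phi w x) ->
  (forall w x, a < w < b -> c < x < d ->
     exists zx zxx zw zww px pxx pw pww q,
     [/\ twice (z w) x zx zxx, twice (z^~ x) w zw zww,
         twice (phi w) x px pxx, twice (phi^~ x) w pw pww &
       - zxx - zww + q * z w x <= - pxx - pww + q * phi w x /\
       0 < - pxx - pww + q * phi w x]) ->
  forall w x, a <= w <= b -> c <= x <= d -> z w x <= phi w x.
Proof.
move=> zc pc p0 bd H w0 x0 hw0 hx0; rewrite leNgt; apply/negP => zp0.
have [k [w [x [k1 hw hx zk m]]]] := touching zc pc p0 hw0 hx0 zp0.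
have nbd : ~~ [|| w == a, w == b, x == c | x == d].
  apply/negP => /(bd w x hw hx); rewrite zk leNgt => /negP; apply.
  by rewrite ltr_pMl// p0.
move: nbd; rewrite !negb_or => /and4P[wa wb xc xd].
have hw' : a < w < b by rewrite lt_neqAle eq_sym wa lt_neqAle wb.
have hx' : c < x < d by rewrite lt_neqAle eq_sym xc lt_neqAle xd.
have [zx [zxx [zw [zww [px [pxx [pw [pww [q [h1 h2 h3 h4 [h5 h6]]]]]]]]]]] := H w x hw' hx'.
have [_ t1] : zx - k * px = 0 /\ zxx - k * pxx <= 0.
  apply: (@twice_max _ _ _ _ (Num.min (x - c) (d - x)) (twiceB h1 (twiceZ k h3))).
    by rewrite lt_min !subr_gt0.
  move=> y; rewrite lt_min !ltr_norml => /andP[/andP[? ?] /andP[? ?]].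
  by rewrite zk subrr subr_le0; apply: m => //; lra.
have [_ t2] : zw - k * pw = 0 /\ zww - k * pww <= 0.
  apply: (@twice_max _ _ _ _ (Num.min (w - a) (b - w)) (twiceB h2 (twiceZ k h4))).
    by rewrite lt_min !subr_gt0.
  move=> y; rewrite lt_min !ltr_norml => /andP[/andP[? ?] /andP[? ?]].
  by rewrite zk subrr subr_le0; apply: m => //; lra.
have : k * (- pxx - pww + q * phi w x) <= - pxx - pww + q * phi w x.
  apply: le_trans h5; rewrite zk; lra.
by rewrite leNgt ltr_pMl// k1.
Qed.

(** Here the touching point may lie on the last slice [w = b], where the time derivatives satisfy a
    one-sided inequality only; its direction is the useful one because [al] is nonnegative. The
    first-order terms in [x] agree exactly. *)
Lemma parabolic_comparison a b c d z phi : a < b ->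
  (forall w x, a <= w <= b -> c <= x <= d -> cont2 z w x) ->
  (forall w x, a <= w <= b -> c <= x <= d -> cont2 phi w x) ->
  (forall w x, a <= w <= b -> c <= x <= d -> 0 < phi w x) ->
  (forall w x, a <= w <= b -> c <= x <= d ->
     [|| w == a, x == c | x == d] -> z w x <= phi w x) ->
  (forall w x, a < w <= b -> c < x < d ->
     exists zx zxx zw px pxx pw al be nu q,
     [/\ twice (z w) x zx zxx, der (z^~ x) w zw,
         twice (phi w) x px pxx, der (phi^~ x) w pw &
       [/\ 0 <= al, 0 <= nu,
        al * zw + be * zx - nu * zxx + q * z w x
          <= al * pw + be * px - nu * pxx + q * phi w x &
        0 < al * pw + be * px - nu * pxx + q * phi w x]]) ->
  forall w x, a <= w <= b -> c <= x <= d -> z w x <= phi w x.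
Proof.
move=> ab zc pc p0 bd H w0 x0 hw0 hx0; rewrite leNgt; apply/negP => zp0.
have [k [w [x [k1 hw hx zk m]]]] := touching zc pc p0 hw0 hx0 zp0.
have nbd : ~~ [|| w == a, x == c | x == d].
  apply/negP => /(bd w x hw hx); rewrite zk leNgt => /negP; apply.
  by rewrite ltr_pMl// p0.
move: nbd; rewrite !negb_or => /and3P[wa xc xd].
have hw' : a < w <= b by rewrite lt_neqAle eq_sym wa.
have hx' : c < x < d by rewrite lt_neqAle eq_sym xc lt_neqAle xd.
have [zx [zxx [zw [px [pxx [pw [al [be [nu [q [h1 h2 h3 h4 [al0 nu0 h5 h6]]]]]]]]]]]] := H w x hw' hx'.
have [t0 t1] : zx - k * px = 0 /\ zxx - k * pxx <= 0.
  apply: (@twice_max _ _ _ _ (Num.min (x - c) (d - x)) (twiceB h1 (twiceZ k h3))).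
    by rewrite lt_min !subr_gt0.
  move=> y; rewrite lt_min !ltr_norml => /andP[/andP[? ?] /andP[? ?]].
  by rewrite zk subrr subr_le0; apply: m => //; lra.
have t2 : 0 <= zw - k * pw.
  case/andP: hw' => aw _.
  apply: (der_at_max_right aw _ (derB h2 (derZ k h4))) => y /andP[? ?].
  by rewrite zk subrr subr_le0; apply: m => //; lra.
have : k * (al * pw + be * px - nu * pxx + q * phi w x) <= al * pw + be * px - nu * pxx + q * phi w x.
  apply: le_trans h5; rewrite zk.
  have e1 : al * (k * pw) <= al * zw by apply: ler_wpM2l => //; lra.
  have e2 : nu * zxx <= nu * (k * pxx) by apply: ler_wpM2l => //; lra.
  have -> : zx = k * px by lra.
  lra.
by rewrite leNgt ltr_pMl// k1.
Qed.

End maximum_principles.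

(** * Symmetry of mixed second derivatives *)

Section schwarz.
Context {R : realType}.
Implicit Types g : R -> R -> R.

Lemma cont2_dist g w x e : 0 < e -> cont2 g w x ->
  exists2 d, 0 < d & forall w' x', `|w' - w| < d -> `|x' - x| < d ->
    `|g w x - g w' x'| < e.
Proof.
move=> e0 gc.
have : \forall q \near (w, x), `|g w x - g q.1 q.2| < e.
  by move/cvgrPdist_lt: gc => /(_ _ e0).
move=> [[A B] /= [/nbhs_ballP[d /= d0 hd] /nbhs_ballP[d' /= d0' hd']] sub].
exists (Num.min d d'); first by rewrite lt_min d0.
move=> w' x'; rewrite !lt_min => /andP[hw _] /andP[_ hx].
by apply: (sub (w', x')); split; [apply: hd|apply: hd']; rewrite /ball /= distrC.
Qed.

(* The double difference is evaluated by the mean value theorem in both orders. *)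
Lemma schwarz g gw gx gxw gwx :
  (forall w x : R, der (g^~ x) w (gw w x)) -> (forall w x : R, der (g w) x (gx w x)) ->
  (forall w x : R, der (gx^~ x) w (gxw w x)) -> (forall w x : R, der (gw w) x (gwx w x)) ->
  (forall w x, cont2 gxw w x) -> (forall w x, cont2 gwx w x) ->
  forall w x, gxw w x = gwx w x.
Proof.
move=> g1 g2 g21 g12 c21 c12 w x.
apply/eqP; rewrite -subr_eq0 -normr_le0; apply/ler_addgt0Pr => e e0; rewrite add0r.
have e2 : 0 < e / 2 by rewrite divr_gt0.
have [d' d0' hd'] := cont2_dist e2 (c21 w x).
have [d'' d0'' hd''] := cont2_dist e2 (c12 w x).
have [d d0 hd] : exists2 d, 0 < d & forall w' x', `|w' - w| < d -> `|x' - x| < d ->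
   `|gxw w x - gxw w' x'| < e / 2 /\ `|gwx w x - gwx w' x'| < e / 2.
  exists (Num.min d' d''); first by rewrite lt_min d0'.
  move=> w' x'; rewrite !lt_min => /andP[? ?] /andP[? ?].
  by split; [exact: hd'|exact: hd''].
pose h := d / 2; have h0 : 0 < h by rewrite divr_gt0.
have hd2 : h < d by rewrite /h; lra.
have [u1 [v1 [hu1 hv1 E1]]] : exists u v, [/\ w < u < w + h, x < v < x + h &
    (g (w + h) (x + h) - g (w + h) x) - (g w (x + h) - g w x) = gxw u v * h * h].
  have [|v hv E] := @der_mvt' R (fun y => g (w + h) y - g w y)
    (fun y => gx (w + h) y - gx w y) x (x + h) _ (fun y _ => derB (g2 _ _) (g2 _ _)).
    by lra.
  have [|u hu E'] := @der_mvt' R (gx^~ v) (gxw^~ v) w (w + h) _ (fun y _ => g21 _ _).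
    by lra.
  by exists u, v; split => //; move: E; rewrite E'; lra.
have [u2 [v2 [hu2 hv2 E2]]] : exists u v, [/\ w < u < w + h, x < v < x + h &
    (g (w + h) (x + h) - g (w + h) x) - (g w (x + h) - g w x) = gwx u v * h * h].
  have [|u hu E] := @der_mvt' R (fun y => g y (x + h) - g y x)
    (fun y => gw y (x + h) - gw y x) w (w + h) _ (fun y _ => derB (g1 _ _) (g1 _ _)).
    by lra.
  have [|v hv E'] := @der_mvt' R (gw u) (gwx u) x (x + h) _ (fun y _ => g12 _ _).
    by lra.
  by exists u, v; split => //; move: E; rewrite E'; lra.
have E : gxw u1 v1 = gwx u2 v2.
  have hn : h != 0 by rewrite gt_eqF.
  by apply: (mulIf hn); apply: (mulIf hn); rewrite -E1 -E2.
have [A1 _] : `|gxw w x - gxw u1 v1| < e / 2 /\ `|gwx w x - gwx u1 v1| < e / 2.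
  by apply: hd; rewrite ger0_norm; lra.
have [_ A2] : `|gxw w x - gxw u2 v2| < e / 2 /\ `|gwx w x - gwx u2 v2| < e / 2.
  by apply: hd; rewrite ger0_norm; lra.
move: A1 A2; rewrite E !ltr_norml ler_norml => /andP[? ?] /andP[? ?].
apply/andP; split; lra.
Qed.

Lemma schwarz_class_C2 g w x : class_C2 2 g -> d1 (d2 g) w x = d2 (d1 g) w x.
Proof.
move=> [gc [g1 g2 [_ [d1d1 d1d2 _ [c12 _]]] [_ [d2d1 d2d2 [c21 _] _]]]].
apply: (@schwarz g (d1 g) (d2 g)) => w' x'.
- exact: (derivable_der (g1 w' x')).
- exact: (derivable_der (g2 w' x')).
- exact: (derivable_der (d2d1 w' x')).
- exact: (derivable_der (d1d2 w' x')).
- exact: (c21 (w', x')).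
- exact: (c12 (w', x')).
Qed.

End schwarz.

(** * Decay for parabolic equations *)

Section integrals_of_continuous_functions.
Context {R : realType}.
Notation mu := (@lebesgue_measure R).
Implicit Types (g : R -> R) (a b x : R).

Lemma continuous_integrable g a b : continuous g -> mu.-integrable `[a, b] (EFin \o g).
Proof.
move=> cg; apply: continuous_compact_integrable; first exact: segment_compact.
exact: continuous_subspaceT.
Qed.

Lemma der_integral g a x : continuous g -> a < x ->
  der (fun y => \int[mu]_(t in `[a, y]) g t) x (g x).
Proof.
move=> cg ax.
have [d e] := @continuous_FTC1_closed R g a x (x + 1) ltac:(lra)
  (continuous_integrable _ _ cg) ax (cg x).
by rewrite -e; exact: derivable_der.
Qed.

Lemma Rintegral_le_bound g a x (M : R) : a <= x -> mu.-integrable `[a, x] (EFin \o g) ->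
  (forall t, a <= t <= x -> `|g t| <= M) -> `|\int[mu]_(t in `[a, x]) g t| <= M * (x - a).
Proof.
move=> ax ig hM.
apply: (le_trans (le_normr_Rintegral _ ig)) => //.
have -> : M * (x - a) = \int[mu]_(t in `[a, x]) M.
  rewrite Rintegral_cst//= lebesgue_measure_itv/= lte_fin.
  case: ifPn => //=; rewrite -leNgt => xa.
  have -> : x = a by lra.
  by rewrite subrr.
apply: le_Rintegral => //.
- exact: (integrable_norm ig).
- by apply: continuous_integrable => ?; exact: cvg_cst.
Qed.

Lemma continuous_Rintegral_le_bound g a x (M : R) : a <= x -> continuous g ->
  (forall t, a <= t <= x -> `|g t| <= M) -> `|\int[mu]_(t in `[a, x]) g t| <= M * (x - a).
Proof. by move=> ax cg; apply: Rintegral_le_bound => //; exact: continuous_integrable. Qed.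

End integrals_of_continuous_functions.

(** * Functions of class [C^k] on the plane *)

Section regularity_classes.
Context {R : realType}.
Implicit Types (f : R -> R) (g : R -> R -> R).

Lemma class_C2_continuous k g : class_C2 k g -> continuous (fun q : R * R => g q.1 q.2).
Proof. by case: k => [|k] []. Qed.

Lemma class_C2_cont k g w x : class_C2 k g -> cont2 g w x.
Proof. by move=> /class_C2_continuous h; exact: (h (w, x)). Qed.

Lemma class_C2_pred k g : class_C2 k.+1 g -> class_C2 k g.
Proof.
elim: k g => [|k IH] g; first by case.
move=> [cg [h1 h2 h3 h4]]; split; first exact: cg.
by split; [exact: h1|exact: h2|exact: IH h3|exact: IH h4].
Qed.

Lemma class_C2_d1 k g : class_C2 k.+1 g -> class_C2 k (d1 g).
Proof. by move=> [_ []]. Qed.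

Lemma class_C2_d2 k g : class_C2 k.+1 g -> class_C2 k (d2 g).
Proof. by move=> [_ []]. Qed.

Lemma class_C2_der1 k g w x : class_C2 k.+1 g -> der (g^~ x) w (d1 g w x).
Proof. by move=> [_ [h _ _ _]]; exact: derivable_der. Qed.

Lemma class_C2_der2 k g w x : class_C2 k.+1 g -> der (g w) x (d2 g w x).
Proof. by move=> [_ [_ h _ _]]; exact: derivable_der. Qed.

Lemma class_C2_cont1 k g x : class_C2 k g -> continuous (g^~ x).
Proof.
move=> /class_C2_continuous cg w.
apply: (@continuous_comp _ _ _ (fun w => (w, x)) (fun q : R * R => g q.1 q.2)).
  by apply: (@cvg_pair _ _ _ _ (nbhs w) (nbhs x)); [exact: cvg_id|exact: cvg_cst].
exact: cg.
Qed.

Lemma class_C2_cont2 k g w : class_C2 k g -> continuous (g w).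
Proof.
move=> /class_C2_continuous cg x.
apply: (@continuous_comp _ _ _ (fun x => (w, x)) (fun q : R * R => g q.1 q.2)).
  by apply: (@cvg_pair _ _ _ _ (nbhs w) (nbhs x)); [exact: cvg_cst|exact: cvg_id].
exact: cg.
Qed.

Lemma class_C2_twice k g w x : class_C2 k.+2 g ->
  twice (g w) x (d2 g w x) (d2 (d2 g) w x).
Proof.
move=> h; exists 1, (d2 g w); split; [exact: ltr01| |reflexivity|].
  by move=> y _; exact: class_C2_der2 h.
exact: class_C2_der2 (class_C2_d2 h).
Qed.

End regularity_classes.
Arguments class_C2_cont {R k g} w x _.
Arguments class_C2_cont1 {R k g} x _.
Arguments class_C2_cont2 {R k g} w _.
Arguments class_C2_der1 {R k g} w x _.
Arguments class_C2_der2 {R k g} w x _.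
Arguments class_C2_twice {R k g} w x _.

(** * Polynomial barriers for parabolic equations *)

Section parabolic_decay.
Context {R : realType}.
Variable R0 : R.

(** Polynomial weights are compatible with a drift growing linearly in [x]: differentiating [ipow n]
    gains exactly the factor that such a drift costs. *)
Definition ipow n x : R := ((1 + (x - R0)) ^+ n)^-1.

Lemma ipow_gt0 n x : R0 <= x -> 0 < ipow n x.
Proof. by move=> hx; rewrite invr_gt0 exprn_gt0//; lra. Qed.

Lemma ipow_le1 n x : R0 <= x -> ipow n x <= 1.
Proof.
by move=> hx; rewrite /ipow invf_le1 ?exprn_gt0 ?exprn_ege1//; lra.
Qed.

Lemma ipowS n x : R0 <= x -> ipow n x = ipow n.+1 x * (1 + (x - R0)).
Proof.
move=> hx; rewrite /ipow exprS; field.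
by rewrite expf_neq0 ?andbT; apply/eqP; lra.
Qed.

Lemma ipowM m n x : R0 <= x -> ipow m x * ipow n x = ipow (m + n) x.
Proof. by move=> hx; rewrite /ipow exprD invfM. Qed.

Lemma ipow_le m n x : R0 <= x -> (m <= n)%N -> ipow n x <= ipow m x.
Proof.
move=> hx mn; rewrite -(subnK mn) -ipowM// ger_pMl ?ipow_gt0//; exact: ipow_le1.
Qed.

Lemma der_ipow n x : R0 - 1 < x -> der (ipow n) x (- (n%:R * ipow n.+1 x)).
Proof.
move=> hx; have h : 1 + (x - R0) != 0 by apply/eqP; lra.
apply: (der_eq (derV (derX n (derD (der_cst 1 x) (derB (der_id x) (der_cst R0 x)))) (expf_neq0 n h))).
rewrite /ipow; case: n => [|n]; first by rewrite !(mul0r, oppr0).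
by rewrite /= !exprS; field; rewrite h expf_neq0.
Qed.

Lemma twice_barrier a b x : R0 <= x ->
  twice (fun x => a * ipow 4 x + b * (1 + (x - R0))) x
    (- (4 * a * ipow 5 x) + b) (20 * a * ipow 6 x).
Proof.
move=> hx; exists 1, (fun y => - (4 * a * ipow 5 y) + b); split; [exact: ltr01| |reflexivity|].
  move=> y; rewrite ltr_norml => /andP[? ?].
  have h : R0 - 1 < y by lra.
  apply: (der_eq (derD (derZ a (der_ipow 4 h))
    (derZ b (derD (der_cst 1 y) (derB (der_id y) (der_cst R0 y)))))); ring.
have h : R0 - 1 < x by lra.
apply: (der_eq (derD (derN (derZ (4 * a) (der_ipow 5 h))) (der_cst b x))); ring.
Qed.

(** The angle plays the role of time; in the applications [al], the coefficient of the time
    derivative, is a velocity bounded below. *)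
Definition heat_solution (th : R) (al be q z : R -> R -> R) (nu : R) : Prop :=
  forall w x, 0 < w <= th -> R0 < x -> exists zx zxx zw,
    [/\ twice (z w) x zx zxx, der (z^~ x) w zw &
        al w x * zw + be w x * zx - nu * zxx + q w x * z w x = 0].

(** The barrier is [expR (L * w)] times the sum of a decaying term and a small growing one. The
    summands of [L] compensate the drift, the diffusion and the zeroth-order coefficient acting on
    [ipow 4], the final [1] makes the inequality strict, and [c] is the lower bound of the
    coefficient of the time derivative. *)
Lemma heat_upper_decay (th c B Q nu M A0 : R) (al be q z : R -> R -> R) :
  0 < th -> 0 < c -> 0 <= nu -> 0 < M ->
  (forall w x, 0 < w <= th -> R0 < x ->
     [/\ c <= al w x, `|be w x| <= B * (1 + (x - R0)) & - Q <= q w x]) ->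
  (forall w x, 0 <= w <= th -> R0 <= x -> cont2 z w x) ->
  (forall w x, 0 <= w <= th -> R0 <= x -> z w x <= M) ->
  (forall x, R0 <= x -> z 0 x <= A0 * ipow 4 x) ->
  heat_solution th al be q z nu ->
  let L := (4 * `|B| + 20 * nu + `|Q| + 1) / c in
  forall w x, 0 <= w <= th -> R0 <= x ->
    z w x <= expR (L * th) * ((M + `|A0|) * ipow 4 x).
Proof.
move=> th0 c0 nu0 M0 hcoef zc zM z0 zeq L w x hw hx.
have L0 : 0 < L.
  rewrite divr_gt0//; have := normr_ge0 B; have := normr_ge0 Q; lra.
have cL : c * L = 4 * `|B| + 20 * nu + `|Q| + 1 by rewrite /L mulrC divfK// gt_eqF.
set A := M + `|A0|.
have A00 : 0 < A by rewrite /A; have := normr_ge0 A0; lra.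
suff key : forall de, 0 < de -> z w x <= expR (L * w) * (A * ipow 4 x + de * (1 + (x - R0))).
  have : z w x <= expR (L * w) * (A * ipow 4 x).
    apply/ler_addgt0Pr => e e0.
    have y0 : 0 < expR (L * w) * (1 + (x - R0)) by rewrite mulr_gt0 ?expR_gt0//; lra.
    have := key (e / (expR (L * w) * (1 + (x - R0)))).
    rewrite divr_gt0// => /(_ erefl) /le_trans; apply.
    rewrite mulrDr lerD2l mulrCA divfK// gt_eqF//.
  move=> /le_trans; apply; rewrite ler_pM2r ?mulr_gt0 ?ipow_gt0//.
  by rewrite ler_expR ler_pM2l//; lra.
move=> de de0.
pose phi w x := expR (L * w) * (A * ipow 4 x + de * (1 + (x - R0))).
(* [X] lies so far out that the growing term alone exceeds [M] there; this replaces a boundary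
   condition at infinity. *)
pose X := R0 + (x - R0) + M / de + 1.
have Md : 0 < M / de by rewrite divr_gt0.
have xX : R0 <= x <= X by rewrite /X; apply/andP; split; lra.
have e1 w' : 0 <= w' -> 1 <= expR (L * w').
  by move=> ?; rewrite -expR0 ler_expR mulr_ge0// ltW.
have phi0 w' x' : R0 <= x' -> 0 < phi w' x'.
  move=> hx'; rewrite /phi mulr_gt0 ?expR_gt0// addr_gt0// mulr_gt0 ?ipow_gt0//; lra.
apply: (@parabolic_comparison R 0 th R0 X z phi) => //.
- by move=> ? ? ? /andP[? _]; apply: zc.
- move=> w' x' hw' /andP[hx' _].
  apply: cvgM.
    apply: continuous_cvg; first exact: continuous_expR.
    by apply: cvgM; [exact: cvg_cst|exact: cvg_fst].
  apply: cvgD; (apply: cvgM; first exact: cvg_cst).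
    apply: (@continuous_comp _ _ _ snd (ipow 4)); first exact: cvg_snd.
    by apply: der_continuous; apply: der_ipow => /=; lra.
  apply: cvgD; [exact: cvg_cst|apply: cvgB; [exact: cvg_snd|exact: cvg_cst]].
- by move=> ? ? ? /andP[? _]; exact: phi0.
- move=> w' x' hw' /andP[hx' hX].
  have h1 : A * ipow 4 x' <= phi w' x'.
    rewrite /phi -[leLHS]mul1r ler_pM ?e1//; [|by case/andP: hw'|].
    + by rewrite mulr_ge0 ?ltW ?ipow_gt0.
    + rewrite lerDl mulr_ge0 ?ltW//; lra.
  have h2 : de * (1 + (x' - R0)) <= phi w' x'.
    rewrite /phi -[leLHS]mul1r ler_pM ?e1//; [|by case/andP: hw'|].
    + by rewrite mulr_ge0 ?ltW//; lra.
    + by rewrite lerDr mulr_ge0 ?ltW ?ipow_gt0.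
  case/or3P => /eqP E; subst.
  + apply: le_trans h1; apply: (le_trans (z0 _ hx')).
    rewrite ler_pM2r ?ipow_gt0// /A; have := ler_norm A0; lra.
  + apply: le_trans h1; apply: (le_trans (zM _ _ hw' hx')).
    have -> : ipow 4 R0 = 1 by rewrite /ipow subrr addr0 expr1n invr1.
    rewrite mulr1 /A; have := normr_ge0 A0; lra.
  + apply: le_trans h2; apply: (le_trans (zM _ _ hw' hx')).
    rewrite mulrC -ler_pdivrMr// /X; have := normr_ge0 A0; case/andP: hw'; lra.
- move=> w' x' hw' /andP[hx' hX].
  have [zx [zxx [zw [t1 t2 E]]]] := zeq w' x' hw' hx'.
  have [hal hbe hq] := hcoef w' x' hw' hx'.
  set al' := al w' x' in hal E *; set be' := be w' x' in hbe E *; set q' := q w' x' in hq E *.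
  set y := 1 + (x' - R0) in hbe.
  have y1 : 1 < y by rewrite /y; lra.
  have x'0 : R0 <= x' by exact: ltW.
  set E0 := expR (L * w').
  have E00 : 0 < E0 := expR_gt0 _.
  have p4 : ipow 4 x' = ipow 6 x' * y ^+ 2 by rewrite (ipowS 4)// (ipowS 5)// -/y; ring.
  have p5 : ipow 5 x' = ipow 6 x' * y by rewrite (ipowS 5).
  have p0 := ipow_gt0 6 x'0.
  have tp := twiceZ E0 (twice_barrier A de x'0).
  have tw : der (phi^~ x') w' (L * phi w' x').
    apply: (der_eq (derM (der_exp (derZ L (der_id w'))) (der_cst _ w'))).
    by rewrite /phi; ring.
  have pos : 0 < al' * (L * phi w' x') + be' * (E0 * (- (4 * A * ipow 5 x') + de))
       - nu * (E0 * (20 * A * ipow 6 x')) + q' * phi w' x'.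
    have -> : al' * (L * phi w' x') + be' * (E0 * (- (4 * A * ipow 5 x') + de))
       - nu * (E0 * (20 * A * ipow 6 x')) + q' * phi w' x' =
      E0 * (A * ipow 6 x' * ((al' * L + q') * y ^+ 2 - 4 * (be' * y) - 20 * nu)
         + de * ((al' * L + q') * y + be')).
      rewrite /phi -/E0 -/y p4 p5; ring.
    have k1 : 4 * `|B| + 20 * nu + 1 <= al' * L + q'.
      have : c * L <= al' * L by rewrite ler_pM2r.
      rewrite cL; have := ler_norm Q; lra.
    have k2 : `|be'| <= `|B| * y.
      by apply: (le_trans hbe); rewrite ler_pM2r; [exact: ler_norm|lra].
    have k3 : be' <= `|B| * y by apply: le_trans k2; exact: ler_norm.
    have k4 : - be' <= `|B| * y by apply: le_trans k2; rewrite -normrN; exact: ler_norm.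
    have B0 := normr_ge0 B.
    have y2 : 1 <= y ^+ 2 by rewrite exprn_ege1// ltW.
    rewrite mulr_gt0// addr_gt0//; (apply: mulr_gt0; first by rewrite ?mulr_gt0).
      have : (4 * `|B| + 20 * nu + 1) * y ^+ 2 <= (al' * L + q') * y ^+ 2.
        by rewrite ler_wpM2r ?exprn_ge0//; lra.
      have : be' * y <= `|B| * y * y by rewrite ler_wpM2r//; lra.
      have : nu * 1 <= nu * y ^+ 2 by rewrite ler_wpM2l.
      by nra.
    have : (4 * `|B| + 20 * nu + 1) * y <= (al' * L + q') * y.
      by rewrite ler_wpM2r//; lra.
    have : 0 <= nu * y by rewrite mulr_ge0//; lra.
    have : 0 <= `|B| * y by rewrite mulr_ge0//; lra.
    by nra.
  exists zx, zxx, zw, (E0 * (- (4 * A * ipow 5 x') + de)), (E0 * (20 * A * ipow 6 x')),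
    (L * phi w' x'), al', be', nu, q'; split => //; split => //.
  + by apply: le_trans hal; exact: ltW.
  + by rewrite E ltW.
Qed.

Lemma heat_solutionN th al be q z nu :
  heat_solution th al be q z nu -> heat_solution th al be q (fun w x => - z w x) nu.
Proof.
move=> h w x hw hx; have [zx [zxx [zw [t1 t2 E]]]] := h w x hw hx.
exists (-1 * zx), (-1 * zxx), (- zw); split.
- have := twiceZ (-1) t1; congr twice; apply/funext => y; ring.
- exact: derN.
- by rewrite -[RHS]oppr0 -[in RHS]E; ring.
Qed.

Lemma heat_decay (th c B Q nu M A0 : R) (al be q z : R -> R -> R) :
  0 < th -> 0 < c -> 0 <= nu -> 0 < M ->
  (forall w x, 0 < w <= th -> R0 < x ->
     [/\ c <= al w x, `|be w x| <= B * (1 + (x - R0)) & - Q <= q w x]) ->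
  (forall w x, 0 <= w <= th -> R0 <= x -> cont2 z w x) ->
  (forall w x, 0 <= w <= th -> R0 <= x -> `|z w x| <= M) ->
  (forall x, R0 <= x -> `|z 0 x| <= A0 * ipow 4 x) ->
  heat_solution th al be q z nu ->
  exists A, 0 < A /\ forall w x, 0 <= w <= th -> R0 <= x -> `|z w x| <= A * ipow 4 x.
Proof.
move=> th0 c0 nu0 M0 hcoef zc zM z0 zeq.
set L := (4 * `|B| + 20 * nu + `|Q| + 1) / c.
exists (expR (L * th) * (M + `|A0|)); split.
  by rewrite mulr_gt0 ?expR_gt0//; have := normr_ge0 A0; lra.
move=> w x hw hx; rewrite ler_norml lerNl; apply/andP; split.
  rewrite -mulrA.
  apply: (@heat_upper_decay th c B Q nu M A0 al be q (fun w x => - z w x)) => //.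
  - by move=> w' x' hw' hx'; apply: cvgN; exact: zc.
  - by move=> w' x' hw' hx'; apply: le_trans (zM _ _ hw' hx'); rewrite -normrN ler_norm.
  - by move=> x' hx'; apply: le_trans (z0 _ hx'); rewrite -normrN ler_norm.
  - exact: heat_solutionN.
rewrite -mulrA.
apply: (@heat_upper_decay th c B Q nu M A0 al be q z) => //.
- by move=> w' x' hw' hx'; apply: le_trans (zM _ _ hw' hx'); rewrite ler_norm.
- by move=> x' hx'; apply: le_trans (z0 _ hx'); rewrite ler_norm.
Qed.

End parabolic_decay.

(** * The Prandtl profile *)

Section decay_tools.
Context {R : realType}.
#[local] Opaque d1 d2 derive1.

(** Follows from [1 + y <= expR y] raised to the power [n]. The rate is split into [n.+1] parts
    rather than [n], which covers [n = 0]; the extra factor is at least one. *)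
Lemma exp_le_ipow (a : R) n : 0 < a -> exists2 C, 0 < C &
  forall y, 0 <= y -> expR (- a * y) <= C * ((1 + y) ^+ n)^-1.
Proof.
move=> a0; pose m := Num.min 1 (a / n.+1%:R).
have m0 : 0 < m by rewrite lt_min ltr01 divr_gt0// ltr0Sn.
exists ((m ^+ n)^-1); first by rewrite invr_gt0 exprn_gt0.
move=> y y0; have y1 : 0 < 1 + y by rewrite ltr_pwDl.
rewrite -invfM -exprMn mulNr expRN lef_pV2 ?posrE ?expR_gt0 ?exprn_gt0 ?mulr_gt0//.
have h : m * (1 + y) <= expR (a / n.+1%:R * y).
  apply: le_trans (expR_ge1Dx _); rewrite mulrDr mulr1 lerD//.
    by rewrite /m ge_min lexx.
  by rewrite ler_wpM2r// /m ge_min lexx orbT.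
have -> : a * y = (a / n.+1%:R * y) * n.+1%:R.
  by rewrite mulrAC divfK// pnatr_eq0.
rewrite expRM_natr.
apply: (@le_trans _ _ (expR (a / n.+1%:R * y) ^+ n)).
  by apply: lerXn2r => //; rewrite nnegrE ?expR_ge0// ltW// mulr_gt0.
rewrite exprS ler_peMl ?exprn_ge0 ?expR_ge0// -expR0 ler_expR mulr_ge0// divr_ge0// ltW//.
Qed.

Lemma exp_decay_ipow (R0 : R) (f : R -> R) n : exp_decay R0 f ->
  exists2 C, 0 < C & forall x, R0 <= x -> `|f x| <= C * ipow R0 n x.
Proof.
move=> [A [a [a0 hA]]]; have [C C0 hC] := exp_le_ipow n a0.
exists ((`|A| + 1) * expR (- a * R0) * C).
  by rewrite !mulr_gt0 ?expR_gt0//; have := normr_ge0 A; lra.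
move=> x hx; apply: (le_trans (hA _ hx)).
have -> : - a * x = - a * R0 + - a * (x - R0) by ring.
rewrite expRD -!mulrA mulrA.
have h1 : 0 <= expR (- a * R0) := expR_ge0 _.
have h2 : expR (- a * (x - R0)) <= C * ipow R0 n x by apply: hC; lra.
rewrite -mulrA; apply: (@le_trans _ _ (`|A| * (expR (- a * R0) * expR (- a * (x - R0))))).
  by rewrite ler_wpM2r ?mulr_ge0 ?expR_ge0// ler_norm.
apply: ler_pM; [exact: normr_ge0|by rewrite mulr_ge0 ?expR_ge0|by rewrite lerDl|].
by rewrite -?mulrA; apply: ler_wpM2l.
Qed.

(** A boundary point is approached from inside, by a shift towards the middle of [[a, b]] and
    upwards in [x], small enough for continuity to apply. *)
Lemma cont2_closed_bound (g : R -> R -> R) (a b c B : R) w x : a < b ->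
  (forall w x, a < w < b -> c < x -> `|g w x| <= B) ->
  a <= w <= b -> c <= x -> cont2 g w x -> `|g w x| <= B.
Proof.
move=> ab hB hw hx gc; apply/ler_addgt0Pr => e e0.
have [d d0 hd] := cont2_dist e0 gc.
pose t := Num.min (1 / 2) (d / (2 * (b - a))).
have t0 : 0 < t by rewrite lt_min !divr_gt0// mulr_gt0// subr_gt0.
have t1 : t <= 1 / 2 by rewrite ge_min lexx.
have t2 : t * (b - a) <= d / 2.
  have : t <= d / (2 * (b - a)) by rewrite ge_min lexx orbT.
  rewrite ler_pdivlMr ?mulr_gt0 ?subr_gt0//; lra.
pose w' := w + ((a + b) / 2 - w) * t.
have hw' : a < w' < b.
  case/andP: hw => hw1 hw2.
  have k1 : (w - a) * (1 / 2) <= (w - a) * (1 - t) by rewrite ler_wpM2l//; lra.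
  have k2 : (b - w) * (1 / 2) <= (b - w) * (1 - t) by rewrite ler_wpM2l//; lra.
  have k3 : 0 < (b - a) * t by rewrite mulr_gt0// subr_gt0.
  rewrite /w'; apply/andP; split; nra.
have := hd w' (x + d / 2).
have -> : `|w' - w| < d.
  rewrite /w' addrC addKr normrM (ger0_norm (ltW t0)).
  apply: (@le_lt_trans _ _ ((b - a) * t)); last by rewrite mulrC; lra.
  apply: ler_wpM2r; first exact: ltW.
  by rewrite ler_norml; case/andP: hw => ? ?; apply/andP; split; lra.
have -> : `|x + d / 2 - x| < d by rewrite addrC addKr gtr0_norm ?divr_gt0//; lra.
move=> /(_ isT isT) h.
have h2 : `|g w' (x + d / 2)| <= B by apply: hB => //; lra.
have -> : g w x = g w x - g w' (x + d / 2) + g w' (x + d / 2) by rewrite subrK.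
by apply: (le_trans (ler_normD _ _)); rewrite addrC lerD// ltW.
Qed.

End decay_tools.

(** * Bounds on the Prandtl layer *)

Section prandtl.
Context {R : realType}.
#[local] Opaque d1 d2 derive1.
Variables (R0 ub thb : R) (ue0 ubar0 : R -> R) (up : R -> R -> R) (vp0 : R -> R).
Hypotheses (hR0 : 0 < R0) (hthb : 0 < thb)
  (hubar0 : smooth_exp_decay R0 ubar0)
  (hmin : 0 < Num.min ub (inf [set ue0 R0 + ubar0 x | x in `[R0, +oo[]))
  (hup : prandtl0 R0 ub thb ue0 ubar0 up vp0).
Notation mu := (@lebesgue_measure R).
Implicit Types w x y : R.

Let up3 : class_C2 3 up := prandtl0_class hup.

(** The radial velocity in the Prandtl equation. The trace condition at [R0] makes it minus the
    integral of [d1 up] from [R0], so it grows at most linearly. *)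
Definition drift w x := rvp0 up w x - R0 * vp0 w.

Lemma driftE w x : 0 <= w <= thb -> R0 <= x ->
  drift w x = - \int[mu]_(y in `[R0, x]) d1 up w y.
Proof.
move=> hw hx; rewrite /drift (prandtl0_trace hup hw) /rvp0.
have hi := prandtl0_integrable hup hw.
have h : (BLeft R0 <= BRight x)%O by rewrite bnd_simp.
have := Rintegral_itvB hi h isT.
rewrite (@Rintegral_itv_obnd_cbnd R x +oo%O); last first.
  by apply: integrableS hi => //; apply: subset_itvr; rewrite bnd_simp.
by move=> <-; ring.
Qed.

Lemma der_drift w x : 0 <= w <= thb -> R0 < x -> der (drift w) x (- d1 up w x).
Proof.
move=> hw hx.
have h := derN (der_integral (class_C2_cont2 w (class_C2_d1 up3)) hx).
by apply: (der_congr_gt hx _ h) => y hy; rewrite driftE// ltW.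
Qed.

Lemma drift_bound (M : R) : (forall w x, 0 <= w <= thb -> R0 <= x -> `|d1 up w x| <= M) ->
  forall w x, 0 <= w <= thb -> R0 <= x -> `|drift w x| <= M * (x - R0).
Proof.
move=> hM w x hw hx; rewrite driftE// normrN.
apply: continuous_Rintegral_le_bound => //.
  exact: (class_C2_cont2 w (class_C2_d1 up3)).
by move=> t /andP[ht _]; exact: hM.
Qed.

Lemma ubar0_decay k n : exists2 A, 0 < A &
  forall x, R0 <= x -> `|derive1n k ubar0 x| <= A * ipow R0 n x.
Proof. exact: exp_decay_ipow (hubar0.2 k). Qed.

Lemma ubar0_der x : der ubar0 x (derive1 ubar0 x).
Proof. by case: (hubar0.1 1%N) => _ [/(_ x) /derivable_der]. Qed.

Lemma ubar0_der2 x : der (derive1 ubar0) x (derive1n 2 ubar0 x).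
Proof. by case: (hubar0.1 2%N) => _ [_ [_ [/(_ x) /derivable_der]]]. Qed.

Lemma up_initial1 x : R0 < x -> d2 up 0 x = derive1 ubar0 x.
Proof.
move=> hx; apply: (der_unique (class_C2_der2 0 x up3)).
by apply: (der_congr_gt hx _ (ubar0_der x)) => y hy; rewrite (prandtl0_initial hup)// ltW.
Qed.

Lemma up_initial2 x : R0 < x -> d2 (d2 up) 0 x = derive1n 2 ubar0 x.
Proof.
move=> hx; apply: (der_unique (class_C2_der2 0 x (class_C2_d2 up3))).
by apply: (der_congr_gt hx _ (ubar0_der2 x)) => y hy; rewrite up_initial1.
Qed.

Lemma right_limit_bound (f g : R -> R) x : {for x, continuous f} -> {for x, continuous g} ->
  (forall y, x < y -> f y <= g y) -> f x <= g x.
Proof.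
move=> fc gc h.
rewrite -subr_ge0.
have hc : (g y - f y) @[y --> x^'+] --> g x - f x.
  by apply: cvg_at_right_filter; apply: cvgB; [exact: gc|exact: fc].
rewrite -(cvg_lim _ hc)//; apply: limr_ge; first by apply/cvg_ex; eexists; exact: hc.
by near=> y; rewrite subr_ge0; apply: h; near: y; exact: nbhs_right_gt.
Unshelve. all: by end_near. Qed.

(** The initial condition is given for [R0 <= x] only, so the derivatives are identified for
    [R0 < x] and their bounds reach [R0] as right limits. *)
Lemma up_initial_decay : exists2 A, 0 < A & forall x, R0 <= x ->
  [/\ `|up 0 x| <= A * ipow R0 4 x, `|d2 up 0 x| <= A * ipow R0 4 x &
      `|d2 (d2 up) 0 x| <= A * ipow R0 4 x].
Proof.
have [A A0 hA] := ubar0_decay 0 4; have [B B0 hB] := ubar0_decay 1 4.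
have [C C0 hC] := ubar0_decay 2 4.
exists (A + B + C); first by rewrite !addr_gt0.
have cont_ip x : R0 <= x -> {for x, continuous (fun y => (A + B + C) * ipow R0 4 y)}.
  move=> hx; apply: cvgM; first exact: cvg_cst.
  by apply: der_continuous; apply: der_ipow; lra.
have h1 x : R0 < x -> `|d2 up 0 x| <= (A + B + C) * ipow R0 4 x.
  move=> hx; have hx' := ltW hx; rewrite up_initial1//; apply: (le_trans (hB _ hx')).
  by rewrite ler_wpM2r ?(ltW (ipow_gt0 _ _))//; lra.
have h2 x : R0 < x -> `|d2 (d2 up) 0 x| <= (A + B + C) * ipow R0 4 x.
  move=> hx; have hx' := ltW hx; rewrite up_initial2//; apply: (le_trans (hC _ hx')).
  by rewrite ler_wpM2r ?(ltW (ipow_gt0 _ _))//; lra.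
move=> x; rewrite le_eqVlt => hx; have hx' : R0 <= x by rewrite le_eqVlt.
split.
- rewrite (prandtl0_initial hup hx'); apply: (le_trans (hA _ hx')).
  by rewrite ler_wpM2r ?(ltW (ipow_gt0 _ _))//; lra.
- case/predU1P : hx => [<-|]; last exact: h1.
  apply: (@right_limit_bound (fun y => `|d2 up 0 y|)
    (fun y => (A + B + C) * ipow R0 4 y) R0 _ (cont_ip _ (lexx _)) h1).
  by apply: cvg_norm; exact: (class_C2_cont2 0 (class_C2_d2 up3)).
- case/predU1P : hx => [<-|]; last exact: h2.
  apply: (@right_limit_bound (fun y => `|d2 (d2 up) 0 y|)
    (fun y => (A + B + C) * ipow R0 4 y) R0 _ (cont_ip _ (lexx _)) h2).
  by apply: cvg_norm; exact: (class_C2_cont2 0 (class_C2_d2 (class_C2_d2 up3))).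
Qed.

Lemma up_lipschitz (M : R) : (forall w x, 0 <= w <= thb -> R0 <= x -> `|d1 up w x| <= M) ->
  forall w x, 0 <= w <= thb -> R0 <= x -> `|up w x - up 0 x| <= M * w.
Proof.
move=> hM w x /andP[w0 wt] hx; move: w0; rewrite le_eqVlt => /predU1P[<-|w0].
  by rewrite subrr normr0 mulr0.
have [c /andP[c0 cw] ->] := @der_mvt' R (up^~ x) (fun w => d1 up w x) 0 w w0
   (fun y _ => class_C2_der1 y x up3).
rewrite subr0 normrM (gtr0_norm w0); apply: ler_wpM2r; first exact: ltW.
apply: hM => //; by rewrite ltW// (le_trans (ltW cw)).
Qed.

Lemma ue0_ubar0_lower : exists2 c, 0 < c & forall x, R0 <= x -> c <= ue0 R0 + ubar0 x.
Proof.
move: hmin; rewrite lt_min => /andP[_ h].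
exists (inf [set ue0 R0 + ubar0 x | x in `[R0, +oo[]) => // x hx.
apply: ge_inf; last by exists x => //=; rewrite in_itv /= hx.
have [A A0 hA] := ubar0_decay 0 0.
exists (ue0 R0 - A) => _ [y /= + <-]; rewrite in_itv /= andbT => hy.
by have := hA _ hy; rewrite /ipow expr0 invr1 mulr1 /= ler_norml => /andP[? _]; lra.
Qed.

Let U w x := ue0 R0 + up w x.

(** Differentiation of the Prandtl equation in [x]. The two products of [d1 up] and [d2 up] cancel
    because the drift has derivative [- d1 up], which leaves an equation without zeroth-order
    term. *)
Lemma prandtl_shear_eq w x : 0 < w < thb -> R0 < x ->
  U w x * d1 (d2 up) w x + drift w x * d2 (d2 up) w x - R0 * d2 (d2 (d2 up)) w x = 0.
Proof.
move=> hw hx.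
have hw' : 0 <= w <= thb by case/andP: hw => ? ?; rewrite !ltW.
have e : forall y, R0 < y -> U w y * d1 up w y + drift w y * d2 up w y = R0 * d2 (d2 up) w y.
  by move=> y hy; exact: (prandtl0_eq hup hw hy).
have h1 := derD (derM (derD (der_cst (ue0 R0) x) (class_C2_der2 w x up3))
                      (class_C2_der2 w x (class_C2_d1 up3)))
                (derM (der_drift hw' hx) (class_C2_der2 w x (class_C2_d2 up3))).
have h2 := derZ R0 (class_C2_der2 w x (class_C2_d2 (class_C2_d2 up3))).
have := der_unique (der_congr_gt hx e h1) h2.
rewrite (schwarz_class_C2 w x (class_C2_pred up3)) => <-.
rewrite /U; generalize (d2 (d1 up) w x) (d2 (d2 up) w x) (drift w x) (d1 up w x) (d2 up w x) (up w x).
by move=> *; ring.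
Qed.

Let G w x := R0 * d2 (d2 up) w x / U w x.

(* In the von Mises variables, [G] is the [w]-derivative of the velocity at fixed stream function,
   hence a solution of the linearized equation. *)
Lemma prandtl_von_mises_eq w x : 0 < w < thb -> R0 < x -> (forall y, R0 <= y -> 0 < U w y) ->
  exists zx zxx zw,
    [/\ twice (G w) x zx zxx, der (G^~ x) w zw &
        U w x * zw + (drift w x - R0 * (d2 up w x / U w x)) * zx - R0 * zxx
        + (R0 * (d2 up w x / U w x) ^+ 2 - G w x) * G w x = 0].
Proof.
move=> hw hx Upos.
have hw' : 0 <= w <= thb by case/andP: hw => ? ?; rewrite !ltW.
have up2 := class_C2_pred up3.
pose T := d1 up w; pose W := d2 up w; pose Z := d2 (d2 up) w; pose Y := d2 (d2 (d2 up)) w.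
pose Tx := d2 (d1 up) w; pose Txx := d2 (d2 (d1 up)) w; pose b := drift w; pose u := U w.
have E0 y : R0 < y -> u y * T y + b y * W y = R0 * Z y.
  by move=> hy; exact: (prandtl0_eq hup hw hy).
have E1 y : R0 < y -> u y * Tx y + b y * Z y = R0 * Y y.
  move=> hy; have := prandtl_shear_eq hw hy.
  rewrite (schwarz_class_C2 w y up2) => /eqP; rewrite subr_eq0 => /eqP; exact.
have u0 y : R0 < y -> u y != 0 by move=> hy; rewrite gt_eqF// Upos// ltW.
have du y : der u y (W y).
  by apply: (der_eq (derD (der_cst (ue0 R0) y) (class_C2_der2 w y up3))); rewrite add0r.
have dT y : der T y (Tx y) := class_C2_der2 w y (class_C2_d1 up3).
have dTx y : der Tx y (Txx y) := class_C2_der2 w y (class_C2_d2 (class_C2_d1 up3)).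
have dW y : der W y (Z y) := class_C2_der2 w y (class_C2_d2 up3).
have dZ y : der Z y (Y y) := class_C2_der2 w y (class_C2_d2 (class_C2_d2 up3)).
have db y : R0 < y -> der b y (- T y) by move=> hy; exact: der_drift.
pose N y := (- T y * W y + b y * Z y) * u y - b y * W y * W y.
pose N' y := (- Tx y * W y - T y * Z y - T y * Z y + b y * Y y) * u y
  + (- T y * W y + b y * Z y) * W y + T y * W y * W y - b y * Z y * W y - b y * W y * Z y.
(* By the Prandtl equation [G] equals [d1 up + drift * d2 up / U] for [R0 < x]. Two derivatives of
   this form in [x] need only three derivatives of [up], while the definition of [G] would need
   four. *)
have dG y : R0 < y -> der (G w) y (Tx y + N y / u y ^+ 2).
  move=> hy.
  have h : der (fun y => T y + b y * W y / u y) y (Tx y + N y / u y ^+ 2).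
    exact: (derD (dT y) (der_div (derM (db y hy) (dW y)) (du y) (u0 y hy))).
  apply: (der_congr_gt hy _ h) => y' hy'.
  by rewrite /G -/(U w y') -[U w y']/(u y') -[d2 (d2 up) w y']/(Z y') -E0//; field; exact: u0.
have dN y : R0 < y -> der N y (N' y).
  move=> hy; rewrite /N.
  apply: (der_eq (derB (derM (derD (derM (derN (dT y)) (dW y)) (derM (db y hy) (dZ y))) (du y))
    (derM (derM (db y hy) (dW y)) (dW y)))).
  by rewrite /N'; ring.
have dG2 : der (fun y => Tx y + N y / u y ^+ 2) x (Txx x + (N' x * u x - 2 * N x * W x) / u x ^+ 3).
  have ux0 := u0 x hx.
  apply: (der_eq (derD (dTx x) (der_div (dN x hx) (derX 2 (du x)) (expf_neq0 2 ux0)))).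
  by rewrite /=; field.
exists (Tx x + N x / u x ^+ 2), (Txx x + (N' x * u x - 2 * N x * W x) / u x ^+ 3),
  (R0 * (Txx x * u x - Z x * T x) / u x ^+ 2); split.
- exists (x - R0), (fun y => Tx y + N y / u y ^+ 2); split; [by rewrite subr_gt0| |reflexivity|exact: dG2].
  by move=> y; rewrite ltr_norml => /andP[? _]; apply: dG; lra.
- have ux0 := u0 x hx.
  have dZw : der (fun w => d2 (d2 up) w x) w (Txx x).
    apply: (der_eq (class_C2_der1 w x (class_C2_d2 (class_C2_d2 up3)))).
    rewrite (schwarz_class_C2 w x (class_C2_d2 up3)).
    have -> : d1 (d2 up) = d2 (d1 up).
      by apply/funext => w'; apply/funext => x'; exact: schwarz_class_C2.
    reflexivity.
  have duw : der (fun w => U w x) w (T x).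
    by apply: (der_eq (derD (der_cst (ue0 R0) w) (class_C2_der1 w x up3))); rewrite add0r.
  apply: (der_eq (der_div (derZ R0 dZw) duw ux0)).
  by rewrite -[U w x]/(u x) -[d2 (d2 up) w x]/(Z x); field.
(* [T] and [Tx] are eliminated by the equation and its [x]-derivative, after which the identity is
   algebraic. *)
- have ux0 := u0 x hx.
  rewrite /G -[U w x]/(u x) -[d2 (d2 up) w x]/(Z x) -[d2 up w x]/(W x) -[drift w x]/(b x).
  have eT : T x = (R0 * Z x - b x * W x) / u x by rewrite -(E0 _ hx); field.
  have eTx : Tx x = (R0 * Y x - b x * Z x) / u x by rewrite -(E1 _ hx); field.
  by rewrite /N /N' eT eTx; field.
Qed.

(** The angle is shortened to [th1] so that the velocity stays above half its initial minimum: [up]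
    leaves its initial value at rate at most [M]. The shear then decays by the parabolic estimate.
    The equation of [G] contains [G] in its own coefficient; the circle is broken by a preliminary
    bound on [G], read off the Prandtl equation, in which the decay of the shear absorbs the linear
    growth of the drift. For [up] itself the decay is obtained up to an error [M * w]. *)
Lemma prandtl_bounds : exists c A M th1, [/\ 0 < c, 0 < A, 0 <= M, 0 < th1 < thb &
  forall w x, 0 <= w <= th1 -> R0 <= x ->
    [/\ c <= ue0 R0 + up w x, `|up w x| <= A * ipow R0 4 x + M * w,
        `|d2 up w x| <= A * ipow R0 4 x & `|d2 (d2 up) w x| <= A * ipow R0 4 x]].
Proof.
have [M hM] := prandtl0_bounded hup.
have M0 : 0 <= M.
  have [h _] := hM 0 R0 ltac:(by rewrite lexx ltW) (lexx _).
  exact: le_trans (normr_ge0 _) h.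
have hM1 w x : 0 <= w <= thb -> R0 <= x -> `|d1 up w x| <= M by move=> hw hx; case: (hM w x hw hx).
have hM2 w x : 0 <= w <= thb -> R0 <= x -> `|d2 up w x| <= M by move=> hw hx; case: (hM w x hw hx).
have [c0 c00 hc0] := ue0_ubar0_lower.
have [A0 A00 hA0] := up_initial_decay.
pose c := c0 / 2; have cp : 0 < c by rewrite divr_gt0.
pose th1 := Num.min (thb / 2) (c / (M + 1)).
have M1 : 0 < M + 1 by lra.
have th10 : 0 < th1 by rewrite lt_min !divr_gt0.
have th1b : th1 < thb by rewrite gt_min ltr_pdivrMr// ltr_pMr// ltr1n.
have th1M : M * th1 <= c.
  have h : th1 <= c / (M + 1) by rewrite ge_min lexx orbT.
  apply: (@le_trans _ _ ((M + 1) * th1)); first by rewrite ler_wpM2r ?(ltW th10)//; lra.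
  by rewrite mulrC -ler_pdivlMr.
have wb w : 0 <= w <= th1 -> 0 <= w <= thb.
  by move=> /andP[-> h] /=; apply: (le_trans h); exact: ltW.
have upl w x : 0 <= w <= th1 -> R0 <= x -> `|up w x - up 0 x| <= M * w.
  by move=> hw; apply: up_lipschitz => //; exact: wb.
have Mw w : 0 <= w <= th1 -> M * w <= c.
  by move=> /andP[_ h]; apply: le_trans th1M; exact: ler_wpM2l.
have Ulow w x : 0 <= w <= th1 -> R0 <= x -> c <= U w x.
  move=> hw hx; have := upl w x hw hx; have := Mw w hw; have := hc0 x hx.
  rewrite (prandtl0_initial hup hx) ler_norml /U /c => ? ? /andP[? _]; lra.
have bbd w x : 0 <= w <= th1 -> R0 <= x -> `|drift w x| <= M * (x - R0).
  by move=> hw; apply: drift_bound => //; exact: wb.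
have up2 := class_C2_pred up3.
have ww w : 0 < w <= th1 -> 0 <= w <= th1 by move=> /andP[h ->]; rewrite ltW.
have wwb w : 0 < w <= th1 -> 0 < w < thb by move=> /andP[-> h] /=; exact: le_lt_trans th1b.
have [A [Ap hA]] : exists A, 0 < A /\
    forall w x, 0 <= w <= th1 -> R0 <= x -> `|d2 up w x| <= A * ipow R0 4 x.
  apply: (@heat_decay R R0 th1 c M 0 R0 (M + 1) A0 U drift (fun _ _ => 0) (d2 up)) => //.
  - exact: ltW.
  - move=> w x hw /ltW hx; split; [by apply: Ulow => //; exact: ww| |by rewrite oppr0].
    by apply: (le_trans (bbd _ _ (ww _ hw) hx)); rewrite ler_wpM2l//; lra.
  - move=> w x _ _; exact: (class_C2_cont w x (class_C2_d2 up3)).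
  - by move=> w x hw hx; apply: (le_trans (hM2 _ _ (wb _ hw) hx)); lra.
  - by move=> x hx; case: (hA0 x hx).
  - move=> w x hw hx; exists (d2 (d2 up) w x), (d2 (d2 (d2 up)) w x), (d1 (d2 up) w x).
    split; [exact: class_C2_twice (class_C2_d2 up3)|exact: class_C2_der1 (class_C2_d2 up3)|].
    by rewrite mul0r addr0; apply: prandtl_shear_eq => //; exact: wwb.
have Upos w x : 0 <= w <= th1 -> R0 <= x -> 0 < U w x.
  by move=> hw hx; apply: lt_le_trans (Ulow _ _ hw hx).
have cG w x : 0 <= w <= th1 -> R0 <= x -> cont2 G w x.
  move=> hw hx; apply: cvgM.
    apply: cvgM; first exact: cvg_cst.
    exact: (class_C2_cont w x (class_C2_d2 (class_C2_d2 up3))).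
  apply: cvgV; first by rewrite gt_eqF// Upos.
  by apply: cvgD; [exact: cvg_cst|exact: (class_C2_cont w x up3)].
have WU w x : 0 <= w <= th1 -> R0 <= x -> `|d2 up w x / U w x| <= A / c * ipow R0 4 x.
  move=> hw hx; rewrite normrM normfV (gtr0_norm (Upos _ _ hw hx)) mulrAC.
  apply: ler_pM; rewrite ?normr_ge0 ?invr_ge0 ?(ltW (Upos _ _ hw hx))//; first exact: hA.
  by rewrite lef_pV2 ?posrE ?Upos// Ulow.
have Ac : 0 < A / c by rewrite divr_gt0.
pose Mg := M + M * (A / c).
have hG w x : 0 <= w <= th1 -> R0 <= x -> `|G w x| <= Mg.
  move=> hw hx; apply: (@cont2_closed_bound R G 0 th1 R0 Mg w x) => //; last exact: cG.
  move=> {hw hx}w' x' hw' hx'.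
  have hw1 : 0 < w' <= th1 by case/andP: hw' => -> /ltW.
  have hw2 := ww _ hw1; have hx2 := ltW hx'.
  have -> : G w' x' = d1 up w' x' + drift w' x' * (d2 up w' x' / U w' x').
    have := prandtl0_eq hup (wwb _ hw1) hx'.
    rewrite /G -/(U w' x') -/(drift w' x') => <-.
    have : U w' x' != 0 by rewrite gt_eqF// Upos.
    generalize (U w' x') (d1 up w' x') (drift w' x') (d2 up w' x') => a b d e a0; by field.
  apply: (le_trans (ler_normD _ _)); rewrite lerD//; first by apply: hM1 => //; exact: wb.
  rewrite normrM.
  have k : (x' - R0) * ipow R0 4 x' <= 1.
    apply: le_trans (ipow_le1 3 hx2); rewrite (ipowS 3 hx2) mulrC.
    by rewrite ler_wpM2l ?(ltW (ipow_gt0 _ _))//; lra.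
  apply: (@le_trans _ _ ((M * (x' - R0)) * (A / c * ipow R0 4 x'))).
    by apply: ler_pM => //; [exact: bbd|exact: WU].
  have -> : M * (x' - R0) * (A / c * ipow R0 4 x') = M * (A / c) * ((x' - R0) * ipow R0 4 x').
    by ring.
  by rewrite ler_piMr// mulr_ge0// ltW.
have Mg0 : 0 <= Mg.
  have h : 0 <= (0 : R) <= th1 by rewrite lexx ltW.
  exact: le_trans (normr_ge0 _) (hG 0 R0 h (lexx _)).
have [B [Bp hB]] : exists A, 0 < A /\
    forall w x, 0 <= w <= th1 -> R0 <= x -> `|G w x| <= A * ipow R0 4 x.
  apply: (@heat_decay R R0 th1 c (M + R0 * (A / c)) Mg R0 (Mg + 1) (R0 * A0 / c) U
    (fun w x => drift w x - R0 * (d2 up w x / U w x))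
    (fun w x => R0 * (d2 up w x / U w x) ^+ 2 - G w x) G) => //.
  - exact: ltW.
  - by rewrite ltr_wpDl.
  - move=> w x hw hx'; have hw' := ww _ hw; have hx := ltW hx'; split.
    + exact: Ulow.
    + rewrite mulrDl; apply: (le_trans (ler_normB _ _)); apply: lerD.
        by apply: (le_trans (bbd _ _ hw' hx)); rewrite ler_wpM2l//; lra.
      rewrite normrM (gtr0_norm hR0) -mulrA ler_wpM2l ?(ltW hR0)//.
      apply: (le_trans (WU _ _ hw' hx)).
      rewrite ler_wpM2l ?(ltW Ac)//; apply: (le_trans (ipow_le1 4 hx)); lra.
    + have := hG w x hw' hx; rewrite ler_norml => /andP[_ h].
      have : 0 <= R0 * (d2 up w x / U w x) ^+ 2 by rewrite mulr_ge0 ?(ltW hR0)// sqr_ge0.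
      lra.
  - by move=> w x hw hx; apply: (le_trans (hG _ _ hw hx)); lra.
  - move=> x hx; have h : 0 <= (0 : R) <= th1 by rewrite lexx ltW.
    have [_ _ h0] := hA0 x hx.
    rewrite /G !normrM normfV (gtr0_norm hR0) (gtr0_norm (Upos _ _ h hx)).
    have -> : R0 * A0 / c * ipow R0 4 x = R0 * (A0 * ipow R0 4 x) / c by ring.
    apply: ler_pM; rewrite ?mulr_ge0 ?normr_ge0 ?(ltW hR0) ?invr_ge0 ?(ltW (Upos _ _ h hx))//.
      by rewrite ler_pM2l.
    by rewrite lef_pV2 ?posrE ?Upos// Ulow.
  - move=> w x hw hx.
    apply: prandtl_von_mises_eq => //; first exact: wwb.
    by move=> y hy; apply: Upos => //; exact: ww.
(* Returning from [G] to [d2 (d2 up)] costs an upper bound on the velocity. *)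
pose Um := `|ue0 R0| + A0 + c.
have hUm w x : 0 <= w <= th1 -> R0 <= x -> `|U w x| <= Um.
  move=> hw hx; rewrite /U /Um -addrA; apply: (le_trans (ler_normD _ _)); rewrite lerD2l.
  have [h0 _ _] := hA0 x hx; have h1 := upl w x hw hx; have h2 := Mw w hw.
  have h3 : A0 * ipow R0 4 x <= A0 by rewrite ler_piMr ?ipow_le1// ltW.
  have -> : up w x = up 0 x + (up w x - up 0 x) by rewrite addrC subrK.
  by apply: (le_trans (ler_normD _ _)); lra.
have Um0 : 0 <= Um by rewrite /Um; have := normr_ge0 (ue0 R0); lra.
have D0 : 0 <= B * Um / R0 by rewrite divr_ge0 ?mulr_ge0// ltW.
exists c, (A + A0 + B * Um / R0), M, th1; split => //; [by lra|by rewrite th10|].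
move=> w x hw hx.
have ip0 := ipow_gt0 4 hx; have [h0 _ _] := hA0 x hx.
have e : forall a, a <= A + A0 + B * Um / R0 -> a * ipow R0 4 x <= (A + A0 + B * Um / R0) * ipow R0 4 x.
  by move=> a ha; rewrite ler_wpM2r// ltW.
split.
- exact: Ulow.
- have -> : up w x = up 0 x + (up w x - up 0 x) by rewrite addrC subrK.
  apply: (le_trans (ler_normD _ _)); apply: lerD; last exact: upl.
  by apply: (le_trans h0); apply: e; lra.
- by apply: (le_trans (hA _ _ hw hx)); apply: e; lra.
- have -> : d2 (d2 up) w x = G w x * (U w x / R0).
    rewrite /G; have : U w x != 0 by rewrite gt_eqF// Upos.
    have : R0 != 0 by rewrite gt_eqF.
    by generalize (d2 (d2 up) w x) (U w x) => a b ? ?; field; apply/andP.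
  apply: (@le_trans _ _ (B * Um / R0 * ipow R0 4 x)); last by apply: e; lra.
  have -> : B * Um / R0 * ipow R0 4 x = B * ipow R0 4 x * (Um / R0) by ring.
  rewrite normrM (normrM (U w x)) normfV (gtr0_norm hR0); apply: ler_pM; rewrite ?mulr_ge0 ?normr_ge0 ?invr_ge0 ?(ltW hR0)//.
  + exact: hB.
  + by rewrite ler_wpM2r ?invr_ge0 ?(ltW hR0)// hUm.
Qed.

End prandtl.

(** * Elliptic estimates on a thin half-strip *)

Section difference_quotients.
Context {R : realType}.
Variable t0 : R.
Implicit Types (f g z a : R -> R -> R) (Q : R -> R -> Prop) (w t s tau : R).

Definition dq tau g w t : R := (g w (t + tau) - g w t) / tau.
Definition shift_by tau g w t : R := g w (t + tau).
(** When [r = expR t] and [R0 = expR t0], this is the power [-N] of [r / R0]; negative [N] give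
    growing weights. *)
Definition weight (N t : R) : R := expR (- (N * (t - t0))).

Lemma weight_gt0 N t : 0 < weight N t. Proof. exact: expR_gt0. Qed.

Lemma weight_le N t s : 0 <= N -> 0 <= s -> weight N (t + s) <= weight N t.
Proof.
move=> N0 s0; rewrite ler_expR lerN2 ler_wpM2l//; lra.
Qed.

Lemma weight0 t : weight 0 t = 1.
Proof. by rewrite /weight mul0r oppr0 expR0. Qed.

Lemma weightM N N' t : weight N t * weight N' t = weight (N + N') t.
Proof. by rewrite /weight -expRD; congr expR; ring. Qed.

Lemma weight_t0 N : weight N t0 = 1.
Proof. by rewrite /weight subrr mulr0 oppr0 expR0. Qed.

Variable tau0 : R.

(** Bounds all iterated forward quotients of order at most [k], with steps independent of one
    another. Quotients of a solution satisfy an equation of the same form and require no derivatives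
    beyond those in it; forward steps do not leave the half-strip. *)
Fixpoint diff_bound Q N (k : nat) K g : Prop :=
  (forall w t, Q w t -> `|g w t| <= K * weight N t) /\
  match k with
  | 0%N => True
  | j.+1 => forall tau, 0 < tau <= tau0 -> diff_bound Q N j K (dq tau g)
  end.

Lemma diff_bound0 Q N k K g w t : diff_bound Q N k K g -> Q w t -> `|g w t| <= K * weight N t.
Proof. by case: k => [|k] [h _]; exact: h. Qed.

Lemma diff_bound_pred Q N k K g : diff_bound Q N k.+1 K g -> diff_bound Q N k K g.
Proof.
elim: k g => [|k IH] g; first by case.
by move=> [h1 h2]; split => // tau htau; apply: IH; exact: h2.
Qed.

Lemma diff_bound_le Q N k K K' g : K <= K' -> diff_bound Q N k K g -> diff_bound Q N k K' g.
Proof.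
move=> KK'; elim: k g => [|k IH] g [h1 h2]; split => //.
- by move=> w t hQ; apply: (le_trans (h1 _ _ hQ)); rewrite ler_wpM2r// ltW// weight_gt0.
- by move=> w t hQ; apply: (le_trans (h1 _ _ hQ)); rewrite ler_wpM2r// ltW// weight_gt0.
- by move=> tau htau; apply: IH; exact: h2.
Qed.

Lemma diff_bound_sub Q Q' N k K g : (forall w t, Q' w t -> Q w t) ->
  diff_bound Q N k K g -> diff_bound Q' N k K g.
Proof.
move=> QQ'; elim: k g => [|k IH] g [h1 h2]; split => //.
- by move=> w t /QQ'; exact: h1.
- by move=> w t /QQ'; exact: h1.
- by move=> tau htau; apply: IH; exact: h2.
Qed.

Lemma dqB tau f g : dq tau (fun w t => f w t - g w t) = fun w t => dq tau f w t - dq tau g w t.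
Proof. by apply/funext => w; apply/funext => t; rewrite /dq; ring. Qed.

(** The discrete Leibniz rule, written with a double negation so that it is literally a difference
    and [diff_boundB] applies. *)
Lemma dqM tau f g : dq tau (fun w t => f w t * g w t) =
  fun w t => shift_by tau f w t * dq tau g w t - - (dq tau f w t * g w t).
Proof. by apply/funext => w; apply/funext => t; rewrite /dq /shift_by; ring. Qed.

Lemma dqN tau f : dq tau (fun w t => - f w t) = fun w t => - dq tau f w t.
Proof. by apply/funext => w; apply/funext => t; rewrite /dq; ring. Qed.

Lemma dq_shift tau s f : dq tau (shift_by s f) = shift_by s (dq tau f).
Proof.
by apply/funext => w; apply/funext => t; rewrite /dq /shift_by addrAC.
Qed.

Lemma diff_boundN Q N k K f : diff_bound Q N k K f -> diff_bound Q N k K (fun w t => - f w t).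
Proof.
elim: k f => [|k IH] f [h1 h2]; split => //.
- by move=> w t hQ; rewrite normrN; exact: h1.
- by move=> w t hQ; rewrite normrN; exact: h1.
- by move=> tau htau; rewrite dqN; apply: IH; exact: h2.
Qed.

Lemma diff_boundB Q N k K K' f g : diff_bound Q N k K f -> diff_bound Q N k K' g ->
  diff_bound Q N k (K + K') (fun w t => f w t - g w t).
Proof.
elim: k f g => [|k IH] f g [f1 f2] [g1 g2]; split => //.
- move=> w t hQ; apply: (le_trans (ler_normB _ _)).
  by rewrite mulrDl lerD ?f1 ?g1.
- move=> w t hQ; apply: (le_trans (ler_normB _ _)).
  by rewrite mulrDl lerD ?f1 ?g1.
- by move=> tau htau; rewrite dqB; apply: IH; [exact: f2|exact: g2].
Qed.

Definition shift_closed Q := forall w t s, 0 <= s -> Q w t -> Q w (t + s).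

Lemma diff_bound_shift Q N k K f s : shift_closed Q -> 0 <= N -> 0 <= K -> 0 <= s ->
  diff_bound Q N k K f -> diff_bound Q N k K (shift_by s f).
Proof.
move=> cQ N0 K0 s0; elim: k f => [|k IH] f [f1 f2].
  split=> // w t hQ; apply: (le_trans (f1 _ _ (cQ _ _ _ s0 hQ))).
  by rewrite ler_wpM2l// weight_le.
split.
  move=> w t hQ; apply: (le_trans (f1 _ _ (cQ _ _ _ s0 hQ))).
  by rewrite ler_wpM2l// weight_le.
by move=> tau htau; rewrite dq_shift; apply: IH; exact: f2.
Qed.

Lemma diff_boundM Q N k K K' f g : shift_closed Q -> 0 <= K -> 0 <= K' ->
  diff_bound Q 0 k K f -> diff_bound Q N k K' g ->
  diff_bound Q N k (2 ^+ k * (K * K')) (fun w t => f w t * g w t).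
Proof.
move=> cQ K0 K0'; elim: k f g => [|k IH] f g hf hg.
  split=> // w t hQ; rewrite expr0 mul1r normrM -mulrA ler_pM//.
    by have := diff_bound0 hf hQ; rewrite weight0 mulr1.
  exact: diff_bound0 hg hQ.
split.
  move=> w t hQ; rewrite normrM.
  apply: (@le_trans _ _ (K * (K' * weight N t))).
    apply: ler_pM => //; first by have := diff_bound0 hf hQ; rewrite weight0 mulr1.
    exact: diff_bound0 hg hQ.
  rewrite mulrA ler_wpM2r ?(ltW (weight_gt0 _ _))// ler_peMl ?mulr_ge0//.
  by apply: exprn_ege1; rewrite ler1n.
move=> tau htau; rewrite dqM.
have -> : (2 : R) ^+ k.+1 * (K * K') = 2 ^+ k * (K * K') + 2 ^+ k * (K * K').
  by rewrite exprS; ring.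
case: hf => f1 f2; case: hg => g1 g2.
apply: diff_boundB; last apply: diff_boundN.
- apply: IH; last exact: g2.
  apply: diff_bound_shift => //; first by case/andP: htau => /ltW.
  by apply: diff_bound_pred; split.
- apply: IH; first exact: f2.
  by apply: diff_bound_pred; split.
Qed.

(** At fixed steps an iterated quotient involves finitely many values, so a pointwise limit inherits
    the bounds with the same constant. *)
Lemma diff_bound_lim Q N k K g (G : R -> R -> R -> R) : shift_closed Q ->
  0 < tau0 ->
  (forall w t, Q w t -> forall e, 0 < e -> exists2 d, 0 < d & forall tau, 0 < tau < d ->
     `|G tau w t - g w t| < e) ->
  (forall tau, 0 < tau <= tau0 -> diff_bound Q N k K (G tau)) -> diff_bound Q N k K g.
Proof.
move=> cQ tau00 hl hG.
have base k' g' (G' : R -> R -> R -> R) :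
  (forall w t, Q w t -> forall e, 0 < e -> exists2 d, 0 < d & forall tau, 0 < tau < d ->
     `|G' tau w t - g' w t| < e) ->
  (forall tau, 0 < tau <= tau0 -> diff_bound Q N k' K (G' tau)) ->
  forall w t, Q w t -> `|g' w t| <= K * weight N t.
  move=> {}hl {}hG w t hQ; apply/ler_addgt0Pr => e e0.
  have [d d0 hd] := hl _ _ hQ _ e0.
  pose tau := Num.min tau0 (d / 2).
  have d20 : 0 < d / 2 by rewrite divr_gt0.
  have h1 : 0 < tau by rewrite lt_min tau00.
  have h2 : tau <= tau0 by rewrite ge_min lexx.
  have h3 : tau < d by rewrite gt_min; apply/orP; right; rewrite ltr_pdivrMr// ltr_pMr// ltr1n.
  have := hd tau; rewrite h1 h3 => /(_ isT) h4.
  have := diff_bound0 (hG tau ltac:(by rewrite h1)) hQ => h5.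
  have -> : g' w t = G' tau w t - (G' tau w t - g' w t) by rewrite subKr.
  by apply: (le_trans (ler_normB _ _)); rewrite lerD// ltW.
elim: k g G hl hG => [|k IH] g G hl hG; first by split => //; exact: base hl hG.
split; first exact: base hl hG.
move=> s hs.
have s0 : 0 < s by case/andP: hs.
apply: (IH _ (fun tau => dq s (G tau))); last first.
  by move=> tau htau; have [_] := hG tau htau; exact.
move=> w t hQ e e0.
have es : 0 < e * s / 2 by rewrite divr_gt0// mulr_gt0.
have [d d0 hd] := hl _ _ hQ _ es.
have [d' d0' hd'] := hl _ _ (cQ _ _ _ (ltW s0) hQ) _ es.
exists (Num.min d d'); first by rewrite lt_min d0.
move=> tau; rewrite lt_min => /and3P[t00 t1 t2].
have := hd tau; rewrite t00 t1 => /(_ isT) h1.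
have := hd' tau; rewrite t00 t2 => /(_ isT) h2.
have -> : dq s (G tau) w t - dq s g w t =
  ((G tau w (t + s) - g w (t + s)) - (G tau w t - g w t)) / s by rewrite /dq; ring.
rewrite normrM normfV (gtr0_norm s0) ltr_pdivrMr//.
by apply: (le_lt_trans (ler_normB _ _)); lra.
Qed.

(** The differential counterpart of [diff_bound]. The derivatives are existentially quantified so
    that nothing is asked of them outside [Q]. *)
Fixpoint tower Q N (k : nat) K g : Prop :=
  (forall w t, Q w t -> `|g w t| <= K * weight N t) /\
  match k with
  | 0%N => True
  | j.+1 => exists g', (forall w t, Q w t -> der (g w) t (g' w t)) /\ tower Q N j K g'
  end.

Lemma tower0 Q N k K g w t : tower Q N k K g -> Q w t -> `|g w t| <= K * weight N t.
Proof. by case: k => [|k] [h _]; exact: h. Qed.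

Lemma tower_le Q N k K K' g : K <= K' -> tower Q N k K g -> tower Q N k K' g.
Proof.
move=> KK'; elim: k g => [|k IH] g [h1 h2].
  by split => // w t hQ; apply: (le_trans (h1 _ _ hQ)); rewrite ler_wpM2r// ltW// weight_gt0.
split.
  by move=> w t hQ; apply: (le_trans (h1 _ _ hQ)); rewrite ler_wpM2r// ltW// weight_gt0.
by case: h2 => g' [h2 h3]; exists g'; split => //; exact: IH.
Qed.

Lemma dq_bound Q Q' N K g g' tau : 0 <= N -> 0 <= K -> 0 < tau ->
  (forall w t s, 0 <= s <= tau -> Q' w t -> Q w (t + s)) ->
  (forall w t, Q w t -> der (g w) t (g' w t)) ->
  (forall w t, Q w t -> `|g' w t| <= K * weight N t) ->
  forall w t, Q' w t -> `|dq tau g w t| <= K * weight N t.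
Proof.
move=> N0 K0 tau00 QQ h2 h3 w t hQ.
have [|x /andP[x1 x2]|c /andP[c1 c2] e] := @der_mvt' R (g w) (g' w) t (t + tau).
- by rewrite ltrDl.
- have -> : x = t + (x - t) by rewrite addrC subrK.
  by apply: h2; apply: QQ => //; apply/andP; split; lra.
rewrite /dq e [t + tau - t]addrAC subrr add0r mulfK ?gt_eqF//.
have cE : c = t + (c - t) by rewrite addrC subrK.
have ct : 0 <= c - t by rewrite subr_ge0 ltW.
have hQc : Q w c by rewrite cE; apply: QQ => //; apply/andP; split; lra.
apply: (le_trans (h3 _ _ hQc)).
by rewrite ler_wpM2l// cE weight_le.
Qed.

(** The region shrinks from [Q] to [Q']. The same statement thus serves a half-strip, stable under
    shifts, and a thin layer, of which each step consumes a part. *)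
Lemma tower_dq Q Q' N k K g tau : 0 <= N -> 0 <= K -> 0 < tau ->
  (forall w t s, 0 <= s <= tau -> Q' w t -> Q w (t + s)) ->
  tower Q N k.+1 K g -> tower Q' N k K (dq tau g).
Proof.
move=> N0 K0 tau00 QQ.
have QQ0 w t : Q' w t -> Q w t.
  by move=> hQ; have := QQ w t 0; rewrite lexx (ltW tau00) addr0; apply.
have QQ1 w t : Q' w t -> Q w (t + tau) by move=> hQ; have := QQ w t tau; rewrite lexx (ltW tau00); apply.
elim: k g => [|k IH] g [h1 [g' [h2 h3]]].
  by split => //; apply: (dq_bound N0 K0 tau00 QQ h2) => w t; exact: (h3.1 w t).
split; first by apply: (dq_bound N0 K0 tau00 QQ h2) => w t; exact: (h3.1 w t).
exists (dq tau g'); split; last exact: IH.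
move=> w t hQ.
have d1 : der (fun s => g w (s + tau)) t (g' w (t + tau)).
  apply: (der_eq (@der_comp R (g w) (fun s => s + tau) t _ _ (h2 _ _ (QQ1 _ _ hQ)) (derD (der_id t) (der_cst tau t)))).
  by rewrite addr0 mul1r.
apply: (der_eq (derM (derB d1 (h2 _ _ (QQ0 _ _ hQ))) (der_cst tau^-1 t))).
by rewrite mulr0 addr0.
Qed.

Lemma tower_diff_bound Q N k K g : shift_closed Q -> 0 <= N -> 0 <= K ->
  tower Q N k K g -> diff_bound Q N k K g.
Proof.
move=> cQ N0 K0; elim: k g => [|k IH] g h; first by split => // w t; exact: (h.1 w t).
split; first by move=> w t; exact: (h.1 w t).
move=> tau /andP[tau00 _]; apply: IH; apply: (tower_dq N0 K0 tau00 _ h).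
by move=> w t s /andP[s0 _]; exact: cQ.
Qed.

(** [k] steps of size at most [tau0] climb no higher than [k * tau0], so bounds on derivatives in a
    layer of height [T] control the quotients based at the bottom. *)
Lemma tower_diff_bound_bottom (P : R -> Prop) T N k K g : 0 <= N -> 0 <= K -> 0 < tau0 ->
  k%:R * tau0 <= T ->
  tower (fun w t => P w /\ t0 <= t <= t0 + T) N k K g ->
  diff_bound (fun w t => P w /\ t = t0) N k K g.
Proof.
move=> N0 K0 tau00; elim: k T g => [|k IH] T g hT h.
  split=> // w t [hP ->]; apply: (h.1 w); split => //; rewrite lexx; lra.
have T0 : 0 <= T by apply: le_trans hT; rewrite mulr_ge0// ltW.
split.
  by move=> w t [hP ->]; apply: (h.1 w); split => //; rewrite lexx lerDl.
move=> tau /andP[htau htau1]; apply: (IH (T - tau0)).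
  by move: hT; rewrite -natr1 mulrDl mul1r; lra.
apply: (tower_dq N0 K0 htau _ h) => w t s /andP[s0 s1] [hP /andP[t1 t2]].
split=> //; apply/andP; split; lra.
Qed.

(** The derivative is the limit of the first quotients, which costs one order; the constant is
    unchanged, whatever [tau0]. *)
Lemma diff_bound_der Q N k K g g' : shift_closed Q -> 0 < tau0 ->
  (forall w t, Q w t -> der (g w) t (g' w t)) ->
  diff_bound Q N k.+1 K g -> diff_bound Q N k K g'.
Proof.
move=> cQ tau00 dg [_ hg].
apply: (diff_bound_lim cQ tau00 _ hg) => w t hQ e e0.
have h : (fun h => h^-1 *: (g w (h *: 1 + t) - g w t)) @ 0^' --> g' w t.
  by case: (dg _ _ hQ) => h1 h2; rewrite -h2; exact: h1.
have hl : \forall h \near (0 : R)^', `|g' w t - h^-1 *: (g w (h *: 1 + t) - g w t)| < e.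
  by move/cvgrPdist_lt: h => /(_ _ e0).
have /nbhs_ballP[d /= d0 hd] : nbhs (0 : R)
    (fun h => h != 0 -> `|g' w t - h^-1 *: (g w (h *: 1 + t) - g w t)| < e) := hl.
exists d => // tau /andP[h1 h2].
have := hd tau; rewrite /ball /= sub0r normrN gtr0_norm// => /(_ h2).
rewrite gt_eqF// => /(_ isT); rewrite distrC /GRing.scale /= mulr1 /dq mulrC.
by rewrite (addrC tau).
Qed.

End difference_quotients.

(** * The Dirichlet problem on the half-strip *)

Section elliptic_half_strip.
Context {R : realType}.
Variables (t0 th : R).
Hypothesis th0 : 0 < th.
Implicit Types (f g z a : R -> R -> R) (w t s tau : R).

(** The Euler operator in [t = ln r], multiplied by [r^2] and written for [z = r v]: this unknown
    removes the first-order term and leaves the isolated [- z]. *)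
Definition elliptic_sol a z f := forall w t, 0 < w < th -> t0 < t ->
  exists zt ztt zw zww, [/\ twice (z w) t zt ztt, twice (z^~ t) w zw zww &
    - ztt - zww - z w t + a w t * z w t = f w t].

Definition cont_strip z := forall w t, 0 <= w <= th -> t0 <= t -> cont2 z w t.

(** A growth condition of Phragmen-Lindelof type: it is what [v -> 0] at infinity says about
    [z = r v]. *)
Definition little_exp z := forall e, 0 < e ->
  exists T, forall w t, 0 <= w <= th -> T <= t -> `|z w t| <= e * expR (t - t0).

Definition in_int w t := 0 < w < th /\ t0 < t.
Definition on_sides w t := (w = 0 \/ w = th) /\ t0 < t.
Definition on_bottom w t := 0 <= w <= th /\ t = t0.
Definition in_strip w t := 0 <= w <= th /\ t0 < t.

Lemma shift_closed_int : shift_closed in_int.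
Proof. by move=> w t s s0 [hw ht]; split => //; rewrite ltr_wpDr. Qed.
Lemma shift_closed_sides : shift_closed on_sides.
Proof. by move=> w t s s0 [hw ht]; split => //; rewrite ltr_wpDr. Qed.
Lemma shift_closed_strip : shift_closed in_strip.
Proof. by move=> w t s s0 [hw ht]; split => //; rewrite ltr_wpDr. Qed.

Lemma elliptic_solN a z f : elliptic_sol a z f ->
  elliptic_sol a (fun w t => - z w t) (fun w t => - f w t).
Proof.
move=> h w t hw ht; have [zt [ztt [zw [zww [h1 h2 E]]]]] := h w t hw ht.
exists (-1 * zt), (-1 * ztt), (-1 * zw), (-1 * zww); split.
- by have := twiceZ (-1) h1; congr twice; apply/funext => y; rewrite mulN1r.
- by have := twiceZ (-1) h2; congr twice; apply/funext => y; rewrite mulN1r.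
- by rewrite -E; ring.
Qed.

Lemma twice_shift (h : R -> R) t s (l l' : R) : twice h (t + s) l l' ->
  twice (fun y => h (y + s)) t l l'.
Proof.
move=> [e [dh [e0 h1 h2 h3]]]; exists e, (fun y => dh (y + s)); split=> //.
- move=> y hy; apply: (der_eq (@der_comp R h (fun y => y + s) y _ _ (h1 (y + s) _)
    (derD (der_id y) (der_cst s y)))); last by rewrite addr0 mul1r.
  by have -> : y + s - (t + s) = y - t by ring.
- apply: (der_eq (@der_comp R dh (fun y => y + s) t _ _ h3 (derD (der_id t) (der_cst s t)))).
  by rewrite addr0 mul1r.
Qed.

(** Apart from [a] the operator has constant coefficients, so translation in [t] only shifts [a] and
    adds the source [- dq a * z]. *)
Lemma elliptic_sol_dq a z f tau : 0 < tau -> elliptic_sol a z f ->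
  elliptic_sol (shift_by tau a) (dq tau z) (fun w t => dq tau f w t - dq tau a w t * z w t).
Proof.
move=> tau0 h w t hw ht.
have ht' : t0 < t + tau by rewrite ltr_wpDr// ltW.
have [zt [ztt [zw [zww [h1 h2 E]]]]] := h w t hw ht.
have [zt' [ztt' [zw' [zww' [h1' h2' E']]]]] := h w _ hw ht'.
exists (tau^-1 * (zt' - zt)), (tau^-1 * (ztt' - ztt)), (tau^-1 * (zw' - zw)), (tau^-1 * (zww' - zww)); split.
- have := twiceZ tau^-1 (twiceB (twice_shift h1') h1).
  by congr twice; apply/funext => y; rewrite mulrC.
- have := twiceZ tau^-1 (twiceB h2' h2).
  by congr twice; apply/funext => y; rewrite mulrC.
- by rewrite /dq /shift_by -E -E'; field; rewrite gt_eqF.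
Qed.

Lemma cont_strip_dq z tau : 0 < tau -> cont_strip z -> cont_strip (dq tau z).
Proof.
move=> tau0 zc w t hw ht; apply: cvgM; last exact: cvg_cst.
have ht' : t0 <= t + tau by rewrite ler_wpDr// ltW.
apply: cvgB; last exact: zc.
apply: (@continuous_comp _ _ _ (fun q : R * R => (q.1, q.2 + tau)) (fun q : R * R => z q.1 q.2)); last exact: zc.
apply: (@cvg_pair _ _ _ _ (nbhs w) (nbhs (t + tau))); first exact: cvg_fst.
by apply: cvgD; [exact: cvg_snd|exact: cvg_cst].
Qed.

Lemma little_exp_dq z tau : 0 < tau -> little_exp z -> little_exp (dq tau z).
Proof.
move=> tau0 hz e e0.
have D0 : 0 < expR tau + 1 by rewrite addr_gt0 ?expR_gt0.
have [|T hT] := hz (e * tau / (expR tau + 1)); first by rewrite divr_gt0// mulr_gt0.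
exists T => w t hw ht.
have h1 := hT w t hw ht.
have h2 := hT w (t + tau) hw ltac:(by rewrite ler_wpDr// ltW).
rewrite /dq normrM normfV (gtr0_norm tau0) ler_pdivrMr//.
apply: (le_trans (ler_normB _ _)); apply: (le_trans (lerD h2 h1)).
have -> : t + tau - t0 = (t - t0) + tau by ring.
rewrite expRD -mulrDr.
have -> : expR (t - t0) * expR tau + expR (t - t0) = expR (t - t0) * (expR tau + 1) by ring.
have -> : e * tau / (expR tau + 1) * (expR (t - t0) * (expR tau + 1)) = e * expR (t - t0) * tau.
  by field; rewrite gt_eqF.
exact: lexx.
Qed.

Definition profile w := 2 - (w / th) ^+ 2.

Lemma profile_bounds w : 0 <= w <= th -> 1 <= profile w <= 2.
Proof.
move=> /andP[h1 h2]; rewrite /profile.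
have h3 : 0 <= w / th by rewrite divr_ge0// ltW.
have h4 : w / th <= 1 by rewrite ler_pdivrMr// mul1r.
have : (w / th) ^+ 2 <= 1 by rewrite expr_le1.
have : 0 <= (w / th) ^+ 2 by rewrite sqr_ge0.
by move=> ? ?; apply/andP; split; lra.
Qed.

Lemma twice_profile w : twice profile w (- (2 * w / th ^+ 2)) (- (2 / th ^+ 2)).
Proof.
have tn : th != 0 by rewrite gt_eqF.
exists 1, (fun y => - (2 * y / th ^+ 2)); split; [exact: ltr01| |reflexivity|].
- move=> y _; apply: (der_eq (derB (der_cst 2 y) (derX 2 (derM (der_id y) (der_cst th^-1 y))))).
  by rewrite /=; field.
- apply: (der_eq (derN (derM (derZ 2 (der_id w)) (der_cst (th ^+ 2)^-1 w)))); ring.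
Qed.

Lemma twice_weight N t : twice (weight t0 N) t (- N * weight t0 N t) (N ^+ 2 * weight t0 N t).
Proof.
have h y : der (weight t0 N) y (- N * weight t0 N y).
  apply: (der_eq (der_exp (derN (derZ N (derB (der_id y) (der_cst t0 y)))))).
  by rewrite /weight subr0 mulr1.
exists 1, (fun y => - N * weight t0 N y); split; [exact: ltr01|by move=> y _; exact: h|reflexivity|].
by apply: (der_eq (derZ (- N) (h t))); ring.
Qed.

Lemma continuous_weight N : continuous (weight t0 N).
Proof. by move=> t; apply: der_continuous; exact: (twice_der (twice_weight N t)). Qed.

Lemma twice_comb (h1 h2 : R -> R) (k1 k2 x l l' m m' : R) :
  twice h1 x l l' -> twice h2 x m m' ->
  twice (fun y => k1 * h1 y + k2 * h2 y) x (k1 * l + k2 * m) (k1 * l' + k2 * m').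
Proof.
move=> h k; have := twiceB (twiceZ k1 h) (twiceZ (- k2) k).
rewrite !mulNr !opprK; congr twice; apply/funext => y; by rewrite mulNr opprK.
Qed.

(* The profile is so concave in a thin sector that both a growing and a decaying exponential
   become supersolutions. *)
Lemma elliptic_upper_decay N Ka K a z f : 0 <= N -> 0 <= K ->
  th ^+ 2 * (N ^+ 2 + Ka + 3) <= 1 ->
  elliptic_sol a z f -> cont_strip z -> little_exp z ->
  (forall w t, in_int w t -> `|a w t| <= Ka) ->
  (forall w t, in_int w t -> f w t <= K * weight t0 N t) ->
  (forall w t, on_sides w t -> z w t <= K * weight t0 N t) ->
  (forall w t, on_bottom w t -> z w t <= K) ->
  forall w t, 0 <= w <= th -> t0 <= t -> z w t <= 2 * K * weight t0 N t.
Proof.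
move=> N0 K0 hth zsol zc zg ha hf hs hb w t hw ht.
suff key : forall de, 0 < de -> z w t <= 2 * (K * weight t0 N t + de * weight t0 (-1) t).
  apply/ler_addgt0Pr => e e0.
  have p0 := weight_gt0 t0 (-1) t.
  have := key (e / (2 * weight t0 (-1) t)); rewrite divr_gt0 ?mulr_gt0// => /(_ isT) /le_trans; apply.
  rewrite le_eqVlt; apply/orP; left; apply/eqP; field.
  by rewrite gt_eqF.
move=> de de0.
have Em1 s : weight t0 (-1) s = expR (s - t0) by rewrite /weight mulN1r opprK.
(* The part with [weight t0 (-1)] grows like [expR (t - t0)] and dominates [z] at the height [T1];
   [de] is arbitrarily small. *)
pose phi w t := profile w * (K * weight t0 N t + de * weight t0 (-1) t).
have S0 w' : 0 <= w' <= th -> 0 < profile w'.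
  by move=> /profile_bounds /andP[h _]; exact: lt_le_trans h.
have E0 t' : 0 < K * weight t0 N t' + de * weight t0 (-1) t'.
  by rewrite ltr_wpDl ?mulr_ge0 ?mulr_gt0 ?weight_gt0// ltW ?weight_gt0.
have [T hT] := zg de de0.
pose T1 := Num.max T t + 1.
have tT1 : t <= T1 by rewrite /T1 ler_wpDr// le_max lexx orbT.
have TT1 : T <= T1 by rewrite /T1 ler_wpDr// le_max lexx.
have phi_ge w' t' : 0 <= w' <= th -> K * weight t0 N t' + de * weight t0 (-1) t' <= phi w' t'.
  by move=> /profile_bounds /andP[h _]; rewrite /phi ler_peMl// ltW.
have phi_geK w' t' : 0 <= w' <= th -> K * weight t0 N t' <= phi w' t'.
  move=> h; apply: le_trans (phi_ge _ _ h); rewrite lerDl mulr_ge0 ?(ltW de0)//; exact: ltW (weight_gt0 _ _ _).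
have phi_gede w' t' : 0 <= w' <= th -> de * weight t0 (-1) t' <= phi w' t'.
  move=> h; apply: le_trans (phi_ge _ _ h); rewrite lerDr mulr_ge0//; exact: ltW (weight_gt0 _ _ _).
apply: (@le_trans _ _ (phi w t)); last first.
  by rewrite /phi ler_pM2r//; have /andP[] := profile_bounds hw.
apply: (@elliptic_comparison R 0 th t0 T1 z phi) => //; last by rewrite ht.
- by move=> w' t' hw' /andP[ht' _]; exact: zc.
- move=> w' t' hw' /andP[ht' _]; apply: cvgM.
    apply: (@continuous_comp _ _ _ fst profile); first exact: cvg_fst.
    by apply: der_continuous; exact: (twice_der (twice_profile w')).
  apply: cvgD; (apply: cvgM; first exact: cvg_cst).
    apply: (@continuous_comp _ _ _ snd (weight t0 N)); first exact: cvg_snd.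
    exact: continuous_weight.
  apply: (@continuous_comp _ _ _ snd (weight t0 (-1))); first exact: cvg_snd.
  exact: continuous_weight.
- by move=> w' t' hw' _; rewrite /phi mulr_gt0// S0.
- move=> w' t' hw' /andP[]; rewrite le_eqVlt => /predU1P[<-|ht'] hT1 bd.
    apply: (@le_trans _ _ K); first by apply: hb.
    by apply: le_trans (phi_geK _ _ hw'); rewrite weight_t0 mulr1.
  case/or4P : bd => /eqP E.
  + by apply: le_trans (phi_geK _ _ hw'); apply: hs; split => //; left.
  + by apply: le_trans (phi_geK _ _ hw'); apply: hs; split => //; right.
  + by move: ht'; rewrite E ltxx.
  + apply: le_trans (phi_gede _ _ hw'); rewrite Em1 E.
    by apply: (le_trans (ler_norm _)); exact: hT.
- move=> w' t' hw' /andP[ht' _].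
  have [zt [ztt [zw [zww [h1 h2 E]]]]] := zsol w' t' hw' ht'.
  have hin : in_int w' t' by [].
  have hw1 : 0 <= w' <= th by case/andP: hw' => ? ?; rewrite !ltW.
  have k1 := twiceZ (profile w') (twice_comb K de (twice_weight N t') (twice_weight (-1) t')).
  have k2 : twice (phi^~ t') w' ((K * weight t0 N t' + de * weight t0 (-1) t') * (- (2 * w' / th ^+ 2)))
     ((K * weight t0 N t' + de * weight t0 (-1) t') * (- (2 / th ^+ 2))).
    have := twiceZ (K * weight t0 N t' + de * weight t0 (-1) t') (twice_profile w').
    by congr twice; apply/funext => y; rewrite /phi mulrC.
  have hA := ha _ _ hin; have hF := hf _ _ hin.
  have /andP[S1 S2] := profile_bounds hw1.
  have p1 : 0 <= K * weight t0 N t' by rewrite mulr_ge0// ltW ?weight_gt0.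
  have p2 : 0 < de * weight t0 (-1) t' by rewrite mulr_gt0// weight_gt0.
  (* The concavity of [profile] contributes [2 / th ^+ 2], which by the smallness of [th] exceeds
     whatever the two exponentials and [a] can cost. *)
  have th2 : 2 * (N ^+ 2 + Ka + 3) <= 2 / th ^+ 2.
    by rewrite ler_pdivlMr ?exprn_gt0//; lra.
  exists zt, ztt, zw, zww. eexists. eexists. eexists. eexists. exists (a w' t' - 1).
  split; [exact: h1|exact: h2|exact: k1|exact: k2|].
  have L : K * weight t0 N t' <
    - (profile w' * (K * (N ^+ 2 * weight t0 N t') + de * ((-1) ^+ 2 * weight t0 (-1) t')))
     - (K * weight t0 N t' + de * weight t0 (-1) t') * (- (2 / th ^+ 2))
     + (a w' t' - 1) * phi w' t'.
    have -> : - (profile w' * (K * (N ^+ 2 * weight t0 N t') + de * ((-1) ^+ 2 * weight t0 (-1) t')))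
     - (K * weight t0 N t' + de * weight t0 (-1) t') * (- (2 / th ^+ 2))
     + (a w' t' - 1) * phi w' t' =
      (K * weight t0 N t') * (2 / th ^+ 2 - profile w' * (N ^+ 2 + 1 - a w' t'))
      + (de * weight t0 (-1) t') * (2 / th ^+ 2 - profile w' * (2 - a w' t')).
      by rewrite /phi; ring.
    move: hA; rewrite ler_norml => /andP[a1 a2].
    have Nsq : 0 <= N ^+ 2 := sqr_ge0 _.
    have q1 : 1 <= 2 / th ^+ 2 - profile w' * (N ^+ 2 + 1 - a w' t').
      have : profile w' * (N ^+ 2 + 1 - a w' t') <= profile w' * (N ^+ 2 + 1 + Ka).
        by apply: ler_wpM2l; lra.
      have : profile w' * (N ^+ 2 + 1 + Ka) <= 2 * (N ^+ 2 + 1 + Ka).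
        by apply: ler_wpM2r => //; lra.
      by lra.
    have q2 : 1 <= 2 / th ^+ 2 - profile w' * (2 - a w' t').
      have : profile w' * (2 - a w' t') <= profile w' * (2 + Ka).
        by apply: ler_wpM2l; lra.
      have : profile w' * (2 + Ka) <= 2 * (2 + Ka).
        by apply: ler_wpM2r => //; lra.
      by lra.
    have r1 : K * weight t0 N t' * 1 <= K * weight t0 N t' * (2 / th ^+ 2 - profile w' * (N ^+ 2 + 1 - a w' t')) by exact: ler_wpM2l.
    have r2 : de * weight t0 (-1) t' * 1 <= de * weight t0 (-1) t' * (2 / th ^+ 2 - profile w' * (2 - a w' t')) by apply: ler_wpM2l => //; exact: ltW.
    by lra.
  split; last exact: le_lt_trans L.
  have -> : - ztt - zww + (a w' t' - 1) * z w' t' = f w' t' by rewrite -E; ring.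
  exact: le_trans (ltW L).
Qed.

Lemma elliptic_decay N Ka K a z f : 0 <= N -> 0 <= K ->
  th ^+ 2 * (N ^+ 2 + Ka + 3) <= 1 ->
  elliptic_sol a z f -> cont_strip z -> little_exp z ->
  (forall w t, in_int w t -> `|a w t| <= Ka) ->
  (forall w t, in_int w t -> `|f w t| <= K * weight t0 N t) ->
  (forall w t, on_sides w t -> `|z w t| <= K * weight t0 N t) ->
  (forall w t, on_bottom w t -> `|z w t| <= K) ->
  forall w t, 0 <= w <= th -> t0 <= t -> `|z w t| <= 2 * K * weight t0 N t.
Proof.
move=> N0 K0 hth zsol zc zg ha hf hs hb w t hw ht.
rewrite ler_norml lerNl; apply/andP; split.
  apply: (elliptic_upper_decay N0 K0 hth (elliptic_solN zsol)) => //.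
  - by move=> w' t' hw' ht'; apply: cvgN; exact: zc.
  - by move=> e e0; have [T hT] := zg e e0; exists T => w' t' *; rewrite normrN; exact: hT.
  - by move=> w' t' h; apply: le_trans (hf _ _ h); rewrite -normrN ler_norm.
  - by move=> w' t' h; apply: le_trans (hs _ _ h); rewrite -normrN ler_norm.
  - by move=> w' t' h; apply: le_trans (hb _ _ h); rewrite -normrN ler_norm.
apply: (elliptic_upper_decay N0 K0 hth zsol) => //.
- by move=> w' t' h; apply: le_trans (hf _ _ h); rewrite ler_norm.
- by move=> w' t' h; apply: le_trans (hs _ _ h); rewrite ler_norm.
- by move=> w' t' h; apply: le_trans (hb _ _ h); rewrite ler_norm.
Qed.

(** Induction on the order through [elliptic_sol_dq]: the bound on [z] at order [k] controls the new
    source. The smallness of [th] involves only the pointwise bound [Ka0] of the coefficient, which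
    shifts preserve; the bound [Ka] of its quotients, possibly large, enters the sources alone. [K']
    is chosen before the step size and the solution. *)
Lemma elliptic_diff_bound k (N Ka0 Ka K : R) : 0 <= N -> 0 <= Ka0 -> 0 <= Ka -> 0 <= K ->
  th ^+ 2 * (N ^+ 2 + Ka0 + 3) <= 1 ->
  exists2 K', 0 <= K' & forall tau0 a z f, 0 < tau0 ->
    elliptic_sol a z f -> cont_strip z -> little_exp z ->
    (forall w t, in_int w t -> `|a w t| <= Ka0) ->
    diff_bound t0 tau0 in_int 0 k Ka a ->
    diff_bound t0 tau0 in_int N k K f ->
    diff_bound t0 tau0 on_sides N k K z ->
    diff_bound t0 tau0 on_bottom 0 k K z ->
    diff_bound t0 tau0 in_strip N k K' z.
Proof.
move=> N0 Ka00 Ka_ge0 K_ge0 hth; move: K K_ge0.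
have base K tau0 j a z f : 0 <= K ->
    elliptic_sol a z f -> cont_strip z -> little_exp z ->
    (forall w t, in_int w t -> `|a w t| <= Ka0) ->
    diff_bound t0 tau0 in_int N j K f ->
    diff_bound t0 tau0 on_sides N j K z ->
    diff_bound t0 tau0 on_bottom 0 j K z ->
    forall w t, in_strip w t -> `|z w t| <= 2 * K * weight t0 N t.
  move=> K0 zsol zc zg ha hf hs hb w t [hw ht].
  apply: (elliptic_decay N0 K0 hth zsol zc zg ha) => //.
  - by move=> w' t' h; exact: (diff_bound0 hf h).
  - by move=> w' t' h; exact: (diff_bound0 hs h).
  - by move=> w' t' h; have := diff_bound0 hb h; rewrite weight0 mulr1.
  - exact: ltW.
elim: k => [|k IH] K K0.
  exists (2 * K); first by rewrite mulr_ge0.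
  move=> tau0 a z f tau00 zsol zc zg ha hA hf hs hb; split => //.
  exact: (base K tau0 0%N a z f).
have [Kz Kz0 hKz] := IH K K0.
(* The second summand accounts for the source [dq a * z] through the product rule [diff_boundM]. *)
pose K1 := K + 2 ^+ k * (Ka * Kz).
have K10 : 0 <= K1 by rewrite addr_ge0// mulr_ge0 ?exprn_ge0// mulr_ge0.
have KK1 : K <= K1 by rewrite lerDl mulr_ge0 ?exprn_ge0// mulr_ge0.
have [K2 K20 hK2] := IH K1 K10.
exists (2 * K + K2); first by rewrite addr_ge0// mulr_ge0.
move=> tau0 a z f tau00 zsol zc zg ha hA hf hs hb.
have hz : diff_bound t0 tau0 in_strip N k Kz z.
  by apply: (hKz tau0 a z f) => //; exact: diff_bound_pred.
split.
  move=> w t h; apply: (le_trans (base K tau0 k.+1 a z f K0 zsol zc zg ha hf hs hb w t h)).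
  by rewrite ler_wpM2r ?lerDl// ltW// weight_gt0.
move=> tau htau; have tau_gt0 : 0 < tau by case/andP: htau.
apply: (@diff_bound_le _ _ _ _ _ _ K2); first by rewrite lerDr mulr_ge0.
apply: (hK2 tau0 (shift_by tau a) (dq tau z) (fun w t => dq tau f w t - dq tau a w t * z w t)) => //.
- exact: elliptic_sol_dq.
- exact: cont_strip_dq.
- exact: little_exp_dq.
- by move=> w t [hw ht]; apply: ha; split => //; rewrite ltr_wpDr// ltW.
- apply: diff_bound_shift => //; [exact: shift_closed_int|exact: ltW|exact: diff_bound_pred].
- apply: diff_boundB; first exact: hf.2.
  apply: diff_boundM => //; [exact: shift_closed_int|exact: hA.2|].
  apply: diff_bound_sub hz => w t [/andP[h1 h2] h3]; split => //.
  by rewrite !ltW.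
- by apply: (diff_bound_le KK1); exact: hs.2.
- by apply: (diff_bound_le KK1); exact: hb.2.
Qed.

(** A barrier concave in [t] and vanishing at the bottom is compared with [z] minus its datum
    extended constantly in [t]. It controls the normal derivative at the bottom through the size of
    [f] alone, without derivatives of [f]. *)
Lemma elliptic_bottom_barrier (Ka K T : R) : 0 <= Ka -> 0 <= K -> 0 < T -> (Ka + 1) * T ^+ 2 <= 1 ->
  exists2 B : R, 0 <= B & forall a z f (g ddg : R -> R),
    elliptic_sol a z f -> cont_strip z ->
    (forall w t, in_int w t -> `|a w t| <= Ka) ->
    (forall w t, in_int w t -> `|f w t| <= K) ->
    (forall w, 0 <= w <= th -> z w t0 = g w) ->
    (forall w, {for w, continuous g}) ->
    (forall w, 0 < w < th -> exists dg, twice g w dg (ddg w)) ->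
    (forall w, 0 <= w <= th -> `|g w| <= K /\ `|ddg w| <= K) ->
    (forall w t, 0 <= w <= th -> t0 <= t -> `|z w t| <= K) ->
    (forall w t, on_sides w t -> `|z w t - g w| <= K * (t - t0)) ->
    forall w t, 0 <= w <= th -> t0 <= t <= t0 + T -> `|z w t - g w| <= B * (t - t0).
Proof.
move=> Ka0 K0 T0 hT.
(* The summands dominate, in order, the source created by subtracting [g], the lateral sides, and
   the top [t = t0 + T]; the final [1] gives strictness. *)
pose B := 2 * K * (3 + Ka) + K / T + 2 * K / T ^+ 2 + 1.
have KT : 0 <= K / T by rewrite divr_ge0// ltW.
have KT2 : 0 <= 2 * K / T ^+ 2 by apply: divr_ge0; [exact: mulr_ge0|exact: sqr_ge0].
have K3 : 0 <= 2 * K * (3 + Ka) by rewrite !mulr_ge0// addr_ge0.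
have B1 : 1 <= B by rewrite /B; lra.
exists (2 * B * T); first by rewrite !mulr_ge0// ?ltW//; lra.
move=> a z f g ddg zsol zc ha hf hb gc hg2 hgK hzK hs.
have up : forall sg : R, (sg = 1 \/ sg = -1) -> forall w t, 0 <= w <= th -> t0 <= t <= t0 + T ->
   sg * (z w t - g w) <= 2 * B * T * (t - t0).
  move=> sg hsg w t hw ht.
  have nsg y : `|sg * y| = `|y| by case: hsg => ->; rewrite ?mul1r// mulN1r normrN.
  have sgle y M : `|y| <= M -> sg * y <= M.
    by move=> h; apply: (le_trans (ler_norm _)); rewrite nsg.
  (* The shift [e] makes the barrier positive; below [e0] it costs at most [B / 2] in the
     zeroth-order term. *)
  pose e0 := B / (2 * (Ka + 1)).
  have e00 : 0 < e0 by rewrite divr_gt0//; lra.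
  suff key : forall e, 0 < e <= e0 -> sg * (z w t - g w) <= B * ((t - t0) * (2 * T - (t - t0))) + e.
    have h1 : B * ((t - t0) * (2 * T - (t - t0))) <= 2 * B * T * (t - t0).
      have -> : 2 * B * T * (t - t0) = B * ((t - t0) * (2 * T)) by ring.
      apply: ler_wpM2l; first lra.
      by case/andP: ht => ? ?; apply: ler_wpM2l; lra.
    apply/ler_addgt0Pr => e ep.
    have := key (Num.min e e0); rewrite lt_min ep e00 ge_min lexx orbT => /(_ isT).
    have : Num.min e e0 <= e by rewrite ge_min lexx.
    lra.
  move=> e /andP[ep ee0].
  pose phi w t := B * ((t - t0) * (2 * T - (t - t0))) + e + 0 * w.
  have -> : B * ((t - t0) * (2 * T - (t - t0))) + e = phi w t by rewrite /phi mul0r addr0.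
  have q0 t' : t0 <= t' <= t0 + T -> 0 <= (t' - t0) * (2 * T - (t' - t0)).
    by move=> /andP[? ?]; apply: mulr_ge0; lra.
  have q1 t' : t0 <= t' <= t0 + T -> (t' - t0) * T <= (t' - t0) * (2 * T - (t' - t0)).
    by move=> /andP[? ?]; apply: ler_wpM2l; lra.
  have q2 t' : t0 <= t' <= t0 + T -> (t' - t0) * (2 * T - (t' - t0)) <= T ^+ 2.
    move=> _; have : 0 <= (T - (t' - t0)) ^+ 2 by exact: sqr_ge0.
    have -> : (T - (t' - t0)) ^+ 2 = T ^+ 2 - (t' - t0) * (2 * T - (t' - t0)) by ring.
    by rewrite subr_ge0.
  have phiE w' t' : phi w' t' = B * ((t' - t0) * (2 * T - (t' - t0))) + e by rewrite /phi mul0r addr0.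
  have B0 : 0 <= B by lra.
  apply: (@elliptic_comparison R 0 th t0 (t0 + T) (fun w t => sg * (z w t - g w)) phi) => //.
  - move=> w' t' hw' /andP[ht' _]; apply: cvgM; first exact: cvg_cst.
    apply: cvgB; first exact: zc.
    by apply: (@continuous_comp _ _ _ fst g); [exact: cvg_fst|exact: gc].
  - move=> w' t' hw' ht'; apply: cvgD; last by apply: cvgM; [exact: cvg_cst|exact: cvg_fst].
    apply: cvgD; last exact: cvg_cst.
    apply: cvgM; first exact: cvg_cst.
    have c1 : (fun q : R * R => q.2 - t0) @ (w', t') --> t' - t0.
      by apply: cvgB; [exact: cvg_snd|exact: cvg_cst].
    by apply: cvgM; [exact: c1|apply: cvgB; [exact: cvg_cst|exact: c1]].
  - by move=> w' t' hw' ht'; rewrite phiE ltr_wpDl// mulr_ge0// q0.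
  - move=> w' t' hw' ht' bd; rewrite phiE; apply: sgle.
    have ht'' := ht'; case/andP: ht'' => ht1 ht2.
    move: ht1; rewrite le_eqVlt => /predU1P[E|ht1].
      by rewrite -E hb// subrr normr0 addr_ge0 ?(ltW ep)// mulr_ge0// subrr mul0r.
    have side : on_sides w' t' -> `|z w' t' - g w'| <= B * ((t' - t0) * (2 * T - (t' - t0))) + e.
      move=> /hs h; apply: (le_trans h).
      apply: (@le_trans _ _ (B * ((t' - t0) * T))).
        have -> : B * ((t' - t0) * T) = (B * T) * (t' - t0) by ring.
        apply: ler_wpM2r; first lra.
        have -> : K = (K / T) * T by rewrite divfK// gt_eqF.
        by apply: ler_wpM2r; [exact: ltW|rewrite /B; lra].
      have := q1 _ ht' => hq; have : B * ((t' - t0) * T) <= B * ((t' - t0) * (2 * T - (t' - t0))) by exact: ler_wpM2l.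
      lra.
    case/or4P : bd => /eqP E.
    + by apply: side; split => //; left.
    + by apply: side; split => //; right.
    + by move: ht1; rewrite E ltxx.
    + have h1 : `|z w' t' - g w'| <= 2 * K.
        apply: (le_trans (ler_normB _ _)).
        by have := hzK w' t' hw' (ltW ht1); have [? _] := hgK w' hw'; lra.
      apply: (le_trans h1); rewrite E.
      have -> : (t0 + T - t0) * (2 * T - (t0 + T - t0)) = T ^+ 2 by ring.
      apply: (@le_trans _ _ (B * T ^+ 2)); last lra.
      have -> : 2 * K = (2 * K / T ^+ 2) * T ^+ 2 by rewrite divfK// gt_eqF// exprn_gt0.
      by apply: ler_wpM2r; [rewrite exprn_ge0// ltW|rewrite /B; lra].
  - move=> w' t' hw' /andP[ht1 ht2].
    have hw1 : 0 <= w' <= th by case/andP: hw' => ? ?; rewrite !ltW.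
    have ht' : t0 <= t' <= t0 + T by rewrite !ltW.
    have hin : in_int w' t' by [].
    have [zt [ztt [zw [zww [h1 h2 E]]]]] := zsol w' t' hw' ht1.
    have [dg hdg] := hg2 w' hw'.
    have tc (c x : R) : twice (fun _ : R => c) x 0 0.
      by exists 1, (fun _ => 0); split; [exact: ltr01|by move=> y _; exact: der_cst|reflexivity|exact: der_cst].
    have k1 := twiceZ sg (twiceB h1 (tc (g w') t')).
    have k2 := twiceZ sg (twiceB h2 hdg).
    have k3 : twice (phi w') t' (B * (2 * T - 2 * (t' - t0))) (B * (- 2)).
      exists 1, (fun y => B * (2 * T - 2 * (y - t0))); split; [exact: ltr01| |reflexivity|].
      + move=> y _; have d := derB (der_id y) (der_cst t0 y).
        apply: (der_eq (derD (derD (derZ B (derM d (derB (der_cst (2 * T) y) d))) (der_cst e y)) (der_cst (0 * w') y))).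
        by ring.
      + have d := derB (der_id t') (der_cst t0 t').
        by apply: (der_eq (derZ B (derB (der_cst (2 * T) t') (derZ 2 d)))); ring.
    have k4 : twice (phi^~ t') w' 0 0.
      by have := tc (B * ((t' - t0) * (2 * T - (t' - t0))) + e) w'; congr twice; apply/funext => y; rewrite phiE.
    exists (sg * (zt - 0)), (sg * (ztt - 0)), (sg * (zw - dg)), (sg * (zww - ddg w')).
    eexists. eexists. eexists. eexists. exists (a w' t' - 1).
    split; [exact: k1|exact: k2|exact: k3|exact: k4|].
    have hA := ha _ _ hin; have hF := hf _ _ hin; have [hG hG2] := hgK _ hw1.
    have L : K * (3 + Ka) < - (B * -2) - 0 + (a w' t' - 1) * phi w' t'.
      rewrite phiE; set q := (t' - t0) * _.
      have Q0 : 0 <= q := q0 _ ht'.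
      have Q1 : q <= T ^+ 2 := q2 _ ht'.
      have e1 : (Ka + 1) * e <= B / 2.
        apply: (@le_trans _ _ ((Ka + 1) * e0)); first by apply: ler_wpM2l => //; lra.
        by rewrite /e0 le_eqVlt; apply/orP; left; apply/eqP; field; apply/eqP; lra.
      have e2 : (Ka + 1) * q <= 1.
        by apply: le_trans hT; apply: ler_wpM2l => //; lra.
      have e3 : B * ((Ka + 1) * q) <= B by exact: ler_piMr.
      have e4 : - ((Ka + 1) * (B * q + e)) <= (a w' t' - 1) * (B * q + e).
        rewrite -mulNr; apply: ler_wpM2r; first by apply: addr_ge0; [exact: mulr_ge0|exact: ltW].
        by move: hA; rewrite ler_norml => /andP[? ?]; lra.
      have e5 : K * (3 + Ka) < B / 2 by rewrite /B; lra.
      by lra.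
    split; last first.
      by apply: le_lt_trans L; rewrite mulr_ge0// addr_ge0.
    apply: le_trans (ltW L).
    have -> : - (sg * (ztt - 0)) - sg * (zww - ddg w') + (a w' t' - 1) * (sg * (z w' t' - g w'))
      = sg * (f w' t' + ddg w' + g w' - a w' t' * g w') by rewrite -E; ring.
    apply: sgle.
    have hag : `|a w' t' * g w'| <= Ka * K by rewrite normrM ler_pM.
    apply: (le_trans (ler_normB _ _)).
    apply: (@le_trans _ _ (K + K + K + Ka * K)); last lra.
    apply: lerD => //.
    apply: (le_trans (ler_normD _ _)); apply: lerD => //.
    by apply: (le_trans (ler_normD _ _)); apply: lerD.
move=> w t hw ht; rewrite ler_norml; apply/andP; split.
  by have := up (-1) (or_intror erefl) w t hw ht; lra.
by have := up 1 (or_introl erefl) w t hw ht; rewrite mul1r.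
Qed.

End elliptic_half_strip.

(** * Decay classes stable under differentiation *)

Section symbols.
Context {R : realType}.
Variable t0 : R.
Implicit Types (B : (R -> R) -> Prop) (h g : R -> R) (t : R).

(** As in a calculus of symbols, [h] and its derivatives up to order [k] on [t0 < t] lie in [B]. The
    class [moderate] is stable under products and acts on [rapid]. *)
Fixpoint symbol B (k : nat) h : Prop :=
  B h /\
  match k with
  | 0%N => True
  | j.+1 => exists h', (forall t, t0 < t -> der h t (h' t)) /\ symbol B j h'
  end.

(** In terms of [r = expR t], decay faster than any power of [r]; [moderate] allows growth like some
    power. The factors [expR t] produced by the chain rule are moderate, hence harmless on rapid
    functions. *)
Definition rapid h := forall n : nat, exists2 K, 0 <= K &
  forall t, t0 < t -> `|h t| <= K * weight t0 n%:R t.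
Definition moderate h := exists (n : nat) K, 0 <= K /\
  forall t, t0 < t -> `|h t| <= K * weight t0 (- n%:R) t.

Lemma symbol_pred B k h : symbol B k.+1 h -> symbol B k h.
Proof.
elim: k h => [|k IH] h; first by case.
by move=> [Bh [h' [dh hk]]]; split => //; exists h'; split => //; exact: IH.
Qed.

Lemma symbol_sub B B' : (forall h, B h -> B' h) -> forall k h, symbol B k h -> symbol B' k h.
Proof.
move=> BB; elim=> [|k IH] h [Bh hh]; split; try exact: BB.
by [].
by case: hh => h' [dh hk]; exists h'; split => //; exact: IH.
Qed.

Lemma symbolD B : (forall h g, B h -> B g -> B (fun t => h t + g t)) ->
  forall k h g, symbol B k h -> symbol B k g -> symbol B k (fun t => h t + g t).
Proof.
move=> BD; elim=> [|k IH] h g [Bh hh] [Bg hg]; split; try exact: BD.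
by [].
case: hh => h' [dh hk]; case: hg => g' [dg gk].
exists (fun t => h' t + g' t); split; last exact: IH.
by move=> t ht; apply: derD; [exact: dh|exact: dg].
Qed.

Lemma symbolM B1 B2 B : (forall h g, B1 h -> B2 g -> B (fun t => h t * g t)) ->
  (forall h g, B h -> B g -> B (fun t => h t + g t)) ->
  forall k h g, symbol B1 k h -> symbol B2 k g -> symbol B k (fun t => h t * g t).
Proof.
move=> BM BD; elim=> [|k IH] h g hh hg; split; try exact: (BM _ _ hh.1 hg.1).
by [].
case: (hh) => _ [h' [dh hk]]; case: (hg) => _ [g' [dg gk]].
exists (fun t => h' t * g t + h t * g' t); split.
  by move=> t ht; apply: derM; [exact: dh|exact: dg].
apply: symbolD => //; apply: IH => //; exact: symbol_pred.
Qed.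

Lemma rapidD h g : rapid h -> rapid g -> rapid (fun t => h t + g t).
Proof.
move=> hh hg n; have [K K0 hK] := hh n; have [M M0 hM] := hg n.
exists (K + M); first exact: addr_ge0.
move=> t ht; apply: (le_trans (ler_normD _ _)); rewrite mulrDl; apply: lerD; [exact: hK|exact: hM].
Qed.

Lemma weightN_mono (m n : nat) t : (m <= n)%N -> t0 < t ->
  weight t0 (- m%:R) t <= weight t0 (- n%:R) t.
Proof.
move=> mn ht; rewrite ler_expR !mulNr !opprK ler_wpM2r ?ler_nat// subr_ge0; exact: ltW.
Qed.

Lemma moderateD h g : moderate h -> moderate g -> moderate (fun t => h t + g t).
Proof.
move=> [n [K [K0 hK]]] [m [M [M0 hM]]].
exists (maxn n m), (K + M); split; first exact: addr_ge0.
move=> t ht; apply: (le_trans (ler_normD _ _)); rewrite mulrDl; apply: lerD.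
  by apply: (le_trans (hK _ ht)); apply: ler_wpM2l => //; apply: weightN_mono => //; exact: leq_maxl.
by apply: (le_trans (hM _ ht)); apply: ler_wpM2l => //; apply: weightN_mono => //; exact: leq_maxr.
Qed.

Lemma moderateM h g : moderate h -> moderate g -> moderate (fun t => h t * g t).
Proof.
move=> [n [K [K0 hK]]] [m [M [M0 hM]]].
exists (n + m)%N, (K * M); split; first exact: mulr_ge0.
move=> t ht; rewrite normrM natrD opprD -weightM mulrACA; apply: ler_pM => //; [exact: hK|exact: hM].
Qed.

Lemma moderate_rapid h g : moderate h -> rapid g -> rapid (fun t => h t * g t).
Proof.
move=> [n [K [K0 hK]]] hg m; have [M M0 hM] := hg (m + n)%N.
exists (K * M); first exact: mulr_ge0.
move=> t ht; rewrite normrM.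
have -> : weight t0 m%:R t = weight t0 (- n%:R) t * weight t0 (m + n)%:R t.
  by rewrite weightM natrD addrCA addNr addr0.
by rewrite mulrACA; apply: ler_pM => //; [exact: hK|exact: hM].
Qed.

Lemma rapid_moderate h : rapid h -> moderate h.
Proof.
move=> hh; have [K K0 hK] := hh 0%N; exists 0%N, K; split => // t ht.
by have := hK t ht; rewrite /= oppr0.
Qed.

Lemma symbol_rapidD k h g : symbol rapid k h -> symbol rapid k g ->
  symbol rapid k (fun t => h t + g t).
Proof. by apply: symbolD; exact: rapidD. Qed.

Lemma symbol_moderateM k h g : symbol moderate k h -> symbol moderate k g ->
  symbol moderate k (fun t => h t * g t).
Proof. by apply: symbolM; [exact: moderateM|exact: moderateD]. Qed.

Lemma symbol_moderate_rapid k h g : symbol moderate k h -> symbol rapid k g ->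
  symbol rapid k (fun t => h t * g t).
Proof. by apply: symbolM; [exact: moderate_rapid|exact: rapidD]. Qed.

Lemma symbol_cst k c : symbol moderate k (fun _ => c).
Proof.
have Bc c' : moderate (fun _ => c').
  by exists 0%N, `|c'|; split => // t ht; rewrite oppr0 weight0 mulr1.
elim: k c => [|k IH] c; split => //.
by exists (fun _ => 0); split => // t _; exact: der_cst.
Qed.

Lemma symbol_exp k : symbol moderate k expR.
Proof.
have Bc : moderate expR.
  exists 1%N, (expR t0); split; first exact: expR_ge0.
  move=> t ht; rewrite ger0_norm ?expR_ge0// /weight -expRD mulN1r opprK.
  by rewrite addrC subrK.
elim: k => [|k IH]; split => //.
by exists expR; split => // t _; exact: is_derive_expR.
Qed.

Lemma symbol_eq B k h g : h =1 g -> symbol B k h -> symbol B k g.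
Proof. by move=> /funext ->. Qed.

Lemma symbol_tower (n : nat) k h : symbol rapid k h ->
  exists2 K, 0 <= K & forall Q : R -> R -> Prop, (forall w t, Q w t -> t0 < t) ->
    tower t0 Q n%:R k K (fun _ t => h t).
Proof.
elim: k h => [|k IH] h [/(_ n) [K K0 hK] hh].
  by exists K => // Q hQ; split => // w t /hQ; exact: hK.
case: hh => h' [dh /IH [K' K0' hK']].
exists (K + K'); first exact: addr_ge0.
move=> Q hQ; split.
  move=> w t /hQ ht; apply: (le_trans (hK t ht)).
  by rewrite ler_wpM2r ?lerDl// ltW// weight_gt0.
exists (fun _ t => h' t); split; first by move=> w t /hQ; exact: dh.
by apply: (@tower_le _ _ _ _ _ K'); [rewrite lerDr|exact: hK'].
Qed.

Lemma tower_comb Q N k K0 K1 X F0 F1 (c0 c1 : R -> R) :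
  (forall w t, Q w t -> `|c0 w| <= X /\ `|c1 w| <= X) ->
  tower t0 Q N k K0 F0 -> tower t0 Q N k K1 F1 ->
  tower t0 Q N k (X * K0 + X * K1) (fun w t => c0 w * F0 w t + c1 w * F1 w t).
Proof.
move=> hc; elim: k F0 F1 => [|k IH] F0 F1 [h1 h2] [g1 g2].
  split=> // w t hQ; have [x0 x1] := hc w t hQ.
  rewrite mulrDl -!mulrA; apply: (le_trans (ler_normD _ _)); rewrite !normrM.
  by apply: lerD; apply: ler_pM => //; [exact: h1|exact: g1].
split.
  move=> w t hQ; have [x0 x1] := hc w t hQ.
  rewrite mulrDl -!mulrA; apply: (le_trans (ler_normD _ _)); rewrite !normrM.
  by apply: lerD; apply: ler_pM => //; [exact: h1|exact: g1].
case: h2 => F0' [d0 t0']; case: g2 => F1' [d1 t1'].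
exists (fun w t => c0 w * F0' w t + c1 w * F1' w t); split; last exact: IH.
by move=> w t hQ; apply: derD; apply: derZ; [exact: d0|exact: d1].
Qed.

(** Derivatives see a neighbourhood, and on the sides [z] agrees with its data only for [t0 <= t],
    hence near each [t > t0]. *)
Lemma tower_near Q N k K (g h : R -> R -> R) : (forall w t, Q w t -> \forall s \near t, g w s = h w s) ->
  tower t0 Q N k K g -> tower t0 Q N k K h.
Proof.
move=> gh; case: k => [|k] [h1 h2]; split=> //.
- by move=> w t hQ; rewrite -(nbhs_singleton (gh w t hQ)); exact: h1.
- by move=> w t hQ; rewrite -(nbhs_singleton (gh w t hQ)); exact: h1.
- case: h2 => g' [dg hg]; exists g'; split => // w t hQ.
  by apply: der_near (dg w t hQ); exact: gh.
Qed.

End symbols.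

Section smooth_functions.
Context {R : realType}.
Implicit Types f : R -> R.

Lemma class_C_derive1n n k f : class_C (n + k) f -> class_C k (derive1n n f).
Proof.
elim: n k f => [//|n IH] k f h.
have : class_C (n + k.+1) f by rewrite addnS -addSn.
by move=> /IH [_ []].
Qed.

Lemma smooth_der n f x : smooth f -> der (derive1n n f) x (derive1n n.+1 f x).
Proof.
move=> /(_ (n + 1)%N) /class_C_derive1n [_ [h _]].
exact: derivable_der.
Qed.

End smooth_functions.

(** * The change of variable [r = expR t] *)

Section logarithmic_variable.
Context {R : realType}.
Variables (R0 t0 : R).
Hypotheses (hR0 : 0 < R0) (ht0 : expR t0 = R0).

Lemma exp_gt_R0 t : t0 < t -> R0 < expR t.
Proof. by move=> ht; rewrite -ht0 ltr_expR. Qed.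

Lemma exp_decay_rapid (f : R -> R) : exp_decay R0 f -> rapid t0 (fun t => f (expR t)).
Proof.
move=> hf n; have [C C0 hC] := exp_decay_ipow n hf.
(* Chosen so that [r / R0 <= m * (1 + (r - R0))] for [R0 <= r]. *)
pose m := Num.max 1 R0^-1.
have m1 : 1 <= m by rewrite le_max lexx.
have mR : R0^-1 <= m by rewrite le_max lexx orbT.
have m0 : 0 < m by exact: lt_le_trans m1.
exists (C * m ^+ n); first by rewrite mulr_ge0 ?exprn_ge0// ltW.
move=> t ht; have hr := exp_gt_R0 ht.
apply: (le_trans (hC _ (ltW hr))); rewrite -mulrA ler_pM2l//.
have -> : weight t0 n%:R t = ((expR t / R0) ^+ n)^-1.
  by rewrite /weight expRN mulrC expRM_natr expRD expRN ht0.
have y0 : 0 < 1 + (expR t - R0) by lra.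
have q0 : 0 < expR t / R0 by rewrite divr_gt0 ?expR_gt0.
rewrite /ipow -exprVn -(exprVn (expR t / R0)) -exprMn.
apply: lerXn2r; rewrite ?nnegrE ?invr_ge0 ?mulr_ge0 ?invr_ge0 ?(ltW y0) ?(ltW q0) ?(ltW m0)//.
rewrite ler_pdivlMr// ler_pdivrMl//.
have -> : expR t / R0 = 1 + (expR t - R0) * R0^-1 by field; rewrite gt_eqF.
rewrite [leRHS]mulrDl mul1r; apply: lerD => //.
by apply: ler_wpM2l => //; lra.
Qed.

Lemma symbol_exp_decay (h : nat -> R -> R) :
  (forall j x, R0 < x -> der (h j) x (h j.+1 x)) ->
  (forall j, exp_decay R0 (h j)) ->
  forall k j, symbol t0 (rapid t0) k (fun t => h j (expR t)).
Proof.
move=> dh eh; elim=> [|k IH] j; split=> //; try exact: exp_decay_rapid.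
exists (fun t => expR t * h j.+1 (expR t)); split; last first.
  by apply: symbol_moderate_rapid; [exact: symbol_exp|exact: IH].
move=> t ht; apply: der_comp; last exact: is_derive_expR.
by apply: dh; exact: exp_gt_R0.
Qed.

Lemma symbol_smooth_exp_decay f k j : smooth_exp_decay R0 f ->
  symbol t0 (rapid t0) k (fun t => derive1n j f (expR t)).
Proof.
by move=> [sf ef]; apply: (@symbol_exp_decay (fun j => derive1n j f)) => // i x _; exact: smooth_der.
Qed.

Variable ue0 : R -> R.
Hypothesis hue0 : euler0 R0 ue0.

Lemma symbol_ue0 k j : symbol t0 (rapid t0) k (fun t => derive1n j.+1 ue0 (expR t)).
Proof.
case: hue0 => su _ eu.
apply: (@symbol_exp_decay (fun j => derive1n j.+1 ue0)) => [i x _|i]; first exact: smooth_der.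
exact: eu.
Qed.

(** The derivative of the inverse is a product of two inverses, [expR t] and a rapid function; the
    induction starts from the positive lower bound of [ue0]. *)
Lemma symbol_inv_ue0 k : symbol t0 (moderate t0) k (fun t => (ue0 (expR t))^-1).
Proof.
case: (hue0) => su [c [c0 hc]] eu.
have B : moderate t0 (fun t => (ue0 (expR t))^-1).
  exists 0%N, c^-1; split; first by rewrite invr_ge0 ltW.
  move=> t ht; have hcr := hc _ (ltW (exp_gt_R0 ht)).
  have u0 : 0 < ue0 (expR t) by exact: lt_le_trans hcr.
  by rewrite oppr0 weight0 mulr1 gtr0_norm ?invr_gt0// lef_pV2.
elim: k => [|k IH]; split=> //.
exists (fun t => (-1 * (expR t * derive1n 1 ue0 (expR t))) * ((ue0 (expR t))^-1 * (ue0 (expR t))^-1)); split.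
  move=> t ht; have hcr := hc _ (ltW (exp_gt_R0 ht)).
  have u0 : ue0 (expR t) != 0 by rewrite gt_eqF//; exact: lt_le_trans hcr.
  apply: (der_eq (derV (der_comp (smooth_der 0 (expR t) su) (is_derive_expR t)) u0)).
  by rewrite /=; field.
apply: symbol_moderateM; last exact: symbol_moderateM.
apply: symbol_moderateM; first exact: symbol_cst.
apply: symbol_moderateM; first exact: symbol_exp.
by apply: symbol_sub (symbol_ue0 k 0); exact: rapid_moderate.
Qed.

(** Of the two factors [r] by which the equation is multiplied, one is used up in [z = r v] and the
    other remains here. *)
Definition zeroth_coef t := expR t * (expR t * derive1n 2 ue0 (expR t) / ue0 (expR t)
    + derive1 ue0 (expR t) / ue0 (expR t)).

Lemma symbol_zeroth_coef k : symbol t0 (rapid t0) k zeroth_coef.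
Proof.
apply: (@symbol_eq _ _ _ _ (fun t => expR t * ((ue0 (expR t))^-1 *
   (expR t * derive1n 2 ue0 (expR t) + derive1n 1 ue0 (expR t))))).
  by move=> t; rewrite /zeroth_coef /=; ring.
apply: symbol_moderate_rapid; first exact: symbol_exp.
apply: symbol_moderate_rapid; first exact: symbol_inv_ue0.
apply: symbol_rapidD; last exact: symbol_ue0.
by apply: symbol_moderate_rapid; [exact: symbol_exp|exact: symbol_ue0].
Qed.

End logarithmic_variable.

(** * The Euler corrector *)

Section compact_bounds.
Context {R : realType}.

Lemma rectangle_bound (g : R -> R -> R) (a b c d : R) : (forall w x, cont2 g w x) ->
  exists2 M, 0 <= M & forall w x, a <= w <= b -> c <= x <= d -> `|g w x| <= M.
Proof.
move=> gc; have [ab|ab] := leP a b; last first.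
  by exists 0 => // w x /andP[h1 h2]; have := le_trans h1 h2; rewrite leNgt ab.
have [cd|cd] := leP c d; last first.
  by exists 0 => // w x _ /andP[h1 h2]; have := le_trans h1 h2; rewrite leNgt cd.
pose A : set (R * R) := `[a, b] `*` `[c, d].
have A0 : A !=set0 by exists (a, c); split; rewrite /= in_itv /= lexx.
have cA : compact A by apply: compact_setX; exact: segment_compact.
have cf : {within A, continuous (fun q : R * R => `|g q.1 q.2|)}.
  apply: continuous_in_subspaceT => -[w x] _.
  by apply: cvg_norm; exact: gc.
have [q _ m] := compact_EVT_max A0 cA cf.
exists `|g q.1 q.2|; first exact: normr_ge0.
by move=> w x hw hx; apply: (m (w, x)); rewrite inE /A /=; split; rewrite /= in_itv.
Qed.

Lemma interval_bound (g : R -> R) (a b : R) : continuous g ->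
  exists2 M, 0 <= M & forall x, a <= x <= b -> `|g x| <= M.
Proof.
move=> gc; have [M M0 hM] := @rectangle_bound (fun w _ => g w) a b 0 0
  (fun w x => (@continuous_comp _ _ _ fst g (w, x) (@cvg_fst _ _ _ _ _) (gc w))).
by exists M => // x hx; apply: (hM x 0) => //; rewrite lexx.
Qed.

Lemma der_right_bound (f : R -> R) (x l B T : R) : 0 < T -> der f x l ->
  (forall y, x <= y <= x + T -> `|f y - f x| <= B * (y - x)) -> `|l| <= B.
Proof.
move=> T0 fl hB; apply/ler_addgt0Pr => e e0.
have h : (fun h => h^-1 *: (f (h *: 1 + x) - f x)) @ 0^' --> l.
  by case: fl => h1 h2; rewrite -h2; exact: h1.
have hl : \forall h \near (0 : R)^', `|l - h^-1 *: (f (h *: 1 + x) - f x)| < e.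
  by move/cvgrPdist_lt: h => /(_ _ e0).
have /nbhs_ballP[d /= d0 hd] : nbhs (0 : R)
    (fun h => h != 0 -> `|l - h^-1 *: (f (h *: 1 + x) - f x)| < e) := hl.
pose s := Num.min T (d / 2).
have d20 : 0 < d / 2 by rewrite divr_gt0.
have s0 : 0 < s by rewrite lt_min T0.
have sT : s <= T by rewrite ge_min lexx.
have sd : s < d by rewrite gt_min; apply/orP; right; rewrite ltr_pdivrMr// ltr_pMr// ltr1n.
have := hd s; rewrite /ball /= sub0r normrN gtr0_norm// => /(_ sd).
rewrite gt_eqF// => /(_ isT); rewrite /GRing.scale /= mulr1 => h1.
have h2 : `|s^-1 * (f (s + x) - f x)| <= B.
  rewrite normrM normfV (gtr0_norm s0) mulrC ler_pdivrMr//.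
  have -> : s = s + x - x by rewrite addrK.
  rewrite {1}addrK; apply: hB; apply/andP; split; lra.
have -> : l = (l - s^-1 * (f (s + x) - f x)) + s^-1 * (f (s + x) - f x) by rewrite subrK.
by apply: (le_trans (ler_normD _ _)); rewrite addrC lerD// ltW.
Qed.

Lemma der_lipschitz (f df : R -> R) (x y M : R) : x <= y ->
  (forall t, x <= t <= y -> der f t (df t)) -> (forall t, x <= t <= y -> `|df t| <= M) ->
  `|f y - f x| <= M * (y - x).
Proof.
move=> xy fd hM; move: xy; rewrite le_eqVlt => /predU1P[->|xy].
  by rewrite !subrr normr0 mulr0.
have [c /andP[c1 c2] ->] := der_mvt' xy fd.
rewrite normrM [X in _ * X]gtr0_norm ?subr_gt0//; apply: ler_wpM2r; first by rewrite subr_ge0 ltW.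
by apply: hM; rewrite !ltW.
Qed.

End compact_bounds.

(** * Estimates up to the bottom of the half-strip *)

Section euler_layer.
Context {R : realType}.
Variables (R0 t0 th Ka0 X : R).
Hypotheses (hR0 : 0 < R0) (ht0 : expR t0 = R0) (hth : 0 < th).
Variables (a F0 F1 S0 S1 g dg ddg chi : R -> R).
Hypotheses (hKa0 : forall t, t0 < t -> `|a t| <= Ka0)
  (hthK : th ^+ 2 * (4%:R ^+ 2 + Ka0 + 3) <= 1)
  (ha : symbol t0 (rapid t0) 3 a) (hF0 : symbol t0 (rapid t0) 3 F0)
  (hF1 : symbol t0 (rapid t0) 3 F1) (hS0 : symbol t0 (rapid t0) 3 S0)
  (hS1 : symbol t0 (rapid t0) 3 S1) (cS0 : continuous S0) (cS1 : continuous S1)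
  (hg : forall w, der g w (dg w)) (hdg : forall w, der dg w (ddg w))
  (cddg : continuous ddg) (corner0 : S0 t0 = g 0) (corner1 : S1 t0 = g th)
  (hchi : forall s, 0 <= s -> `|chi s| <= X).
Implicit Types (z : R -> R -> R).

(** The derivatives are carried as explicit functions, to be filled in with formulas from the
    corrector. The data are parameters of the section while [eps] and the solution are arguments, so
    a constant chosen before the latter is uniform in both. *)
Record layer_sol (eps : R) z z1 z2 z3 zw zww : Prop := LayerSol {
  layer_cont : forall w t, cont2 z w t ;
  layer_cont1 : forall w t, cont2 z1 w t ;
  layer_cont2 : forall w t, cont2 z2 w t ;
  layer_cont3 : forall w t, cont2 z3 w t ;
  layer_contww : forall w t, cont2 zww w t ;
  layer_der : forall w t : R, der (z w) t (z1 w t) ;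
  layer_der1 : forall w t : R, der (z1 w) t (z2 w t) ;
  layer_der2 : forall w t : R, der (z2 w) t (z3 w t) ;
  layer_derw : forall w t : R, der (z^~ t) w (zw w t) ;
  layer_derww : forall w t : R, der (zw^~ t) w (zww w t) ;
  layer_eq : forall w t, 0 < w < th -> t0 < t ->
    - z2 w t - zww w t - z w t + a t * z w t
      = chi (w / eps) * F0 t + chi ((th - w) / eps) * F1 t ;
  layer_left : forall t, t0 <= t -> z 0 t = S0 t ;
  layer_right : forall t, t0 <= t -> z th t = S1 t ;
  layer_bottom : forall w, 0 <= w <= th -> z w t0 = g w ;
  layer_infty : little_exp t0 th z
}.

(** The decay rate, equal to the power of [ipow] in the bounds on the profile. *)
Let N : R := 4%:R.
Let N0 : 0 <= N. Proof. by rewrite /N ler0n. Qed.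
Let Ka00 : 0 <= Ka0.
Proof. by apply: le_trans (normr_ge0 _) (hKa0 (t := t0 + 1) _); rewrite ltrDl. Qed.
Let X0 : 0 <= X.
Proof. exact: le_trans (normr_ge0 _) (hchi (lexx 0)). Qed.

Let source eps (w t : R) := chi (w / eps) * F0 t + chi ((th - w) / eps) * F1 t.

Lemma layer_elliptic_sol eps z z1 z2 z3 zw zww : layer_sol eps z z1 z2 z3 zw zww ->
  elliptic_sol t0 th (fun _ t => a t) z (source eps).
Proof.
move=> h w t hw ht; exists (z1 w t), (z2 w t), (zw w t), (zww w t); split.
- exists 1, (z1 w); split; [exact: ltr01| |reflexivity|exact: layer_der1 h w t].
  by move=> y _; exact: layer_der h w y.
- exists 1, (fun w => zw w t); split; [exact: ltr01| |reflexivity|exact: layer_derww h w t].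
  by move=> y _; exact: layer_derw h y t.
- exact: layer_eq h w t hw ht.
Qed.

Lemma side_lipschitz (S : R -> R) K : continuous S -> symbol t0 (rapid t0) 1 S ->
  tower t0 (fun _ t => t0 < t) N 1 K (fun _ t => S t) -> 0 <= K ->
  forall t, t0 < t -> `|S t - S t0| <= K * (t - t0).
Proof.
move=> cS _ [_ [S' [dS [hS' _]]]] K0 t ht.
have [c /andP[c1 c2] ->] : exists2 c, t0 < c < t & S t - S t0 = S' t c * (t - t0).
  apply: (@der_mvt R S (S' t)) => //; first by move=> x /andP[hx _]; exact: (dS t x hx).
  exact: continuous_subspaceT.
rewrite normrM (gtr0_norm (_ : 0 < t - t0)) ?subr_gt0//.
apply: ler_wpM2r; first by rewrite subr_ge0 ltW.
apply: (le_trans (hS' t c c1)); rewrite ler_piMr//.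
by rewrite -(weight_t0 t0 N) -[c](subrK t0) addrC; apply: weight_le => //; rewrite subr_ge0 ltW.
Qed.

(* [K] collects the bounds of the data; everything derived from it is independent of [eps]
   and of the solution. *)
Lemma layer_data_bounds k : (k <= 3)%N -> exists Ka K, [/\ 0 <= Ka, 0 <= K,
  tower t0 (in_int t0 th) 0 k Ka (fun _ t => a t),
  forall eps, 0 < eps -> tower t0 (in_int t0 th) N k K (source eps) &
  (forall Q : R -> R -> Prop, (forall w t, Q w t -> t0 < t) ->
    tower t0 Q N k K (fun _ t => S0 t) /\ tower t0 Q N k K (fun _ t => S1 t)) /\
  (forall w, 0 <= w <= th -> `|g w| <= K /\ `|ddg w| <= K)].
Proof.
move=> k3.
have red h : symbol t0 (rapid t0) 3 h -> symbol t0 (rapid t0) k h.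
  by move: k3; case: k => [|[|[|[|//]]]] // _ hh; do ?[exact: hh|apply: symbol_pred].
have [Ka Ka_ge0 hKa] := symbol_tower 0 (red _ ha).
have [K0 K00 hK0] := symbol_tower 4 (red _ hF0).
have [K1 K10 hK1] := symbol_tower 4 (red _ hF1).
have [L0 L00 hL0] := symbol_tower 4 (red _ hS0).
have [L1 L10 hL1] := symbol_tower 4 (red _ hS1).
have cg : continuous g by move=> w; exact: der_continuous (hg w).
have [G G0 hG] := interval_bound 0 th cg.
have [G2 G20 hG2] := interval_bound 0 th cddg.
have XK : 0 <= X * K0 + X * K1 by rewrite addr_ge0// mulr_ge0.
exists Ka, (X * K0 + X * K1 + L0 + L1 + G + G2); split => //.
- by rewrite !addr_ge0 ?mulr_ge0.
- by apply: hKa => w t [].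
- move=> eps eps0; apply: (@tower_le _ _ _ _ _ (X * K0 + X * K1)); first lra.
  apply: (@tower_comb R t0 _ _ _ _ _ _ (fun _ t => F0 t) (fun _ t => F1 t)
    (fun w => chi (w / eps)) (fun w => chi ((th - w) / eps))).
  + move=> w t [/andP[h1 h2] _]; split; apply: hchi; rewrite divr_ge0 ?(ltW eps0)//; lra.
  + by apply: hK0 => w t [].
  + by apply: hK1 => w t [].
- split; last by move=> w hw; have := hG w hw; have := hG2 w hw; split; lra.
  move=> Q hQ; split.
    by apply: (@tower_le _ _ _ _ _ L0); [lra|exact: hL0].
  by apply: (@tower_le _ _ _ _ _ L1); [lra|exact: hL1].
Qed.

(** Applied to the indicators of the two sides, whose absolute values add up to one there, so that
    joining the sides does not increase [K]. *)
Lemma tower_convex Q k K F0' F1' (c0 c1 : R -> R) :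
  (forall w t, Q w t -> `|c0 w| + `|c1 w| <= 1) -> 0 <= K ->
  tower t0 Q N k K F0' -> tower t0 Q N k K F1' ->
  tower t0 Q N k K (fun w t => c0 w * F0' w t + c1 w * F1' w t).
Proof.
move=> hc K0.
have bd f0 f1 : (forall w t, Q w t -> `|f0 w t| <= K * weight t0 N t) ->
    (forall w t, Q w t -> `|f1 w t| <= K * weight t0 N t) ->
    forall w t, Q w t -> `|c0 w * f0 w t + c1 w * f1 w t| <= K * weight t0 N t.
  move=> h0 h1 w t hQ; apply: (le_trans (ler_normD _ _)); rewrite !normrM.
  apply: (@le_trans _ _ ((`|c0 w| + `|c1 w|) * (K * weight t0 N t))).
    rewrite mulrDl; apply: lerD.
      by apply: ler_wpM2l => //; exact: h0.
    by apply: ler_wpM2l => //; exact: h1.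
  by apply: ler_piMl; [by rewrite mulr_ge0 ?(ltW (weight_gt0 _ _ _))|exact: (hc w t hQ)].
elim: k F0' F1' => [|k IH] f0 f1 [a0 b0] [a1 b1]; split; try exact: bd.
  by [].
case: b0 => f0' [d0 t0']; case: b1 => f1' [d1 t1'].
exists (fun w t => c0 w * f0' w t + c1 w * f1' w t); split; last exact: IH.
by move=> w t hQ; apply: derD; apply: derZ; [exact: d0|exact: d1].
Qed.

Lemma layer_side_tower eps z z1 z2 z3 zw zww k K : 0 <= K -> layer_sol eps z z1 z2 z3 zw zww ->
  (forall Q : R -> R -> Prop, (forall w t, Q w t -> t0 < t) ->
    tower t0 Q N k K (fun _ t => S0 t) /\ tower t0 Q N k K (fun _ t => S1 t)) ->
  tower t0 (on_sides t0 th) N k K z.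
Proof.
move=> K0 h hS.
have [h0 _] := hS (on_sides t0 th) (fun w t => fun H => H.2).
have [_ h1] := hS (on_sides t0 th) (fun w t => fun H => H.2).
pose c0 (w : R) : R := if w == 0 then 1 else 0.
pose c1 (w : R) : R := if w == th then 1 else 0.
apply: (@tower_near R t0 (on_sides t0 th) N k K (fun w t => c0 w * S0 t + c1 w * S1 t)).
  move=> w t [hw ht]; near=> s.
  have hs : t0 <= s by apply: ltW; near: s; exact: lt_nbhsr.
  case: hw => ->; rewrite /c0 /c1 eqxx.
    by rewrite lt_eqF// mul0r addr0 mul1r (layer_left h).
  by rewrite gt_eqF// mul0r add0r mul1r (layer_right h).
have hc w t : on_sides t0 th w t -> `|c0 w| + `|c1 w| <= 1.
  move=> [[->|->] _]; rewrite /c0 /c1 eqxx.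
    by rewrite lt_eqF// normr1 normr0 addr0.
  by rewrite gt_eqF// normr1 normr0 add0r.
exact: (tower_convex hc K0 h0 h1).
Unshelve. all: by end_near. Qed.

(** [C] depends on the bottom bound [K] but not on the height [T] of the layer where it holds: [T]
    only limits the steps, and these tend to zero in the end. An arbitrarily thin layer is therefore
    enough. *)
Lemma layer_bounds_of k K : (1 <= k <= 3)%N -> 0 <= K -> exists2 C, 0 <= C &
  forall eps z z1 z2 z3 zw zww T, 0 < eps -> 0 < T -> layer_sol eps z z1 z2 z3 zw zww ->
  tower t0 (fun w t => 0 <= w <= th /\ t0 <= t <= t0 + T) 0 k K z ->
  exists2 tau0, 0 < tau0 & diff_bound t0 tau0 (in_strip t0 th) N k C z.
Proof.
move=> /andP[k1 k3] K0.
have [Ka [Kd [Ka_ge0 Kd0 hKa hKs [hKS hKg]]]] := layer_data_bounds k3.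
have KK0 : 0 <= K + Kd by rewrite addr_ge0.
have [C C0 hC] := elliptic_diff_bound t0 hth k N0 Ka00 Ka_ge0 KK0 hthK.
exists C => // eps z z1 z2 z3 zw zww T eps0 T0 h hT.
have kR0 : 0 < k%:R :> R by rewrite ltr0n.
have tau00 : 0 < T / k%:R by rewrite divr_gt0.
exists (T / k%:R) => //.
apply: (hC (T / k%:R) (fun _ t => a t) z (source eps)) => //.
- exact: layer_elliptic_sol h.
- by move=> w t _ _; exact: (layer_cont h).
- exact: layer_infty h.
- by move=> w t [_ ht]; exact: hKa0.
- by apply: tower_diff_bound => //; exact: shift_closed_int.
- apply: (@diff_bound_le _ _ _ _ _ _ Kd); first by rewrite lerDr.
  by apply: tower_diff_bound => //; [exact: shift_closed_int|exact: hKs].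
- apply: (@diff_bound_le _ _ _ _ _ _ Kd); first by rewrite lerDr.
  by apply: tower_diff_bound => //; [exact: shift_closed_sides|exact: layer_side_tower Kd0 h hKS].
- apply: (@diff_bound_le _ _ _ _ _ _ K); first by rewrite lerDl.
  apply: (@tower_diff_bound_bottom R t0 (T / k%:R) (fun w => 0 <= w <= th) T) => //.
  by rewrite mulrC divfK// gt_eqF.
Qed.

(** Uniform in [eps]: the barrier gives [z1], and the equation then gives [z2], because at the
    bottom [zww] is the second derivative of the datum and the source is bounded through the size of
    [chi]. *)
Lemma layer_bottom_bounds : exists2 C, 0 <= C &
  forall eps z z1 z2 z3 zw zww, 0 < eps -> layer_sol eps z z1 z2 z3 zw zww ->
  forall w, 0 <= w <= th -> [/\ `|z w t0| <= C, `|z1 w t0| <= C & `|z2 w t0| <= C].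
Proof.
have [_ [K [_ K0 _ hKs [hKS hKg]]]] := layer_data_bounds (isT : (1 <= 3)%N).
pose T := (Ka0 + 1)^-1.
have Ka1 : 0 < Ka0 + 1 by rewrite ltr_wpDl.
have T0 : 0 < T by rewrite invr_gt0.
have hT : (Ka0 + 1) * T ^+ 2 <= 1.
  by rewrite expr2 mulrA /T mulfV ?gt_eqF// mul1r invf_le1// lerDr.
have K20 : 0 <= 2 * K by rewrite mulr_ge0.
have [B B0 hB] := elliptic_bottom_barrier t0 th Ka00 K20 T0 hT.
pose C := 2 * K + B + (K + (1 + Ka0) * (2 * K) + K).
have C1 : 0 <= (1 + Ka0) * (2 * K) by rewrite mulr_ge0// addr_ge0.
exists C; first by rewrite /C; lra.
move=> eps z z1 z2 z3 zw zww eps0 h.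
have zsol := layer_elliptic_sol h.
have zc : cont_strip t0 th z by move=> w t _ _; exact: (layer_cont h).
have w1 t : t0 <= t -> weight t0 N t <= 1.
  by move=> ht; rewrite -(weight_t0 t0 N) -[t](subrK t0) addrC; apply: weight_le => //; rewrite subr_ge0.
have fK w t : in_int t0 th w t -> `|source eps w t| <= K * weight t0 N t.
  by move=> hin; exact: (tower0 (hKs eps eps0) hin).
have hz w t : 0 <= w <= th -> t0 <= t -> `|z w t| <= 2 * K.
  move=> hw ht; apply: (@le_trans _ _ (2 * K * weight t0 N t)).
    apply: (elliptic_decay hth N0 K0 hthK zsol zc (layer_infty h)) => //.
    - by move=> w' t' [_ ht']; exact: hKa0.
    - by move=> w' t' hs; exact: (tower0 (layer_side_tower K0 h hKS) hs).
    - move=> w' t' [hw' ->]; rewrite (layer_bottom h hw'); exact: (hKg _ hw').1.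
  by rewrite ler_piMr// w1.
have bar w t : 0 <= w <= th -> t0 <= t <= t0 + T -> `|z w t - g w| <= B * (t - t0).
  apply: (hB (fun _ t => a t) z (source eps) g ddg zsol zc).
  - by move=> w' t' [_ ht']; exact: hKa0.
  - move=> w' t' hin; apply: (le_trans (fK _ _ hin)).
    have : K * weight t0 N t' <= K by rewrite ler_piMr// w1// ltW//; case: hin.
    lra.
  - exact: (layer_bottom h).
  - by move=> w'; exact: der_continuous (hg w').
  - move=> w' _; exists (dg w'), 1, dg; split; [exact: ltr01| |reflexivity|exact: hdg].
    by move=> y _; exact: hg.
  - by move=> w' hw'; have [? ?] := hKg _ hw'; split; lra.
  - exact: hz.
  - have [hS0' hS1'] := hKS (fun _ t => t0 < t) (fun w t H => H).
    move=> w' t' [[->|->] ht'].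
      rewrite (layer_left h (ltW ht')) -corner0.
      apply: (le_trans (side_lipschitz cS0 (symbol_pred (symbol_pred hS0)) hS0' K0 ht')).
      by apply: ler_wpM2r; [rewrite subr_ge0 ltW|lra].
    rewrite (layer_right h (ltW ht')) -corner1.
    apply: (le_trans (side_lipschitz cS1 (symbol_pred (symbol_pred hS1)) hS1' K0 ht')).
    by apply: ler_wpM2r; [rewrite subr_ge0 ltW|lra].
have z2b w : 0 < w < th -> `|z2 w t0| <= K + (1 + Ka0) * (2 * K) + K.
  move=> hw; have hw' : 0 <= w <= th by case/andP: hw => ? ?; rewrite !ltW.
  have zww0 : zww w t0 = ddg w.
    have dzw y : 0 < y < th -> zw y t0 = dg y.
      move=> hy; apply: (der_unique (layer_derw h y t0)).
      apply: (der_congr_oo hy _ (hg y)) => y' /andP[? ?].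
      by rewrite (layer_bottom h)// !ltW.
    apply: (der_unique (layer_derww h w t0)).
    by apply: (der_congr_oo hw _ (hdg w)) => y' hy'; rewrite dzw.
  have c2 : {for t0, continuous (fun t => `|z2 w t|)}.
    by apply: cvg_norm; exact: der_continuous (layer_der2 h w t0).
  have cw : {for t0, continuous (fun t => `|zww w t| + ((1 + Ka0) * (2 * K) + K))}.
    apply: cvgD; last exact: cvg_cst.
    apply: cvg_norm.
    apply: (@continuous_comp _ _ _ (fun t => (w, t)) (fun q : R * R => zww q.1 q.2)).
      by apply: (@cvg_pair _ _ _ _ (nbhs w) (nbhs t0)); [exact: cvg_cst|exact: cvg_id].
    exact: (layer_contww h).
  have := right_limit_bound c2 cw; rewrite zww0 => H.
  have {}H : `|z2 w t0| <= `|ddg w| + ((1 + Ka0) * (2 * K) + K).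
    apply: H => t ht.
    have e := layer_eq h hw ht.
    have -> : z2 w t = - zww w t - (1 - a t) * z w t - source eps w t by rewrite /source -e; ring.
    rewrite addrA; apply: (le_trans (ler_normB _ _)); apply: lerD; last first.
      have hin : in_int t0 th w t by [].
      by apply: (le_trans (fK _ _ hin)); rewrite ler_piMr// w1// ltW.
     apply: (le_trans (ler_normB _ _)); rewrite normrN lerD2l normrM.
    apply: ler_pM => //; last by apply: hz => //; exact: ltW.
    by apply: (le_trans (ler_normB _ _)); rewrite normr1 lerD2l; exact: hKa0.
  by have [_ ?] := hKg _ hw'; lra.
move=> w hw; split.
- by apply: (le_trans (hz _ _ hw (lexx _))); rewrite /C; lra.
- apply: (@le_trans _ _ B); last by rewrite /C; lra.
  apply: (der_right_bound T0 (layer_der h w t0)) => y hy.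
  by rewrite (layer_bottom h hw); exact: bar.
(* The equation is available at interior angles only; continuity brings the bound to the corners. *)
- apply: (@le_trans _ _ (K + (1 + Ka0) * (2 * K) + K)); last by rewrite /C; lra.
  apply: (@cont2_closed_bound R (fun w t => z2 w t0) 0 th 0 _ w 0) => //.
    by move=> w' _ hw' _; exact: z2b.
  apply: (@continuous_comp _ _ _ (fun q : R * R => (q.1, t0)) (fun q : R * R => z2 q.1 q.2)).
    by apply: (@cvg_pair _ _ _ _ (nbhs w) (nbhs t0)); [exact: cvg_fst|exact: cvg_cst].
  exact: (layer_cont2 h).
Qed.

(** At the bottom the uniform [C] applies, and by continuity [C + 1] holds on a layer above it. The
    height of that layer depends on the solution, which [layer_bounds_of] permits. *)
Lemma layer_uniform_bounds : exists2 C, 0 <= C &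
  forall eps z z1 z2 z3 zw zww, 0 < eps -> layer_sol eps z z1 z2 z3 zw zww ->
  forall w t, 0 <= w <= th -> t0 < t ->
    `|z1 w t| <= C * weight t0 N t /\ `|z2 w t| <= C * weight t0 N t.
Proof.
have [C C0 hC] := layer_bottom_bounds.
have C10 : 0 <= C + 1 by lra.
have [D D0 hD] := layer_bounds_of (isT : (1 <= 2 <= 3)%N) C10.
exists D => // eps z z1 z2 z3 zw zww eps0 h.
have [M M0 hM] := @rectangle_bound R z1 0 th t0 (t0 + 1) (layer_cont1 h).
have [M2 M20 hM2] := @rectangle_bound R z2 0 th t0 (t0 + 1) (layer_cont2 h).
have [M3 M30 hM3] := @rectangle_bound R z3 0 th t0 (t0 + 1) (layer_cont3 h).
pose T := (M + M2 + M3 + 1)^-1.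
have Mp : 0 < M + M2 + M3 + 1 by lra.
have T0 : 0 < T by rewrite invr_gt0.
have T1 : T <= 1 by rewrite invf_le1//; lra.
have MT m : 0 <= m <= M + M2 + M3 + 1 -> m * T <= 1.
  by move=> /andP[_ hm]; rewrite ler_pdivrMr// mul1r.
have lip (f df : R -> R -> R) m : (forall w t : R, der (f w) t (df w t)) ->
    0 <= m <= M + M2 + M3 + 1 ->
    (forall w t, 0 <= w <= th -> t0 <= t <= t0 + 1 -> `|df w t| <= m) ->
    (forall w, 0 <= w <= th -> `|f w t0| <= C) ->
    forall w t, 0 <= w <= th -> t0 <= t <= t0 + T -> `|f w t| <= C + 1.
  move=> df_ hm hdf hf w t hw /andP[h1 h2].
  have l : `|f w t - f w t0| <= m * (t - t0).
    apply: (der_lipschitz h1) => s /andP[s1 s2]; first exact: df_.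
    by apply: hdf => //; apply/andP; split; lra.
  have -> : f w t = f w t0 + (f w t - f w t0) by rewrite addrC subrK.
  apply: (le_trans (ler_normD _ _)); apply: lerD; first exact: hf.
  apply: (le_trans l); apply: le_trans (MT m hm).
  by case/andP: hm => m0 _; apply: ler_wpM2l => //; lra.
have b0 := lip z z1 M (layer_der h) ltac:(apply/andP; split; lra) hM
  (fun w hw => let: And3 p _ _ := hC _ _ _ _ _ _ _ eps0 h w hw in p).
have b1 := lip z1 z2 M2 (layer_der1 h) ltac:(apply/andP; split; lra) hM2
  (fun w hw => let: And3 _ p _ := hC _ _ _ _ _ _ _ eps0 h w hw in p).
have b2 := lip z2 z3 M3 (layer_der2 h) ltac:(apply/andP; split; lra) hM3
  (fun w hw => let: And3 _ _ p := hC _ _ _ _ _ _ _ eps0 h w hw in p).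
have [tau0 tau00 hz] : exists2 tau0, 0 < tau0 & diff_bound t0 tau0 (in_strip t0 th) N 2 D z.
  apply: (hD eps z z1 z2 z3 zw zww T eps0 T0 h).
  split; first by move=> w t [hw ht]; rewrite weight0 mulr1; exact: b0.
  exists z1; split; first by move=> w t _; exact: layer_der h w t.
  split; first by move=> w t [hw ht]; rewrite weight0 mulr1; exact: b1.
  exists z2; split; first by move=> w t _; exact: layer_der1 h w t.
  by split=> // w t [hw ht]; rewrite weight0 mulr1; exact: b2.
have hz1 := diff_bound_der (@shift_closed_strip R t0 th) tau00 (fun w t _ => layer_der h w t) hz.
have hz2 := diff_bound_der (@shift_closed_strip R t0 th) tau00 (fun w t _ => layer_der1 h w t) hz1.
move=> w t hw ht; split.
  exact: (diff_bound0 hz1 (conj hw ht)).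
exact: (diff_bound0 hz2 (conj hw ht)).
Qed.

(** The values of [z3] near the bottom are bounded by compactness alone, hence a constant that
    depends on the solution. *)
Lemma layer_third_bound eps z z1 z2 z3 zw zww : 0 < eps -> layer_sol eps z z1 z2 z3 zw zww ->
  exists2 C, 0 <= C & forall w t, 0 <= w <= th -> t0 < t -> `|z3 w t| <= C * weight t0 N t.
Proof.
move=> eps0 h.
have [M0 M00 hM0] := @rectangle_bound R z 0 th t0 (t0 + 1) (layer_cont h).
have [M1 M10 hM1] := @rectangle_bound R z1 0 th t0 (t0 + 1) (layer_cont1 h).
have [M2 M20 hM2] := @rectangle_bound R z2 0 th t0 (t0 + 1) (layer_cont2 h).
have [M3 M30 hM3] := @rectangle_bound R z3 0 th t0 (t0 + 1) (layer_cont3 h).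
pose M := M0 + M1 + M2 + M3.
have Mp : 0 <= M by rewrite !addr_ge0.
have [D D0 hD] := layer_bounds_of (isT : (1 <= 3 <= 3)%N) Mp.
have [tau0 tau00 hz] : exists2 tau0, 0 < tau0 & diff_bound t0 tau0 (in_strip t0 th) N 3 D z.
  apply: (hD eps z z1 z2 z3 zw zww 1 eps0 ltr01 h).
  split.
    by move=> w t [hw ht]; rewrite weight0 mulr1; apply: (le_trans (hM0 _ _ hw ht)); rewrite /M; lra.
  exists z1; split; first by move=> w t _; exact: layer_der h w t.
  split.
    by move=> w t [hw ht]; rewrite weight0 mulr1; apply: (le_trans (hM1 _ _ hw ht)); rewrite /M; lra.
  exists z2; split; first by move=> w t _; exact: layer_der1 h w t.
  split.
    by move=> w t [hw ht]; rewrite weight0 mulr1; apply: (le_trans (hM2 _ _ hw ht)); rewrite /M; lra.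
  exists z3; split; first by move=> w t _; exact: layer_der2 h w t.
  by split=> // w t [hw ht]; rewrite weight0 mulr1; apply: (le_trans (hM3 _ _ hw ht)); rewrite /M; lra.
have hz1 := diff_bound_der (@shift_closed_strip R t0 th) tau00 (fun w t _ => layer_der h w t) hz.
have hz2 := diff_bound_der (@shift_closed_strip R t0 th) tau00 (fun w t _ => layer_der1 h w t) hz1.
have hz3 := diff_bound_der (@shift_closed_strip R t0 th) tau00 (fun w t _ => layer_der2 h w t) hz2.
by exists D => // w t hw ht; exact: (diff_bound0 hz3 (conj hw ht)).
Qed.

End euler_layer.

(** * Integrals depending on a parameter *)

Section parametric_integrals.
Context {R : realType}.
Notation mu := (@lebesgue_measure R).
Implicit Types (g : R -> R -> R) (w x : R).

Lemma cont2_section1 g : (forall w x, cont2 g w x) -> forall x, continuous (g^~ x).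
Proof.
move=> gc x w.
apply: (@continuous_comp _ _ _ (fun w => (w, x)) (fun q : R * R => g q.1 q.2)); last exact: gc.
by apply: (@cvg_pair _ _ _ _ (nbhs w) (nbhs x)); [exact: cvg_id|exact: cvg_cst].
Qed.

Lemma cont2_section2 g : (forall w x, cont2 g w x) -> forall w, continuous (g w).
Proof.
move=> gc w x.
apply: (@continuous_comp _ _ _ (fun x => (w, x)) (fun q : R * R => g q.1 q.2)); last exact: gc.
by apply: (@cvg_pair _ _ _ _ (nbhs w) (nbhs x)); [exact: cvg_cst|exact: cvg_id].
Qed.

Lemma dist_cont2 g w x : (forall e, 0 < e -> exists2 d, 0 < d &
    forall w' x', `|w' - w| < d -> `|x' - x| < d -> `|g w x - g w' x'| < e) -> cont2 g w x.
Proof.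
move=> h; apply/cvgrPdist_lt => e e0; have [d d0 hd] := h e e0.
exists (ball w d, ball x d) => /=; first by split; exact: nbhsx_ballx.
by move=> [w' x'] [/= hw hx]; apply: hd; rewrite distrC.
Qed.

Lemma der_param_integral g gx w x : (forall w x, cont2 g w x) -> (forall w x, cont2 gx w x) ->
  (forall w x, der (g w) x (gx w x)) ->
  der (fun x => \int[mu]_(a in `[0, w]) g a x) x (\int[mu]_(a in `[0, w]) gx a x).
Proof.
move=> gc gxc dg.
have [M M0 hM] := @rectangle_bound R gx 0 w (x - 1) (x + 1) gxc.
have Ix : `]x - 1, x + 1[%classic x by rewrite /= in_itv /=; apply/andP; split; lra.
have I1 y : `]x - 1, x + 1[%classic y -> mu.-integrable `[0, w] (EFin \o (fun a => g a y)).
  by move=> _; apply: continuous_integrable; exact: cont2_section1.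
have I2 y a : `]x - 1, x + 1[%classic y -> `[0, w]%classic a -> derivable (g a) y 1.
  by move=> _ _; exact: der_derivable (dg a y).
have I3 : mu.-integrable `[0, w] (EFin \o (fun _ => M)).
  by apply: continuous_integrable => ?; exact: cvg_cst.
have I4 y a : `]x - 1, x + 1[%classic y -> `[0, w]%classic a ->
    `|partial1of2 (fun y a => g a y) y a| <= M.
  rewrite /= !in_itv /= => /andP[h1 h2] ha.
  have -> : partial1of2 (fun y a => g a y) y a = gx a y.
    by rewrite partial1of2E; exact: (@derive_val _ _ _ _ _ _ _ (dg a y)).
  by apply: hM => //; apply/andP; split; lra.
have mI : measurable (`[0, w] : set R) by [].
have d := @derivable_under_integral R _ _ mu (fun y a => g a y) _ mI x _ _ Ix I1 I2
  (fun _ => M) (fun _ => M0) I3 I4.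
have e := @differentiation_under_integral R _ _ mu (fun y a => g a y) _ mI x _ _ Ix I1 I2
  (fun _ => M) (fun _ => M0) I3 I4.
apply: (der_eq (derivable_der d)); rewrite e.
apply: eq_Rintegral => a _.
by rewrite partial1of2E; exact: (@derive_val _ _ _ _ _ _ _ (dg a x)).
Qed.

(** Continuity in [x] is by domination, in [w] by a Lipschitz bound. The assumption [0 < w] keeps
    neighbouring upper limits positive, where the integral is differentiable in its upper limit. *)
Lemma cont2_param_integral g w x : 0 < w -> (forall w x, cont2 g w x) ->
  cont2 (fun w x => \int[mu]_(a in `[0, w]) g a x) w x.
Proof.
move=> w0 gc; apply: dist_cont2 => e e0.
have [M M0 hM] := @rectangle_bound R g 0 (2 * w) (x - 1) (x + 1) gc.
have hx : {for x, continuous (fun y => \int[mu]_(a in `[0, w]) g a y)}.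
  have h := @continuity_under_integral R _ _ mu (fun y a => g a y) `[0, w]
    (measurable_itv _) (x - 1) (x + 1) _ _ (fun _ => M) _ _.
  apply: h; last by rewrite inE /= in_itv /=; apply/andP; split; lra.
  - by move=> y _; apply: continuous_integrable; exact: cont2_section1.
  - by apply: aeW => a _ y _; exact: cont2_section2.
  - by apply: continuous_integrable => ?; exact: cvg_cst.
  - move=> y; rewrite /= in_itv /= => /andP[h1 h2]; apply: aeW => a; rewrite /= in_itv /= => /andP[a1 a2].
    by apply: hM; apply/andP; split; lra.
have e2 : 0 < e / 2 by rewrite divr_gt0.
have /nbhs_ballP[d /= d0 hd] : nbhs x (fun y =>
    `|\int[mu]_(a in `[0, w]) g a x - \int[mu]_(a in `[0, w]) g a y| < e / 2).
  by move/cvgrPdist_lt: hx => /(_ _ e2).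
pose d' := Num.min (Num.min d 1) (Num.min (w / 2) (e / (2 * (M + 1)))).
have M1 : 0 < 2 * (M + 1) by lra.
have d'0 : 0 < d' by rewrite !lt_min d0 ltr01 !divr_gt0.
exists d' => // w' x'; rewrite !lt_min => /andP[/andP[_ _] /andP[w1 w2]] /andP[/andP[x1 x2] _].
have hw : \int[mu]_(a in `[0, w]) g a x - \int[mu]_(a in `[0, w']) g a x' =
  (\int[mu]_(a in `[0, w]) g a x - \int[mu]_(a in `[0, w]) g a x') +
  (\int[mu]_(a in `[0, w]) g a x' - \int[mu]_(a in `[0, w']) g a x') by rewrite addrA subrK.
rewrite hw; apply: (le_lt_trans (ler_normD _ _)).
have k1 : `|\int[mu]_(a in `[0, w]) g a x - \int[mu]_(a in `[0, w]) g a x'| < e / 2.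
  by apply: (hd x'); rewrite /ball /= distrC.
have k2 : `|\int[mu]_(a in `[0, w]) g a x' - \int[mu]_(a in `[0, w']) g a x'| <= M * `|w' - w|.
  have L p q : 0 < p -> p <= q -> q <= 2 * w ->
      `|\int[mu]_(a in `[0, q]) g a x' - \int[mu]_(a in `[0, p]) g a x'| <= M * (q - p).
    move=> p0 pq q2.
    apply: (@der_lipschitz R (fun q => \int[mu]_(a in `[0, q]) g a x') (g^~ x')) => // t /andP[t1 t2].
      by apply: der_integral; [exact: cont2_section1|lra].
    move: x2; rewrite ltr_norml => /andP[? ?].
    by apply: hM; apply/andP; split; lra.
  move: w1; rewrite ltr_norml => /andP[? ?].
  have [ww|ww] := leP w w'.
    rewrite distrC (ger0_norm (_ : 0 <= w' - w)) ?subr_ge0//.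
    by apply: L => //; lra.
  rewrite (ltr0_norm (_ : w' - w < 0)) ?subr_lt0// opprB.
  by apply: L => //; [lra|exact: ltW|lra].
have k3 : M * `|w' - w| <= e / 2.
  move: w2; rewrite ltr_pdivlMr// => w2.
  have : 0 <= `|w' - w| by [].
  by clear -w2 M0; nra.
by have := ltr_leD k1 (le_trans k2 k3); rewrite -splitr.
Qed.

End parametric_integrals.

(** * Derivatives of the tangential corrector *)

Section euler_profile.
Context {R : realType}.
#[local] Opaque d1 d2 derive1.
Notation mu := (@lebesgue_measure R).
Implicit Types (v : R -> R -> R) (w r t : R).

(** This function and the next two are the first three [r]-derivatives of [r v]; their angular
    integrals give [ue1] and its derivatives. *)
Definition ue1_integrand0 v w r := v w r + r * d2 v w r.
Definition ue1_integrand1 v w r := 2 * d2 v w r + r * d2 (d2 v) w r.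
Definition ue1_integrand2 v w r := 3 * d2 (d2 v) w r + r * d2 (d2 (d2 v)) w r.

Definition ue1_d (ub1 : R -> R) v w r :=
  derive1 ub1 r - \int[mu]_(a in `[0, w]) ue1_integrand1 v a r.
Definition ue1_dd (ub1 : R -> R) v w r :=
  derive1n 2 ub1 r - \int[mu]_(a in `[0, w]) ue1_integrand2 v a r.

Lemma cont2D (g h : R -> R -> R) w r : cont2 g w r -> cont2 h w r ->
  cont2 (fun w r => g w r + h w r) w r.
Proof. by move=> gc hc; apply: cvgD; [exact: gc|exact: hc]. Qed.
Lemma cont2M (g h : R -> R -> R) w r : cont2 g w r -> cont2 h w r ->
  cont2 (fun w r => g w r * h w r) w r.
Proof. by move=> gc hc; apply: cvgM; [exact: gc|exact: hc]. Qed.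
Lemma cont2_of_snd (h : R -> R) w r : {for r, continuous h} -> cont2 (fun _ r => h r) w r.
Proof.
by move=> hc; apply: (@continuous_comp _ _ _ snd h); [exact: cvg_snd|exact: hc].
Qed.
Lemma cont2_cst (c : R) w r : cont2 (fun _ _ => c) w r. Proof. exact: cvg_cst. Qed.
Lemma cont2_snd w r : cont2 (fun _ r => r) w r. Proof. exact: cvg_snd. Qed.

Variable v : R -> R -> R.
Hypothesis v3 : class_C2 3 v.
Let v2 := class_C2_pred v3.
Let cv w r : cont2 v w r := class_C2_cont w r v3.
Let cv1 w r : cont2 (d2 v) w r := class_C2_cont w r (class_C2_d2 v3).
Let cv2 w r : cont2 (d2 (d2 v)) w r := class_C2_cont w r (class_C2_d2 (class_C2_d2 v3)).
Let cv3 w r : cont2 (d2 (d2 (d2 v))) w r :=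
  class_C2_cont w r (class_C2_d2 (class_C2_d2 (class_C2_d2 v3))).

Lemma cont_integrand0 w r : cont2 (ue1_integrand0 v) w r.
Proof. by apply: cont2D; [exact: cv|apply: cont2M; [exact: cont2_snd|exact: cv1]]. Qed.
Lemma cont_integrand1 w r : cont2 (ue1_integrand1 v) w r.
Proof.
by apply: cont2D; apply: cont2M; [exact: cont2_cst|exact: cv1|exact: cont2_snd|exact: cv2].
Qed.
Lemma cont_integrand2 w r : cont2 (ue1_integrand2 v) w r.
Proof.
by apply: cont2D; apply: cont2M; [exact: cont2_cst|exact: cv2|exact: cont2_snd|exact: cv3].
Qed.

Lemma d2_mul_r w r : d2 (fun a s => s * v a s) w r = ue1_integrand0 v w r.
Proof.
apply: der_derive1.
apply: (der_eq (derM (der_id r) (class_C2_der2 w r v3))).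
by rewrite mul1r.
Qed.

Lemma der_integrand0 w r : der (ue1_integrand0 v w) r (ue1_integrand1 v w r).
Proof.
apply: (der_eq (derD (class_C2_der2 w r v3) (derM (der_id r) (class_C2_der2 w r (class_C2_d2 v3))))).
rewrite /ue1_integrand1; generalize (d2 v w r) (d2 (d2 v) w r) => b c; ring.
Qed.

Lemma der_integrand1 w r : der (ue1_integrand1 v w) r (ue1_integrand2 v w r).
Proof.
apply: (der_eq (derD (derZ 2 (class_C2_der2 w r (class_C2_d2 v3)))
  (derM (der_id r) (class_C2_der2 w r (class_C2_d2 (class_C2_d2 v3)))))).
rewrite /ue1_integrand2; generalize (d2 (d2 v) w r) (d2 (d2 (d2 v)) w r) => b c; ring.
Qed.

Variable ub1 : R -> R.
Hypothesis sub1 : smooth ub1.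

Lemma ue1E w r : ue1 ub1 v w r = ub1 r - \int[mu]_(a in `[0, w]) ue1_integrand0 v a r.
Proof. by rewrite /ue1; congr (_ - _); apply: eq_Rintegral => a _; exact: d2_mul_r. Qed.

Lemma der_ue1 w r : der (ue1 ub1 v w) r (ue1_d ub1 v w r).
Proof.
have -> : ue1 ub1 v w = fun r => ub1 r - \int[mu]_(a in `[0, w]) ue1_integrand0 v a r.
  by apply/funext => s; exact: ue1E.
apply: derB; first exact: (smooth_der 0 r sub1).
apply: der_param_integral; [exact: cont_integrand0|exact: cont_integrand1|exact: der_integrand0].
Qed.

Lemma der_ue1_d w r : der (ue1_d ub1 v w) r (ue1_dd ub1 v w r).
Proof.
apply: derB; first exact: (smooth_der 1 r sub1).
apply: der_param_integral; [exact: cont_integrand1|exact: cont_integrand2|exact: der_integrand1].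
Qed.

Lemma cont_smooth n w r : cont2 (fun _ r => derive1n n ub1 r) w r.
Proof. by apply: cont2_of_snd; exact: der_continuous (smooth_der n r sub1). Qed.

Lemma cont_ue1 w r : 0 < w -> cont2 (ue1 ub1 v) w r.
Proof.
move=> w0.
have -> : ue1 ub1 v = fun w r => ub1 r - \int[mu]_(a in `[0, w]) ue1_integrand0 v a r.
  by apply/funext => a; apply/funext => s; exact: ue1E.
apply: cvgB; first exact: (@cont_smooth 0 w r).
exact: (@cont2_param_integral R (ue1_integrand0 v) w r w0 (@cont_integrand0)).
Qed.

Lemma cont_ue1_dd w r : 0 < w -> cont2 (ue1_dd ub1 v) w r.
Proof.
move=> w0; apply: cvgB; first exact: (@cont_smooth 2 w r).
exact: (@cont2_param_integral R (ue1_integrand2 v) w r w0 (@cont_integrand2)).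
Qed.

End euler_profile.

(** * The source of the corrector in the logarithmic variable *)

Section euler_data.
Context {R : realType}.
#[local] Opaque d1 d2 derive1.
Variables (R0 t0 th : R) (ue0 vp0 Vb0 Vb1 : R -> R).
Hypotheses (hR0 : 0 < R0) (ht0 : expR t0 = R0) (hth : 0 < th)
  (hue0 : euler0 R0 ue0) (hvp0 : class_C 2 vp0)
  (hVb0 : smooth_exp_decay R0 Vb0) (hVb1 : smooth_exp_decay R0 Vb1).
Implicit Types (w r t : R).

Let vp0' := derive1 vp0.
Let vp0'' := derive1 (derive1 vp0).

Lemma der_vp0 w : der vp0 w (vp0' w).
Proof. have [_ [h _]] := hvp0; exact: (derivable_der (h w)). Qed.
Lemma der_vp0' w : der vp0' w (vp0'' w).
Proof. have [_ [_ [_ [h _]]]] := hvp0; exact: (derivable_der (h w)). Qed.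
Lemma continuous_vp0'' : continuous vp0''.
Proof. have [_ [_ [_ [_ [h _]]]]] := hvp0; exact: h. Qed.

(** The boundary interpolation is a sum of products of a function of the angle and a function of
    [r]. At fixed [w] the angular factors, with at most two derivatives of [vp0], are constants; the
    rest consists of derivatives of [Vb0] and [Vb1] times moderate functions. *)
Lemma boundary_data_rapid w : symbol t0 (rapid t0) 3
  (fun t => expR t ^+ 2 * euler1_op ue0 (euler1_bdry th vp0 Vb0 Vb1) w (expR t)).
Proof.
pose c0 := (vp0 0)^-1; pose c1 := (vp0 th)^-1.
pose A w := (1 - w / th) * (vp0 w * c0).
pose A' w := - th^-1 * (vp0 w * c0) + (1 - w / th) * (vp0' w * c0).
pose A'' w := - th^-1 * (vp0' w * c0) + (- th^-1 * (vp0' w * c0) + (1 - w / th) * (vp0'' w * c0)).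
pose B w := (w / th) * (vp0 w * c1).
pose B' w := th^-1 * (vp0 w * c1) + (w / th) * (vp0' w * c1).
pose B'' w := th^-1 * (vp0' w * c1) + (th^-1 * (vp0' w * c1) + (w / th) * (vp0'' w * c1)).
have dl a : der (fun w => 1 - w / th) a (- th^-1).
  by apply: (der_eq (derB (der_cst 1 a) (derM (der_id a) (der_cst th^-1 a)))); ring.
have dl' a : der (fun w => w / th) a th^-1.
  by apply: (der_eq (derM (der_id a) (der_cst th^-1 a))); ring.
have dv c a : der (fun w => vp0 w * c) a (vp0' a * c).
  by apply: (der_eq (derM (der_vp0 a) (der_cst c a))); rewrite mulr0 addr0.
have dv' c a : der (fun w => vp0' w * c) a (vp0'' a * c).
  by apply: (der_eq (derM (der_vp0' a) (der_cst c a))); rewrite mulr0 addr0.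
have dA a : der A a (A' a) := derM (dl a) (dv c0 a).
have dA' a : der A' a (A'' a) := derD (derZ (- th^-1) (dv c0 a)) (derM (dl a) (dv' c0 a)).
have dB a : der B a (B' a) := derM (dl' a) (dv c1 a).
have dB' a : der B' a (B'' a) := derD (derZ (th^-1) (dv c1 a)) (derM (dl' a) (dv' c1 a)).
have e1 : d1 (euler1_bdry th vp0 Vb0 Vb1) = fun a r => A' a * Vb0 r + B' a * Vb1 r.
  apply/funext => a; apply/funext => r; apply: der_derive1.
  apply: (der_eq (derD (derM (dA a) (der_cst (Vb0 r) a)) (derM (dB a) (der_cst (Vb1 r) a)))).
  by rewrite !mulr0 !addr0.
have e11 a r : d1 (d1 (euler1_bdry th vp0 Vb0 Vb1)) a r = A'' a * Vb0 r + B'' a * Vb1 r.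
  rewrite e1; apply: der_derive1.
  apply: (der_eq (derD (derM (dA' a) (der_cst (Vb0 r) a)) (derM (dB' a) (der_cst (Vb1 r) a)))).
  by rewrite !mulr0 !addr0.
have e2 : d2 (euler1_bdry th vp0 Vb0 Vb1) =
    fun a r => A a * derive1n 1 Vb0 r + B a * derive1n 1 Vb1 r.
  apply/funext => a; apply/funext => r; apply: der_derive1.
  exact: (derD (derZ (A a) (smooth_der 0 r hVb0.1)) (derZ (B a) (smooth_der 0 r hVb1.1))).
have e22 a r : d2 (d2 (euler1_bdry th vp0 Vb0 Vb1)) a r = A a * derive1n 2 Vb0 r + B a * derive1n 2 Vb1 r.
  rewrite e2; apply: der_derive1.
  exact: (derD (derZ (A a) (smooth_der 1 r hVb0.1)) (derZ (B a) (smooth_der 1 r hVb1.1))).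
pose P j a b t := a * derive1n j Vb0 (expR t) + b * derive1n j Vb1 (expR t).
have hP j a b : symbol t0 (rapid t0) 3 (P j a b).
  apply: symbol_rapidD; (apply: symbol_moderate_rapid; first exact: symbol_cst).
    exact: (symbol_smooth_exp_decay hR0 ht0 3 j hVb0).
  exact: (symbol_smooth_exp_decay hR0 ht0 3 j hVb1).
have he k h : symbol t0 (rapid t0) k h -> symbol t0 (rapid t0) k (fun t => expR t * h t).
  by move=> hh; apply: symbol_moderate_rapid => //; exact: symbol_exp.
have hZ c k h : symbol t0 (rapid t0) k h -> symbol t0 (rapid t0) k (fun t => c * h t).
  by move=> hh; apply: symbol_moderate_rapid => //; exact: symbol_cst.
apply: (@symbol_eq R t0 _ _ (fun t =>
    (-1) * (expR t * (expR t * (expR t * P 2%N (A w) (B w) t)))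
    + (-3) * (expR t * (expR t * P 1%N (A w) (B w) t))
    + (-1) * (expR t * (P 0%N (A'' w) (B'' w) t + 2 * P 0%N (A w) (B w) t))
    + expR t * (zeroth_coef ue0 t * P 0%N (A w) (B w) t))).
  move=> t; rewrite /euler1_op e11 e22 e2.
  have -> : euler1_bdry th vp0 Vb0 Vb1 w (expR t) = P 0%N (A w) (B w) t by [].
  have -> : A'' w * Vb0 (expR t) + B'' w * Vb1 (expR t) = P 0%N (A'' w) (B'' w) t by [].
  rewrite -/(P 1%N (A w) (B w) t) -/(P 2%N (A w) (B w) t) /zeroth_coef.
  have : expR t != 0 by rewrite gt_eqF// expR_gt0.
  generalize (P 2%N (A w) (B w) t) (P 1%N (A w) (B w) t) (P 0%N (A w) (B w) t) (P 0%N (A'' w) (B'' w) t) (expR t).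
  move=> p2 p1 p0 q0 r r0.
  generalize (derive1n 2 ue0 r / ue0 r) (derive1 ue0 r / ue0 r) (derive1n 2 ue0 r) ((ue0 r)^-1) => x y x' y'.
  by field.
do ![apply: symbol_rapidD].
- by apply: hZ; apply: (he _ _ (he _ _ (he _ _ (hP 2%N (A w) (B w))))).
- by apply: hZ; apply: (he _ _ (he _ _ (hP 1%N (A w) (B w)))).
- by apply: (hZ _); apply: he; apply: symbol_rapidD; [exact: hP|by apply: (hZ _); exact: hP].
- apply: he; apply: symbol_moderate_rapid; last exact: hP.
  by apply: symbol_sub (symbol_zeroth_coef hR0 ht0 hue0 3); exact: rapid_moderate.
Qed.

End euler_data.

(** * Uniform bounds on the corrector *)

Section euler_solutions.
Context {R : realType}.
#[local] Opaque d1 d2 derive1.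
Variables (R0 t0 th K Ka0 : R) (ue0 vp0 Vb0 Vb1 chi ub1 : R -> R).
Hypotheses (hR0 : 0 < R0) (ht0 : expR t0 = R0) (hth : 0 < th)
  (hue0 : euler0 R0 ue0) (hvp0 : class_C 2 vp0)
  (hdata : euler1_data R0 th K vp0 Vb0 Vb1)
  (hchi : cutoff chi) (hub1 : smooth_exp_decay R0 ub1)
  (hKa0 : forall t, t0 < t -> `|zeroth_coef ue0 t| <= Ka0)
  (hthK : th ^+ 2 * (4%:R ^+ 2 + Ka0 + 3) <= 1).
Implicit Types (w r t : R).

Lemma cutoff_bound : exists X : R, forall s, 0 <= s -> `|chi s| <= X.
Proof.
case: hchi => sc _ c1.
have cc : continuous chi by case: (sc 0%N).
have [M M0 hM] := interval_bound 0 1 cc.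
exists M => s s0; have [s1|s1] := leP s 1; first by apply: hM; rewrite s0.
by rewrite c1 ?normr0// ltW.
Qed.

Let F w t := expR t ^+ 2 * euler1_op ue0 (euler1_bdry th vp0 Vb0 Vb1) w (expR t).

(** [z] to [z3] are the powers of [d_t = r d_r] applied to [r v]; the coefficients are Stirling
    numbers of the second kind. *)
Let z v w t := expR t * v w (expR t) : R.
Let z1 v w t := expR t * v w (expR t) + expR t ^+ 2 * d2 v w (expR t) : R.
Let z2 v w t := expR t * v w (expR t) + 3 * (expR t ^+ 2 * d2 v w (expR t))
  + expR t ^+ 3 * d2 (d2 v) w (expR t) : R.
Let z3 v w t := expR t * v w (expR t) + 7 * (expR t ^+ 2 * d2 v w (expR t))
  + 6 * (expR t ^+ 3 * d2 (d2 v) w (expR t)) + expR t ^+ 4 * d2 (d2 (d2 v)) w (expR t) : R.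
Let zw v w t := expR t * d1 v w (expR t) : R.
Let zww v w t := expR t * d1 (d1 v) w (expR t) : R.

Lemma cont2_exp (g : R -> R -> R) w t : (forall w r, cont2 g w r) ->
  cont2 (fun w t => g w (expR t)) w t.
Proof.
move=> gc.
apply: (@continuous_comp _ _ _ (fun q : R * R => (q.1, expR q.2)) (fun q : R * R => g q.1 q.2)); last exact: gc.
apply: (@cvg_pair _ _ _ _ (nbhs w) (nbhs (expR t))); first exact: cvg_fst.
exact: (@cont2_of_snd R expR w t (@continuous_expR R t)).
Qed.

Lemma der_exp_pow (g : R -> R) n t g' : der g (expR t) g' ->
  der (fun t => expR t ^+ n * g (expR t)) t
    (n%:R * (expR t ^+ n * g (expR t)) + expR t ^+ n.+1 * g').
Proof.
move=> dg; have dexp := is_derive_expR t.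
apply: (der_eq (derM (derX n dexp) (der_comp dg dexp))).
by case: n => [|n]; rewrite /= ?exprS; ring.
Qed.

Lemma euler1_layer_sol eps v : 0 < eps -> euler1 R0 th eps ue0 vp0 Vb0 Vb1 chi v ->
  layer_sol t0 th (zeroth_coef ue0) (F 0) (F th) (fun t => expR t * Vb0 (expR t))
    (fun t => expR t * Vb1 (expR t)) (fun w => - (R0 * vp0 w)) chi eps
    (z v) (z1 v) (z2 v) (z3 v) (zw v) (zww v).
Proof.
move=> eps0 hv; have v3 := euler1_class hv.
have ce n (g : R -> R -> R) w t : (forall w r, cont2 g w r) -> cont2 (fun w t => expR t ^+ n * g w (expR t)) w t.
  move=> gc; apply: cont2M; last exact: cont2_exp.
  apply: cont2_of_snd; apply: der_continuous; exact: (derX n (is_derive_expR t)).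
have ce1 (g : R -> R -> R) w t : (forall w r, cont2 g w r) -> cont2 (fun w t => expR t * g w (expR t)) w t.
  by move=> gc; exact: (ce 1%N g).
have cz c (g : R -> R -> R) w t : cont2 g w t -> cont2 (fun w t => c * g w t) w t.
  by move=> gc; apply: cont2M => //; exact: cont2_cst.
have c0 w r : cont2 v w r := class_C2_cont w r v3.
have c1 w r : cont2 (d2 v) w r := class_C2_cont w r (class_C2_d2 v3).
have c2 w r : cont2 (d2 (d2 v)) w r := class_C2_cont w r (class_C2_d2 (class_C2_d2 v3)).
have c3 w r : cont2 (d2 (d2 (d2 v))) w r :=
  class_C2_cont w r (class_C2_d2 (class_C2_d2 (class_C2_d2 v3))).
have c11 w r : cont2 (d1 (d1 v)) w r := class_C2_cont w r (class_C2_d1 (class_C2_d1 v3)).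
have D0 w t := @der_exp_pow (v w) 1 t _ (class_C2_der2 w (expR t) v3).
have D1 w t := @der_exp_pow (d2 v w) 2 t _ (class_C2_der2 w (expR t) (class_C2_d2 v3)).
have D2 w t := @der_exp_pow (d2 (d2 v) w) 3 t _ (class_C2_der2 w (expR t) (class_C2_d2 (class_C2_d2 v3))).
split.
- by move=> w t; exact: ce1.
- by move=> w t; apply: cont2D; [exact: ce1|exact: ce].
- by move=> w t; apply: cont2D; [apply: cont2D; [exact: ce1|apply: cz; exact: ce]|exact: ce].
- move=> w t; apply: cont2D; last exact: ce.
  by apply: cont2D; [apply: cont2D; [exact: ce1|apply: cz; exact: ce]|apply: cz; exact: ce].
- by move=> w t; exact: ce1.
- move=> w t; apply: (der_eq (D0 w t)); rewrite /z1 mul1r expr1; reflexivity.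
- move=> w t; apply: (der_eq (derD (D0 w t) (D1 w t))); rewrite /z2.
  generalize (v w (expR t)) (d2 v w (expR t)) (d2 (d2 v) w (expR t)) (expR t) => a b c e; ring.
- move=> w t; apply: (der_eq (derD (derD (D0 w t) (derZ 3 (D1 w t))) (D2 w t))); rewrite /z3.
  have e3 (a b c d e : R) : 1%:R * (e ^+ 1 * a) + e ^+ 2 * b + 3 * (2%:R * (e ^+ 2 * b) + e ^+ 3 * c)
    + (3%:R * (e ^+ 3 * c) + e ^+ 4 * d)
    = e * a + 7 * (e ^+ 2 * b) + 6 * (e ^+ 3 * c) + e ^+ 4 * d by ring.
  exact: e3.
- by move=> w t; apply: derZ; exact: class_C2_der1 w (expR t) v3.
- by move=> w t; apply: derZ; exact: class_C2_der1 w (expR t) (class_C2_d1 v3).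
- move=> w t hw ht.
  have := euler1_eq hv hw (exp_gt_R0 ht0 ht).
  rewrite /euler1_source /F -/(euler1_bdry th vp0 Vb0 Vb1) => E.
  have {}E := congr1 (fun x => expR t ^+ 2 * x) E.
  have -> : chi (w / eps) * (expR t ^+ 2 * euler1_op ue0 (euler1_bdry th vp0 Vb0 Vb1) 0 (expR t)) +
    chi ((th - w) / eps) * (expR t ^+ 2 * euler1_op ue0 (euler1_bdry th vp0 Vb0 Vb1) th (expR t)) =
    expR t ^+ 2 * (chi (w / eps) * euler1_op ue0 (euler1_bdry th vp0 Vb0 Vb1) 0 (expR t) +
      chi ((th - w) / eps) * euler1_op ue0 (euler1_bdry th vp0 Vb0 Vb1) th (expR t)).
    generalize (euler1_op ue0 (euler1_bdry th vp0 Vb0 Vb1) 0 (expR t))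
      (euler1_op ue0 (euler1_bdry th vp0 Vb0 Vb1) th (expR t)) => a b; ring.
  rewrite -E /euler1_op /z2 /zww /z /zeroth_coef.
  have : expR t != 0 by rewrite gt_eqF// expR_gt0.
  move: (v w (expR t)) (d2 v w (expR t)) (d2 (d2 v) w (expR t)) (d1 (d1 v) w (expR t)) (expR t).
  move=> v0 vr vrr vww r r0.
  move: (derive1n 2 ue0 r) (derive1 ue0 r) ((ue0 r)^-1) => x y y'.
  by field.
- move=> t ht; rewrite /z (euler1_left hv)// -ht0 ler_expR//.
- move=> t ht; rewrite /z (euler1_right hv)// -ht0 ler_expR//.
- by move=> w hw; rewrite /z ht0 (euler1_bottom hv hw) mulrN.
(* The decay of [v] becomes smallness of [z = r v] relative to [expR (t - t0)]; the factor [R0]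
   between [r] and this exponential is absorbed in [e]. *)
- move=> e e0; have [|A [_ hA]] := euler1_infty hv (e := e / R0); first by rewrite divr_gt0.
  exists A => w t hw hAt.
  have At : A < expR t.
    by apply: (le_lt_trans hAt); apply: (@lt_le_trans _ _ (1 + t)); [rewrite ltrDr|exact: expR_ge1Dx].
  have := hA _ At w hw => h.
  rewrite /z normrM ger0_norm ?expR_ge0// expRD expRN ht0 mulrA (mulrC e) -mulrA.
  by apply: ler_wpM2l => //; exact: expR_ge0.
Qed.

Lemma inv_r_ipow : exists2 m : R, 0 < m & forall t, t0 < t ->
  weight t0 4%:R t <= m * ipow R0 4 (expR t).
Proof.
pose m := Num.max 1 R0.
have m1 : 1 <= m by rewrite le_max lexx.
have mR : R0 <= m by rewrite le_max lexx orbT.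
have m0 : 0 < m by exact: lt_le_trans m1.
exists (m ^+ 4); first exact: exprn_gt0.
move=> t ht; have hr := exp_gt_R0 ht0 ht.
have r0 : 0 < expR t := expR_gt0 t.
have y0 : 0 < 1 + (expR t - R0) by lra.
have -> : weight t0 4%:R t = (R0 / expR t) ^+ 4.
  rewrite /weight mulrC -mulNr expRM_natr opprB expRD expRN ht0; reflexivity.
rewrite /ipow -exprVn -exprMn.
apply: lerXn2r; rewrite ?nnegrE ?divr_ge0 ?(ltW hR0) ?(ltW r0) ?(ltW m0) ?(ltW y0)//.
rewrite ler_pdivrMr// mulrAC ler_pdivlMr//.
have [h|h] := leP R0 1; nra.
Qed.

(** [C] is chosen before [eps] and may depend on [th] and the data. The integrands are recovered
    from [t]-derivatives by [d_r^2 = r^-2 (d_t^2 - d_t)] and its third-order analogue; integration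
    over the angle costs a factor [th]. The second derivative of [ue1] rests on the third derivative
    of [z], so its constant [C'] comes after [eps] and [v]. *)
Lemma euler_corrector_bounds : exists2 C, 0 <= C &
  forall eps v, 0 < eps -> euler1 R0 th eps ue0 vp0 Vb0 Vb1 chi v ->
  (forall w r, 0 <= w <= th -> R0 < r ->
     `|ue1 ub1 v w r| <= C /\ `|ue1_d ub1 v w r| <= C * ipow R0 4 r) /\
  exists2 C', 0 <= C' & forall w r, 0 <= w <= th -> R0 < r ->
     `|ue1_dd ub1 v w r| <= C' * ipow R0 4 r.
Proof.
have [X hX] := cutoff_bound.
have sS V : smooth_exp_decay R0 V -> symbol t0 (rapid t0) 3 (fun t => expR t * V (expR t)).
  move=> hV; apply: symbol_moderate_rapid; first exact: symbol_exp.
  exact: (symbol_smooth_exp_decay hR0 ht0 3 0 hV).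
have cS V : smooth_exp_decay R0 V -> continuous (fun t => expR t * V (expR t)).
  move=> hV t; apply: der_continuous.
  exact: (derM (is_derive_expR t) (der_comp (smooth_der 0 (expR t) hV.1) (is_derive_expR t))).
have hV0 := euler1_Vb0 hdata; have hV1 := euler1_Vb1 hdata.
have dg w : der (fun w => - (R0 * vp0 w)) w (- (R0 * derive1 vp0 w)).
  exact: (derN (derZ R0 (der_vp0 hvp0 w))).
have ddg w : der (fun w => - (R0 * derive1 vp0 w)) w (- (R0 * derive1 (derive1 vp0) w)).
  exact: (derN (derZ R0 (der_vp0' hvp0 w))).
have cddg : continuous (fun w => - (R0 * derive1 (derive1 vp0) w)).
  move=> w; apply: cvgN; apply: cvgM; first exact: cvg_cst.
  exact: (continuous_vp0'' hvp0).
have k0 : expR t0 * Vb0 (expR t0) = - (R0 * vp0 0).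
  by rewrite ht0 (euler1_corner0 hdata) mulrN.
have k1 : expR t0 * Vb1 (expR t0) = - (R0 * vp0 th).
  by rewrite ht0 (euler1_corner1 hdata) mulrN.
have hF w := boundary_data_rapid th hR0 ht0 hue0 hvp0 hV0 hV1 w.
have ha := symbol_zeroth_coef hR0 ht0 hue0 3.
have [C C0 hC] := layer_uniform_bounds hth hKa0 hthK ha (hF 0) (hF th) (sS _ hV0) (sS _ hV1)
  (cS _ hV0) (cS _ hV1) dg ddg cddg k0 k1 hX.
have [B0 B00 hB0] := exp_decay_ipow 0 (hub1.2 0%N).
have [B1 B10 hB1] := exp_decay_ipow 4 (hub1.2 1%N).
have [B2 B20 hB2] := exp_decay_ipow 4 (hub1.2 2%N).
have [m m0 hm] := inv_r_ipow.
pose D := B0 + B1 + th * (C / R0) + th * (2 * C * m / R0 ^+ 2).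
have D1 : 0 <= th * (C / R0) by rewrite mulr_ge0 ?divr_ge0 ?(ltW hth) ?(ltW hR0).
have D2 : 0 <= th * (2 * C * m / R0 ^+ 2).
  by rewrite mulr_ge0 ?(ltW hth)// divr_ge0 ?sqr_ge0// !mulr_ge0 ?(ltW m0).
exists D; first by rewrite /D; lra.
move=> eps v eps0 hv.
have h := euler1_layer_sol eps0 hv.
have hb := hC _ _ _ _ _ _ _ eps0 h.
have [C3 C30 hb3] := layer_third_bound hth hKa0 hthK ha (hF 0) (hF th) (sS _ hV0) (sS _ hV1)
  dg cddg hX eps0 h.
have v3 := euler1_class hv.
have rt r : R0 < r -> exists2 t, t0 < t & expR t = r.
  move=> hr; have r0 : 0 < r by exact: lt_trans hr.
  by exists (ln r); [rewrite -ltr_expR lnK ?posrE// ht0|rewrite lnK ?posrE].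
have w1 t : t0 < t -> weight t0 4%:R t <= 1.
  move=> ht; have := @weight_le R t0 4%:R t0 (t - t0) (ler0n _ _).
  have -> : t0 + (t - t0) = t by ring.
  by rewrite weight_t0; apply; rewrite subr_ge0 ltW.
have b0 w r : 0 <= w <= th -> R0 < r -> `|ue1_integrand0 v w r| <= C / R0.
  move=> hw hr; have [t ht rE] := rt r hr; have [q1 _] := hb w t hw ht.
  have r0 : 0 < r by exact: lt_trans hr.
  have -> : ue1_integrand0 v w r = z1 v w t / r.
    rewrite /z1 rE /ue1_integrand0; have : r != 0 by rewrite gt_eqF.
    generalize (v w r) (d2 v w r) => a b ?; by field.
  rewrite normrM normfV (gtr0_norm r0); apply: ler_pM; rewrite ?invr_ge0 ?(ltW r0)//.
    by apply: (le_trans q1); rewrite ler_piMr// w1.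
  by rewrite lef_pV2 ?posrE// ltW.
have b1 w r : 0 <= w <= th -> R0 < r -> `|ue1_integrand1 v w r| <= 2 * C * m / R0 ^+ 2 * ipow R0 4 r.
  move=> hw hr; have [t ht rE] := rt r hr; have [q1 q2] := hb w t hw ht.
  have r0 : 0 < r by exact: lt_trans hr.
  have -> : ue1_integrand1 v w r = (z2 v w t - z1 v w t) / r ^+ 2.
    rewrite /z1 /z2 rE /ue1_integrand1; have : r != 0 by rewrite gt_eqF.
    generalize (v w r) (d2 v w r) (d2 (d2 v) w r) => a b c ?; by field.
  rewrite normrM normfV (gtr0_norm (exprn_gt0 2 r0)).
  have -> : 2 * C * m / R0 ^+ 2 * ipow R0 4 r = (2 * C * (m * ipow R0 4 r)) / R0 ^+ 2 by ring.
  apply: ler_pM; rewrite ?invr_ge0 ?sqr_ge0//.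
    apply: (le_trans (ler_normB _ _)).
    have -> : 2 * C * (m * ipow R0 4 r) = C * (m * ipow R0 4 r) + C * (m * ipow R0 4 r) by ring.
    have hw4 := hm t ht; rewrite rE in hw4.
    by apply: lerD; [apply: (le_trans q2)|apply: (le_trans q1)]; exact: ler_wpM2l.
  rewrite lef_pV2 ?posrE ?exprn_gt0//; apply: lerXn2r; rewrite ?nnegrE ?(ltW hR0) ?(ltW r0)//.
  exact: ltW.
have b2 w r : 0 <= w <= th -> R0 < r -> `|ue1_integrand2 v w r| <= (C3 + 3 * C + 2 * C) * m / R0 ^+ 3 * ipow R0 4 r.
  move=> hw hr; have [t ht rE] := rt r hr; have [q1 q2] := hb w t hw ht; have q3 := hb3 w t hw ht.
  have r0 : 0 < r by exact: lt_trans hr.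
  have -> : ue1_integrand2 v w r = (z3 v w t - 3 * z2 v w t + 2 * z1 v w t) / r ^+ 3.
    rewrite /z1 /z2 /z3 rE /ue1_integrand2; have : r != 0 by rewrite gt_eqF.
    generalize (v w r) (d2 v w r) (d2 (d2 v) w r) (d2 (d2 (d2 v)) w r) => a b c d ?; by field.
  rewrite normrM normfV (gtr0_norm (exprn_gt0 3 r0)).
  have -> : (C3 + 3 * C + 2 * C) * m / R0 ^+ 3 * ipow R0 4 r
    = (C3 + 3 * C + 2 * C) * (m * ipow R0 4 r) / R0 ^+ 3 by ring.
  apply: ler_pM; rewrite ?invr_ge0 ?exprn_ge0 ?(ltW r0)//.
    have hw4 := hm t ht; rewrite rE in hw4.
    have -> : (C3 + 3 * C + 2 * C) * (m * ipow R0 4 r) =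
      C3 * (m * ipow R0 4 r) + 3 * (C * (m * ipow R0 4 r)) + 2 * (C * (m * ipow R0 4 r)) by ring.
    apply: (le_trans (ler_normD _ _)); apply: lerD.
      apply: (le_trans (ler_normB _ _)); apply: lerD.
        by apply: (le_trans q3); exact: ler_wpM2l.
      rewrite normrM ger0_norm//; apply: ler_wpM2l => //.
      by apply: (le_trans q2); exact: ler_wpM2l.
    rewrite normrM ger0_norm//; apply: ler_wpM2l => //.
    by apply: (le_trans q1); exact: ler_wpM2l.
  rewrite lef_pV2 ?posrE ?exprn_gt0//; apply: lerXn2r; rewrite ?nnegrE ?(ltW hR0) ?(ltW r0)//.
  exact: ltW.
have ci (g : R -> R -> R) M w r : (forall w r, cont2 g w r) -> 0 <= M -> 0 <= w <= th ->
    (forall a, 0 <= a <= th -> `|g a r| <= M) ->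
    `|\int[@lebesgue_measure R]_(a in `[0, w]) g a r| <= th * M.
  move=> gc M0 /andP[w0 wt] hg.
  apply: (@le_trans _ _ (M * (w - 0))).
    apply: continuous_Rintegral_le_bound => //; first exact: cont2_section1.
    by move=> a /andP[a0 aw]; apply: hg; rewrite a0 (le_trans aw).
  by rewrite subr0 mulrC; apply: ler_wpM2r.
split.
  move=> w r hw hr; have r' := ltW hr; have ip0 := ipow_gt0 4 r'; split.
    rewrite (ue1E v3); apply: (le_trans (ler_normB _ _)).
    apply: (@le_trans _ _ (B0 + th * (C / R0))); last by rewrite /D; lra.
    apply: lerD.
      by have := hB0 r r'; rewrite /ipow expr0 invr1 mulr1.
    apply: ci => //; [exact: cont_integrand0|by rewrite divr_ge0 ?(ltW hR0)|].
    by move=> a aI; exact: b0.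
  rewrite /ue1_d; apply: (le_trans (ler_normB _ _)).
  apply: (@le_trans _ _ ((B1 + th * (2 * C * m / R0 ^+ 2)) * ipow R0 4 r)); last first.
    by apply: ler_wpM2r; [exact: ltW|rewrite /D; lra].
  rewrite mulrDl; apply: lerD; first exact: hB1 r r'.
  rewrite -[X in _ <= X]mulrA; apply: ci => //; [exact: cont_integrand1| |].
    by rewrite mulr_ge0 ?(ltW ip0)// divr_ge0 ?sqr_ge0// !mulr_ge0 ?(ltW m0).
  by move=> a aI; exact: b1.
have E0 : 0 <= (C3 + 3 * C + 2 * C) * m / R0 ^+ 3.
  by rewrite divr_ge0 ?exprn_ge0 ?(ltW hR0)// mulr_ge0 ?(ltW m0)//; lra.
exists (B2 + th * ((C3 + 3 * C + 2 * C) * m / R0 ^+ 3)).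
  by apply: addr_ge0; [exact: ltW|apply: mulr_ge0; [exact: ltW|exact: E0]].
move=> w r hw hr; have r' := ltW hr; have ip0 := ipow_gt0 4 r'.
rewrite /ue1_dd; apply: (le_trans (ler_normB _ _)).
rewrite mulrDl; apply: lerD; first exact: hB2 r r'.
rewrite -[X in _ <= X]mulrA; apply: ci => //; [exact: cont_integrand2| |].
  by rewrite mulr_ge0 ?(ltW ip0).
by move=> a aI; exact: b2.
Qed.

End euler_solutions.

(** * The full profile *)

Section full_profile.
Context {R : realType}.
#[local] Opaque d1 d2 derive1.
Implicit Types (w x : R).

Lemma r_of_gt (R0 eps x : R) : 0 < eps -> R0 < x -> R0 < r_of R0 eps x.
Proof. by move=> e0 hx; rewrite /r_of ltrDl mulr_gt0 ?sqrtr_gt0// subr_gt0. Qed.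

Lemma der_r_of (R0 eps x : R) : der (r_of R0 eps) x (Num.sqrt eps).
Proof.
apply: (der_eq (derD (der_cst R0 x) (derZ (Num.sqrt eps) (derB (der_id x) (der_cst R0 x))))).
by rewrite add0r subr0 mulr1.
Qed.

Definition us_d (R0 eps : R) (ue0 ub1 : R -> R) (up ve1 : R -> R -> R) w x :=
  Num.sqrt eps * derive1n 1 ue0 (r_of R0 eps x) + d2 up w x
  + Num.sqrt eps * (Num.sqrt eps * ue1_d ub1 ve1 w (r_of R0 eps x)).

Definition us_dd (R0 eps : R) (ue0 ub1 : R -> R) (up ve1 : R -> R -> R) w x :=
  Num.sqrt eps * (Num.sqrt eps * derive1n 2 ue0 (r_of R0 eps x)) + d2 (d2 up) w x
  + Num.sqrt eps * (Num.sqrt eps * (Num.sqrt eps * ue1_dd ub1 ve1 w (r_of R0 eps x))).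

Section regularity.
Variables (R0 eps : R) (ue0 ub1 : R -> R) (up ve1 : R -> R -> R).
Hypotheses (sue0 : smooth ue0) (sub1 : smooth ub1) (cup : class_C2 3 up) (cve : class_C2 3 ve1).

Lemma der_us w x : der (us R0 eps ue0 ub1 up ve1 w) x (us_d R0 eps ue0 ub1 up ve1 w x).
Proof.
apply: derD.
  apply: derD; last exact: class_C2_der2 w x cup.
  exact: (der_comp (smooth_der 0 _ sue0) (der_r_of R0 eps x)).
by apply: derZ; exact: (der_comp (der_ue1 cve sub1 w _) (der_r_of R0 eps x)).
Qed.

Lemma der_us_d w x : der (us_d R0 eps ue0 ub1 up ve1 w) x (us_dd R0 eps ue0 ub1 up ve1 w x).
Proof.
apply: derD.
  apply: derD; last exact: class_C2_der2 w x (class_C2_d2 cup).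
  by apply: derZ; exact: (der_comp (smooth_der 1 _ sue0) (der_r_of R0 eps x)).
apply: derZ; apply: derZ.
exact: (der_comp (der_ue1_d cve sub1 w _) (der_r_of R0 eps x)).
Qed.

Lemma d2_us : d2 (us R0 eps ue0 ub1 up ve1) = us_d R0 eps ue0 ub1 up ve1.
Proof. by apply/funext => w; apply/funext => x; apply: der_derive1; exact: der_us. Qed.

Lemma d22_us : d2 (d2 (us R0 eps ue0 ub1 up ve1)) = us_dd R0 eps ue0 ub1 up ve1.
Proof. by rewrite d2_us; apply/funext => w; apply/funext => x; apply: der_derive1; exact: der_us_d. Qed.

Lemma cont2_r_of (g : R -> R -> R) w x : cont2 g w (r_of R0 eps x) ->
  cont2 (fun w x => g w (r_of R0 eps x)) w x.
Proof.
move=> gc.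
apply: (@continuous_comp _ _ _ (fun q : R * R => (q.1, r_of R0 eps q.2)) (fun q : R * R => g q.1 q.2)); last exact: gc.
apply: (@cvg_pair _ _ _ _ (nbhs w) (nbhs (r_of R0 eps x))); first exact: cvg_fst.
exact: (@cont2_of_snd R (r_of R0 eps) w x (der_continuous (der_r_of R0 eps x))).
Qed.

Lemma cont_us w x : 0 < w -> cont2 (us R0 eps ue0 ub1 up ve1) w x.
Proof.
move=> w0; apply: cont2D.
  apply: cont2D; last exact: class_C2_cont w x cup.
  apply: (@cont2_r_of (fun _ r => ue0 r)); apply: cont2_of_snd.
  exact: (der_continuous (smooth_der 0 _ sue0)).
by apply: cont2M; [exact: cont2_cst|apply: cont2_r_of; exact: (cont_ue1 cve sub1)].
Qed.

Lemma cont_us_dd w x : 0 < w -> cont2 (us_dd R0 eps ue0 ub1 up ve1) w x.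
Proof.
move=> w0; apply: cont2D.
  apply: cont2D; last exact: class_C2_cont w x (class_C2_d2 (class_C2_d2 cup)).
  do 2 (apply: cont2M; first exact: cont2_cst).
  apply: (@cont2_r_of (fun _ r => derive1n 2 ue0 r)); apply: cont2_of_snd.
  exact: (der_continuous (smooth_der 2 _ sue0)).
do 3 (apply: cont2M; first exact: cont2_cst).
by apply: cont2_r_of; exact: (cont_ue1_dd cve sub1).
Qed.

End regularity.

(** Close to the wall [ue0] differs little from its boundary value, and the Prandtl velocity gives
    the lower bound; beyond [Y] the Prandtl part is small and [ue0] gives it. The quantifiers fix
    [c0], [A] and [ths] before [th], since the constant of the theorem is built from them, and leave
    to [s0] whatever depends on the corrector. *)
Lemma us_bounds (R0 ub thb K : R)
    (ue0 ubar0 ub1 chi : R -> R) (up : R -> R -> R) (vp0 : R -> R)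
    (hR0 : 0 < R0) (hthb : 0 < thb)
    (hue0 : euler0 R0 ue0) (hubar0 : smooth_exp_decay R0 ubar0)
    (hub1 : smooth_exp_decay R0 ub1)
    (hmin : 0 < Num.min ub (inf [set ue0 R0 + ubar0 x | x in `[R0, +oo[]))
    (hup : prandtl0 R0 ub thb ue0 ubar0 up vp0)
    (hchi : cutoff chi) :
  exists c0 A ths : R, [/\ 0 < c0, 0 < A, 0 < ths <= thb &
  forall th : R, 0 < th <= ths ->
  forall Vb0 Vb1 : R -> R, euler1_data R0 th K vp0 Vb0 Vb1 ->
  exists2 s0 : R, 0 < s0 <= 1 &
  forall eps : R, 0 < eps -> Num.sqrt eps <= s0 ->
  forall ve1 : R -> R -> R, euler1 R0 th eps ue0 vp0 Vb0 Vb1 chi ve1 ->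
  (forall w x, 0 <= w <= th -> R0 < x ->
     c0 <= us R0 eps ue0 ub1 up ve1 w x /\
     `|us_d R0 eps ue0 ub1 up ve1 w x|
       <= A * (Num.sqrt eps * ipow R0 4 (r_of R0 eps x) + ipow R0 4 x)) /\
  exists2 C, 0 <= C & forall w x, 0 <= w <= th -> R0 < x ->
     `|us_dd R0 eps ue0 ub1 up ve1 w x| <= C * ipow R0 4 x].
Proof.
have [c [A0 [M [th1 [c00 A00 M0 /andP[th10 th1b] hP]]]]] := prandtl_bounds hR0 hthb hubar0 hmin hup.
have [sue0 [ce [ce0 hce]] eue0] := hue0.
have [L L0 hL] := exp_decay_ipow 4 (eue0 1%N isT).
have [L2 L20 hL2] := exp_decay_ipow 4 (eue0 2%N isT).
pose t0 := ln R0.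
have ht0 : expR t0 = R0 by rewrite lnK ?posrE.
have [Ka0 Ka00 hKa0'] := (symbol_zeroth_coef hR0 ht0 hue0 0).1 0%N.
have hKa0 t : t0 < t -> `|zeroth_coef ue0 t| <= Ka0.
  by move=> /hKa0'; rewrite weight0 mulr1.
(* The four entries secure the Prandtl bounds, [th <= 1], the smallness of the non-decaying error
   [M * w], and the thinness required by the elliptic estimates. *)
pose ths := Num.min (Num.min th1 1) (Num.min (ce / (4 * (M + 1))) (4%:R ^+ 2 + Ka0 + 3)^-1).
have M1 : 0 < M + 1 by lra.
have Kp : 0 < 4%:R ^+ 2 + Ka0 + 3 by rewrite -addrA ltr_pwDl// ?exprn_gt0// addr_ge0.
have ths0 : 0 < ths by rewrite !lt_min th10 ltr01 divr_gt0 ?mulr_gt0//= invr_gt0.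
pose cm := Num.min c ce; have cm0 : 0 < cm by rewrite lt_min c00.
have cmc : cm <= c by rewrite ge_min lexx.
have cmce : cm <= ce by rewrite ge_min lexx orbT.
(* [L] comes from [ue0], [A0] from the Prandtl part, and [1] from the corrector, whose constant is
   absorbed by [s * C <= 1]. *)
exists (cm / 4), (L + A0 + 1), ths; split.
- by rewrite divr_gt0.
- by rewrite !addr_gt0.
- by rewrite ths0 /= !ge_min (ltW th1b).
move=> th /andP[th0]; rewrite !le_min => /andP[/andP[hth1 hth2] /andP[hM hK]] Vb0 Vb1 hdata.
have hthM : M * th <= ce / 4.
  apply: (@le_trans _ _ ((M + 1) * th)); first by apply: ler_wpM2r; [exact: ltW|rewrite lerDl].
  move: hM; rewrite ler_pdivlMr ?mulr_gt0// => hM; rewrite ler_pdivlMr//.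
  by rewrite (_ : _ * 4 = th * (4 * (M + 1)))//; ring.
have hthK : th ^+ 2 * (4%:R ^+ 2 + Ka0 + 3) <= 1.
  apply: (@le_trans _ _ (th * (4%:R ^+ 2 + Ka0 + 3))).
    apply: ler_wpM2r; first exact: ltW.
    by rewrite expr2 ler_piMl// ltW.
  by rewrite -ler_pdivlMr// div1r.
have hvp0 := prandtl0_trace_class hup.
have [C C0 hC] := euler_corrector_bounds hR0 ht0 th0 hue0 hvp0 hdata hchi hub1 hKa0 hthK.
(* Beyond distance [Y] from the wall, [A0 / (x - R0)] is at most [ce / 4]. *)
pose Y := 4 * A0 / ce.
have Y0 : 0 < Y by rewrite divr_gt0// mulr_gt0.
pose s0 := Num.min 1 (Num.min (c / (4 * (L * Y))) (Num.min (cm / (4 * (C + 1))) (C + 1)^-1)).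
have C1 : 0 < C + 1 by lra.
have LY0 : 0 < L * Y by rewrite mulr_gt0.
have s00 : 0 < s0.
  by rewrite !lt_min ltr01 invr_gt0 C1 andbT /= !divr_gt0// mulr_gt0.
exists s0; first by rewrite s00 ge_min lexx.
move=> eps eps0; rewrite !le_min => /andP[s1 /andP[sLY /andP[sC sC1]]] ve1 hve.
set s := Num.sqrt eps in s1 sLY sC sC1 *.
have sp : 0 < s by rewrite sqrtr_gt0.
have {}sLY : s * (L * Y) <= c / 4.
  have p4 : 0 < 4 * (L * Y) by rewrite mulr_gt0.
  move: sLY; rewrite ler_pdivlMr// => h; rewrite ler_pdivlMr//.
  by rewrite (_ : _ * 4 = s * (4 * (L * Y)))//; ring.
have {}sC : s * C <= cm / 4.
  have p4 : 0 < 4 * (C + 1) by rewrite mulr_gt0.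
  move: sC; rewrite ler_pdivlMr// => h; rewrite ler_pdivlMr//.
  apply: le_trans h; have -> : s * (4 * (C + 1)) = s * C * 4 + s * 4 by ring.
  by rewrite lerDl mulr_ge0// ltW.
have {}sC1 : s * C <= 1.
  apply: (@le_trans _ _ (s * (C + 1))); first by apply: ler_wpM2l; [exact: ltW|rewrite lerDl].
  by rewrite -ler_pdivlMr// div1r.
have [hC1 [C' C'0 hC2]] := hC eps ve1 eps0 hve.
have wth w : 0 <= w <= th -> 0 <= w <= th1.
  by move=> /andP[-> h] /=; exact: le_trans h hth1.
split.
  move=> w x hw hx; have hx' := ltW hx.
  have hr := r_of_gt eps0 hx; set r := r_of R0 eps x in hr *; have hr' := ltW hr.
  have [P1 P2 P3 P4] := hP w x (wth _ hw) hx'.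
  have [Q1 Q2] := hC1 w r hw hr.
  have ip0 := ipow_gt0 4 hx'.
  have sQ : `|s * ue1 ub1 ve1 w r| <= cm / 4.
    rewrite normrM (gtr0_norm sp); apply: le_trans sC; apply: ler_wpM2l => //; exact: ltW.
  split.
    rewrite /us -/s -/r; move: sQ; rewrite ler_norml => /andP[sQ _].
    have [yY|yY] := leP (x - R0) Y.
      have l : `|ue0 r - ue0 R0| <= L * (r - R0).
        apply: (der_lipschitz hr' (df := derive1n 1 ue0)) => t /andP[t1 t2].
          exact: (smooth_der 0 t sue0).
        by apply: (le_trans (hL t t1)); rewrite ler_piMr ?ipow_le1// ltW.
      have : L * (r - R0) <= c / 4.
        apply: le_trans sLY; rewrite /r /r_of -/s addrC addKr mulrCA.
        by apply: ler_wpM2l; [exact: ltW|apply: ler_wpM2l => //; exact: ltW].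
      move: l; rewrite ler_norml => /andP[l _]; lra.
    have hcr := hce r hr'.
    have k : A0 * ipow R0 4 x <= ce / 4.
      have y0 : 0 < x - R0 by rewrite subr_gt0.
      apply: (@le_trans _ _ (A0 / (x - R0))).
        apply: ler_wpM2l; first exact: ltW.
        have h1 : 0 < 1 + (x - R0) by rewrite addr_gt0// subr_gt0.
        rewrite /ipow lef_pV2 ?posrE ?exprn_gt0//.
        apply: (@le_trans _ _ (1 + (x - R0))); first by rewrite lerDr.
        by apply: ler_eXnr => //; rewrite lerDl ltW.
      rewrite ler_pdivrMr//; apply: (@le_trans _ _ (ce / 4 * Y)).
        rewrite /Y (_ : ce / 4 * (4 * A0 / ce) = A0)//; field; by rewrite gt_eqF.
      by apply: ler_wpM2l; [rewrite divr_ge0// ltW|exact: ltW].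
    have Mw : M * w <= ce / 4.
      by apply: le_trans hthM; apply: ler_wpM2l => //; case/andP: hw.
    move: P2; rewrite ler_norml => /andP[P2 _]; lra.
  rewrite /us_d -/s -/r.
  have ir0 := ipow_gt0 4 hr'.
  apply: (@le_trans _ _ (s * (L * ipow R0 4 r) + A0 * ipow R0 4 x + s * (1 * ipow R0 4 r))).
    apply: (le_trans (ler_normD _ _)); apply: lerD.
      apply: (le_trans (ler_normD _ _)); apply: lerD => //.
      rewrite normrM (gtr0_norm sp); apply: ler_wpM2l; first exact: ltW.
      exact: hL.
    rewrite normrM (gtr0_norm sp); apply: ler_wpM2l; first exact: ltW.
    rewrite normrM (gtr0_norm sp); apply: (@le_trans _ _ (s * (C * ipow R0 4 r))).
      by apply: ler_wpM2l => //; exact: ltW.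
    by rewrite mulrA; apply: ler_wpM2r => //; exact: ltW.
  have -> : (L + A0 + 1) * (s * ipow R0 4 r + ipow R0 4 x) =
    s * (L * ipow R0 4 r) + A0 * ipow R0 4 x + s * (1 * ipow R0 4 r) +
    (A0 * (s * ipow R0 4 r) + (L + 1) * ipow R0 4 x) by ring.
  rewrite lerDl addr_ge0// mulr_ge0// ?(ltW A00)//; first by rewrite mulr_ge0 ?(ltW sp) ?(ltW ir0).
    by rewrite addr_ge0 ?(ltW L0).
  exact: ltW.
(* The powers of [s] come from replacing decay in [r] by decay in [x]; no uniformity in [eps] is
   sought here. *)
exists (L2 / s ^+ 4 + A0 + C' / s ^+ 4).
  by rewrite !addr_ge0 ?divr_ge0 ?exprn_ge0 ?(ltW sp) ?(ltW L20) ?(ltW A00).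
move=> w x hw hx; have hx' := ltW hx.
have hr := r_of_gt eps0 hx; set r := r_of R0 eps x in hr *; have hr' := ltW hr.
have [P1 P2 P3 P4] := hP w x (wth _ hw) hx'.
have Q := hC2 w r hw hr.
have ip0 := ipow_gt0 4 hx'.
have irx : ipow R0 4 r <= ipow R0 4 x / s ^+ 4.
  have h1 : 0 < 1 + (x - R0) by rewrite addr_gt0// subr_gt0.
  have h2 : 0 < 1 + (r - R0) by rewrite addr_gt0// subr_gt0.
  rewrite /ipow -invfM -exprMn lef_pV2 ?posrE ?exprn_gt0 ?mulr_gt0//.
  apply: lerXn2r; rewrite ?nnegrE ?mulr_ge0 ?(ltW h1) ?(ltW h2) ?(ltW sp)//.
  have -> : 1 + (r - R0) = 1 + s * (x - R0) by rewrite /r /r_of -/s; ring.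
  by rewrite mulrDl mul1r [_ * s]mulrC lerD2r.
rewrite /us_dd -/s -/r.
have sle b B : `|b| <= B -> `|s * b| <= B.
  move=> h; rewrite normrM (gtr0_norm sp); apply: le_trans h.
  by rewrite ler_piMl.
rewrite !mulrDl; apply: (le_trans (ler_normD _ _)); apply: lerD.
  apply: (le_trans (ler_normD _ _)); apply: lerD => //.
  do 2 apply: (sle).
  apply: (le_trans (hL2 r hr')); rewrite -mulrA (mulrC _^-1).
  by apply: ler_wpM2l => //; exact: ltW.
do 3 apply: (sle).
apply: (le_trans Q); rewrite -mulrA (mulrC _^-1).
by apply: ler_wpM2l.
Qed.

End full_profile.

(** * Absolutely continuous functions *)

Section Lebesgue_tools.
Context {R : realType}.
Notation mu := (@lebesgue_measure R).
Implicit Types (f g F G : R -> R) (D : set (measurableTypeR R)) (a b x : R).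

Definition L1 D f := mu.-integrable D (EFin \o f).

Lemma L1D D f g : measurable D -> L1 D f -> L1 D g -> L1 D (fun x => f x + g x).
Proof.
move=> mD hf hg; have h := integrableD mD hf hg.
by apply: (eq_integrable mD _ _ _ h) => x _ /=; rewrite EFinD.
Qed.

Lemma L1Z D f k : measurable D -> L1 D f -> L1 D (fun x => k * f x).
Proof.
move=> mD hf; have h := integrableZl mD k hf.
by apply: (eq_integrable mD _ _ _ h) => x _ /=; rewrite EFinM.
Qed.

Lemma L1_eq D f g : measurable D -> (forall x, D x -> f x = g x) -> L1 D f -> L1 D g.
Proof.
move=> mD fg hf; apply: (eq_integrable mD _ _ _ hf) => x; rewrite inE => Dx /=.
by rewrite fg.
Qed.

Lemma L1_measurable D f : L1 D f -> measurable_fun D f.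
Proof. by move=> /measurable_int /measurable_EFinP. Qed.

Lemma L1_le D f g : measurable D -> measurable_fun D f -> L1 D g ->
  (forall x, D x -> `|f x| <= g x) -> L1 D f.
Proof.
move=> mD mf ig h; apply: (le_integrable mD _ _ ig); first exact/measurable_EFinP.
by move=> x Dx /=; rewrite lee_fin; apply: (le_trans (h x Dx)); exact: ler_norm.
Qed.

Lemma L1_bounded_mul D f g M : measurable D -> measurable_fun D f -> L1 D g ->
  (forall x, D x -> `|f x| <= M) -> L1 D (fun x => f x * g x).
Proof.
move=> mD mf ig hM.
apply: (@L1_le _ _ (fun x => M * `|g x|)) => //.
- by apply: measurable_funM => //; exact: L1_measurable.
- by apply: L1Z => //; exact: (integrable_norm ig).
- by move=> x Dx; rewrite normrM; apply: ler_wpM2r => //; exact: hM.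
Qed.

Lemma Rintegral_linear D f g k : measurable D -> L1 D f -> L1 D g ->
  \int[mu]_(x in D) (f x + k * g x) = \int[mu]_(x in D) f x + k * \int[mu]_(x in D) g x.
Proof.
move=> mD hf hg; rewrite (RintegralD mD hf (L1Z k mD hg)).
by congr (_ + _); exact: RintegralZl.
Qed.

Lemma Rintegral_interval_cst a b (k : R) : a <= b -> \int[mu]_(x in `[a, b]) k = k * (b - a).
Proof.
move=> ab; rewrite Rintegral_cst//= lebesgue_measure_itv/= lte_fin.
case: ifPn => //=; rewrite -leNgt => ba.
have -> : b = a by apply: le_anti; rewrite ab ba.
by rewrite subrr.
Qed.

Lemma L1_cst a b (k : R) : L1 `[a, b] (fun _ => k).
Proof. by apply: continuous_integrable => ?; exact: cvg_cst. Qed.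

Lemma L1_restrict D f : measurable D -> L1 D f -> L1 setT (f \_ D).
Proof.
move=> mD hf; have h := @integrable_mkcond _ _ _ mu D (EFin \o f) mD.
by rewrite /L1 -restrict_EFin; apply/h.
Qed.

Lemma cauchy_schwarz_interval f a b : a < b -> L1 `[a, b] f -> L1 `[a, b] (fun x => f x ^+ 2) ->
  (\int[mu]_(x in `[a, b]) f x) ^+ 2 <= (b - a) * \int[mu]_(x in `[a, b]) (f x ^+ 2).
Proof.
move=> ab hf hf2.
set I := \int[mu]_(x in `[a, b]) f x; set S := \int[mu]_(x in `[a, b]) (f x ^+ 2).
have L0 : 0 < b - a by rewrite subr_gt0.
pose m := I / (b - a).
have h0 : 0 <= \int[mu]_(x in `[a, b]) ((f x - m) ^+ 2).
  by apply: Rintegral_ge0 => x _; exact: sqr_ge0.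
have e : \int[mu]_(x in `[a, b]) ((f x - m) ^+ 2) = S + (- 2 * m) * I + m ^+ 2 * (b - a).
  have mI : measurable (`[a, b]%classic : set (measurableTypeR R)) by [].
  rewrite -(Rintegral_interval_cst (m ^+ 2) (ltW ab)) -(Rintegral_linear (-2 * m) mI hf2 hf).
  rewrite -RintegralD//; last 2 first.
  - by apply: L1D => //; exact: L1Z.
  - exact: L1_cst.
  apply: eq_Rintegral => x _ /=; move: (f x) => y; ring.
move: h0; rewrite e {e}.
have -> : S + -2 * m * I + m ^+ 2 * (b - a) = S - I ^+ 2 / (b - a).
  have id (i j l : R) : l != 0 -> j + -2 * (i / l) * i + (i / l) ^+ 2 * l = j - i ^+ 2 / l.
    by move=> l0; field.
  by apply: id; rewrite gt_eqF.
by rewrite subr_ge0 ler_pdivrMr// mulrC.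
Qed.

Lemma measurable_continuous_on a b f : {within `[a, b], continuous f} ->
  measurable_fun `[a, b] f.
Proof. by move=> cf; apply: subspace_continuous_measurable_fun. Qed.

Lemma primitive_continuous_within a b f F : a <= b -> L1 `[a, b] f ->
  (forall x, a <= x <= b -> F x = F a + \int[mu]_(y in `[a, x]) f y) ->
  {within `[a, b], continuous F}.
Proof.
move=> ab hf hF.
have h : {within `[a, b], continuous (fun x => F a + \int[mu]_(y in `[a, x]) f y)}.
  move=> x; apply: cvgD; first exact: cvg_cst.
  exact: (parameterized_integral_continuous ab hf).
apply: (subspace_eq_continuous _ h) => x; rewrite inE /= in_itv /= => hx.
exact: (esym (hF x hx)).
Qed.

Lemma continuous_within_bounded a b F : a <= b -> {within `[a, b], continuous F} ->
  exists2 M, 0 <= M & forall x, a <= x <= b -> `|F x| <= M.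
Proof.
move=> ab cF.
have [c hc m] : exists2 c, c \in `[a, b] & forall t, t \in `[a, b] -> `|F t| <= `|F c|.
  apply: (@EVT_max R (fun x => `|F x|)) => // x.
  by apply: cvg_norm; exact: cF.
by exists `|F c| => // x hx; apply: m; rewrite in_itv.
Qed.

Lemma L1_continuous_mul a b f F : a <= b -> L1 `[a, b] f -> {within `[a, b], continuous F} ->
  L1 `[a, b] (fun x => F x * f x).
Proof.
move=> ab hf cF; have [M M0 hM] := continuous_within_bounded ab cF.
by apply: (@L1_bounded_mul _ _ _ M) => //; exact: measurable_continuous_on.
Qed.

(** Integrability of every section makes the inner integrals finite everywhere, so that the exchange
    passes from extended to real integrals. *)
Lemma RFubini (h : R -> R -> R) :
  (mu \x mu)%E.-integrable setT (fun z : R * R => (h z.1 z.2)%:E) ->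
  (forall x, L1 setT (h x)) -> (forall y, L1 setT (h^~ y)) ->
  \int[mu]_x \int[mu]_y h x y = \int[mu]_y \int[mu]_x h x y.
Proof.
move=> ih h1 h2.
have F := Fubini ih.
have e1 x : (\int[mu]_y (h x y)%:E = (\int[mu]_y h x y)%:E)%E.
  by rewrite /Rintegral fineK//; exact: (integrable_fin_num measurableT (h1 x)).
have e2 y : (\int[mu]_x (h x y)%:E = (\int[mu]_x h x y)%:E)%E.
  by rewrite /Rintegral fineK//; exact: (integrable_fin_num measurableT (h2 y)).
rewrite [LHS]/Rintegral [RHS]/Rintegral; congr fine.
transitivity (\int[mu]_x \int[mu]_y (h x y)%:E)%E; first by apply: eq_integral => x _; rewrite e1.
transitivity (\int[mu]_y \int[mu]_x (h x y)%:E)%E; first exact: F.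
by apply: eq_integral => y _; rewrite e2.
Qed.

(* Fubini on the triangle [a <= y <= x <= b]. *)
Lemma integration_by_parts_ac a b f g F G : a < b -> L1 `[a, b] f -> L1 `[a, b] g ->
  (forall x, a <= x <= b -> F x = \int[mu]_(y in `[a, x]) f y) ->
  (forall x, a <= x <= b -> G x = G a + \int[mu]_(y in `[a, x]) g y) ->
  \int[mu]_(x in `[a, b]) (f x * G x + F x * g x) = F b * G b.
Proof.
move=> ab hf hg hF hG; have ab' := ltW ab.
have mI : measurable (`[a, b]%classic : set (measurableTypeR R)) by [].
pose f0 := f \_ `[a, b]; pose g0 := g \_ `[a, b].
have if0 : L1 setT f0 := L1_restrict mI hf.
have ig0 : L1 setT g0 := L1_restrict mI hg.
have mf0 : measurable_fun setT f0 := L1_measurable if0.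
have mg0 : measurable_fun setT g0 := L1_measurable ig0.
pose h (x y : R) : R := if y <= x then f0 y * g0 x else 0.
have mh : measurable_fun setT (fun z : measurableTypeR R * measurableTypeR R => h z.1 z.2).
  apply: measurable_fun_ifT => //.
    by apply: measurable_fun_ler; [exact: measurable_snd|exact: measurable_fst].
  apply: measurable_funM; first exact: (measurableT_comp mf0 measurable_snd).
  exact: (measurableT_comp mg0 measurable_fst).
have hle x y : `|h x y| <= `|f0 y| * `|g0 x|.
  rewrite /h; case: ifP => _; first by rewrite normrM.
  by rewrite normr0 mulr_ge0.
have if1 : L1 setT (fun y => `|f0 y|) := integrable_norm if0.
have ig1 : L1 setT (fun y => `|g0 y|) := integrable_norm ig0.
have h1 x : L1 setT (h x).
  apply: (@L1_le _ _ (fun y => `|g0 x| * `|f0 y|)) => //.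
  - exact: (measurableT_comp mh (pair1_measurable x)).
  - exact: L1Z.
  - by move=> y _; rewrite mulrC.
have h2 y : L1 setT (h^~ y).
  apply: (@L1_le _ _ (fun x => `|f0 y| * `|g0 x|)) => //.
  - exact: (measurableT_comp mh (pair2_measurable y)).
  - exact: L1Z.
have ih : (mu \x mu)%E.-integrable setT (fun z : R * R => (h z.1 z.2)%:E).
  apply/integrable12ltyP; first exact/measurable_EFinP.
  apply: (@le_lt_trans _ _ (\int[mu]_x ((\int[mu]_y `|f0 y|) * `|g0 x|)%:E)%E).
    apply: ge0_le_integral; [exact: measurableT| | | |].
    - by move=> x _; apply: integral_ge0.
    - have mh' : measurable_fun setT (abse \o (fun z : measurableTypeR R * measurableTypeR R => (h z.1 z.2)%:E)).
        by apply: measurableT_comp => //; exact/measurable_EFinP.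
      exact: (measurable_fun_fubini_tonelli_F _ mh' (fun z => abse_ge0 _)).
    - apply/measurable_EFinP; apply: measurable_funM => //; exact: (L1_measurable ig1).
    - move=> x _.
      have -> : ((\int[mu]_y `|f0 y|) * `|g0 x|)%:E = (\int[mu]_y (`|g0 x| * `|f0 y|)%:E)%E.
        rewrite mulrC -RintegralZl// /Rintegral fineK//.
        by apply: (integrable_fin_num measurableT); exact: (L1Z _ _ if1).
      apply: ge0_le_integral; [exact: measurableT|by []| | |].
      + by apply/measurable_EFinP; apply: measurableT_comp => //; exact: L1_measurable (h1 x).
      + by apply/measurable_EFinP; apply: (L1_measurable (L1Z _ _ if1)).
      + by move=> y _; rewrite /= lee_fin mulrC.
  apply: integrable_lty => //; exact: (L1Z _ _ ig1).
have cF : {within `[a, b], continuous F}.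
  apply: (primitive_continuous_within ab' hf) => x hx.
  by rewrite (hF a) ?lexx ?ab'// set_itv1 Rintegral_set1 add0r; exact: hF.
have cG : {within `[a, b], continuous G} := primitive_continuous_within ab' hg hG.
have E := RFubini ih h1 h2.
clear ih h1 h2 hle if1 ig1 mh if0 ig0 mf0 mg0.
have E1 : \int[mu]_x \int[mu]_y h x y = \int[mu]_(x in `[a, b]) (F x * g x).
  clear E; rewrite [RHS]Rintegral_mkcond; apply: eq_Rintegral => x _; rewrite patchE.
  case: ifPn => [|xI].
    rewrite inE /= in_itv /= => hx; case/andP: (hx) => hx1 hx2.
    rewrite (hF x hx) mulrC [in RHS]Rintegral_mkcond -RintegralZl//; last first.
      apply: L1_restrict => //.
      by apply: integrableS hf => //; apply: subset_itvl; rewrite bnd_simp.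
    apply: eq_Rintegral => y _; rewrite /h /f0 /g0 !patchE.
    have -> : x \in `[a, b]%classic by rewrite inE /= in_itv /= hx.
    case: (leP y x) => yx; last first.
      by rewrite memNset ?mulr0//= in_itv /= (lt_geF yx) andbF.
    rewrite (_ : (y \in `[a, b]%classic) = (y \in `[a, x]%classic)); last first.
      apply/idP/idP; rewrite !inE /= !in_itv /= => /andP[-> _] /=; first exact: yx.
      exact: le_trans hx2.
    by case: ifP => _; rewrite ?mul0r ?mulr0 // mulrC.
  rewrite (_ : (fun y => h x y) = fun _ => 0) ?Rintegral_cst ?mul0r//.
  apply/funext => y; rewrite /h /g0 patchE (negbTE xI) mulr0.
  by case: ifP.
have E2 : \int[mu]_y \int[mu]_x h x y = \int[mu]_(y in `[a, b]) (f y * (G b - G y)).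
  clear E E1; rewrite [RHS]Rintegral_mkcond; apply: eq_Rintegral => y _; rewrite patchE.
  case: ifPn => [|yI].
    rewrite inE /= in_itv /= => hy; case/andP: (hy) => hy1 hy2.
    have igy : mu.-integrable `[y, b] (EFin \o g).
      by apply: integrableS hg => //; apply: subset_itvr; rewrite bnd_simp.
    have -> : G b - G y = \int[mu]_(x in `[y, b]) g x.
      rewrite (hG b) ?lexx ?ab'// (hG y hy).
      have igy' : mu.-integrable `]y, b] (EFin \o g).
        by apply: integrableS igy => //; apply: subset_itvr; rewrite bnd_simp.
      rewrite -(Rintegral_itv_obnd_cbnd igy').
      rewrite -(@Rintegral_itvB R g (BLeft a) (BRight b) y hg) ?bnd_simp//.
      by rewrite opprD addrACA subrr add0r.
    rewrite [in RHS]Rintegral_mkcond -RintegralZl//; last first.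
      exact: L1_restrict.
    apply: eq_Rintegral => x _; rewrite /h /f0 /g0 !patchE.
    have -> : y \in `[a, b]%classic by rewrite inE /= in_itv /= hy.
    case: (leP y x) => yx; last first.
      by rewrite memNset ?mulr0//= in_itv /= (lt_geF yx).
    rewrite (_ : (x \in `[a, b]%classic) = (x \in `[y, b]%classic)); last first.
      apply/idP/idP; rewrite !inE /= !in_itv /= => /andP[h3 ->]; rewrite andbT.
        exact: yx.
      exact: le_trans h3.
    by [].
  rewrite (_ : (fun x => h x y) = fun _ => 0) ?Rintegral_cst ?mul0r//.
  apply/funext => x; rewrite /h /f0 patchE (negbTE yI) mul0r.
  by case: ifP.
have iFg : L1 `[a, b] (fun x => F x * g x) := L1_continuous_mul ab' hg cF.
have ifG : L1 `[a, b] (fun x => G x * f x) := L1_continuous_mul ab' hf cG.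
have ifG' : L1 `[a, b] (fun x => f x * G x).
  by apply: (L1_eq mI _ ifG) => x _; rewrite mulrC.
have E3 : \int[mu]_(y in `[a, b]) (f y * (G b - G y)) =
    G b * F b - \int[mu]_(x in `[a, b]) (f x * G x).
  clear E E1 E2; have -> : G b * F b = \int[mu]_(x in `[a, b]) (G b * f x).
    by rewrite RintegralZl// -hF// ab' lexx.
  rewrite -RintegralB//; last exact: L1Z.
  by apply: eq_Rintegral => x _; rewrite mulrBr mulrC.
rewrite RintegralD// -E1 E E2 E3 addrC subrK mulrC; reflexivity.
Qed.

End Lebesgue_tools.

(** * Integrals on segments and half-lines *)

Section half_line_integrals.
Context {R : realType}.
Notation mu := (@lebesgue_measure R).
Implicit Types (f g F G : R -> R) (D : set (measurableTypeR R)) (a b x : R).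

Lemma L1_sub A D f : measurable (A : set (measurableTypeR R)) -> measurable D ->
  A `<=` D -> L1 D f -> L1 A f.
Proof. by move=> mA mD AD; exact: integrableS. Qed.

Lemma L1_segment a b f : L1 `[a, +oo[ f -> L1 `[a, b] f.
Proof. by apply: L1_sub => //; apply: subset_itvl; rewrite bnd_simp. Qed.

Lemma L1_obnd_cbnd a (c : itv_bound R) f :
  L1 [set` Interval (BRight a) c] f -> L1 [set` Interval (BLeft a) c] f.
Proof.
move=> hf.
have mf := measurable_int _ hf.
have mabs : measurable_fun [set` Interval (BRight a) c] (abse \o (EFin \o f)).
  exact: measurableT_comp.
move/integrableP: hf => [_ hf]; apply/integrableP; split.
  exact/emeasurable_fun_itv_obnd_cbndP.
by rewrite -(integral_itv_obnd_cbnd mabs).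
Qed.

Lemma Rintegral_subset A D f : measurable (A : set (measurableTypeR R)) -> measurable D ->
  A `<=` D -> L1 D f -> (forall x, D x -> 0 <= f x) ->
  \int[mu]_(x in A) f x <= \int[mu]_(x in D) f x.
Proof.
move=> mA mD AD hf f0.
have hA := L1_sub mA mD AD hf.
apply: fine_le; [exact: integrable_fin_num|exact: integrable_fin_num|].
apply: (@ge0_subset_integral _ _ _ mu A D mA mD (EFin \o f)) => //.
exact: measurable_int hf.
Qed.

Lemma Rintegral_segment_le a b f : L1 `[a, +oo[ f -> (forall x, a <= x -> 0 <= f x) ->
  \int[mu]_(x in `[a, b]) f x <= \int[mu]_(x in `[a, +oo[) f x.
Proof.
move=> hf f0; apply: Rintegral_subset => //.
- by apply: subset_itvl; rewrite bnd_simp.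
- by move=> x /=; rewrite in_itv /= andbT; exact: f0.
Qed.

Lemma continuous_on_segment a b f : (forall x, a <= x <= b -> {for x, continuous f}) ->
  {within `[a, b], continuous f}.
Proof.
move=> cf; apply: continuous_in_subspaceT => x; rewrite inE /= in_itv /= => hx.
exact: cf.
Qed.

Lemma L1_continuous a b f : (forall x, a <= x <= b -> {for x, continuous f}) -> L1 `[a, b] f.
Proof.
move=> cf; apply: continuous_compact_integrable; first exact: segment_compact.
exact: continuous_on_segment.
Qed.

Lemma der_primitive a b f F : a <= b -> (forall x, a <= x <= b -> der F x (f x)) ->
  (forall x, a <= x <= b -> {for x, continuous f}) ->
  F b = F a + \int[mu]_(x in `[a, b]) f x.
Proof.
move=> ab dF cf; move: (ab); rewrite le_eqVlt => /orP[/eqP <-|ab'].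
  by rewrite set_itv1 Rintegral_set1 addr0.
have cF x : a <= x <= b -> {for x, continuous F} by move=> /dF; exact: der_continuous.
have h : (\int[mu]_(x in `[a, b]) (f x)%:E = (F b)%:E - (F a)%:E)%E.
  apply: continuous_FTC2 => //; first exact: continuous_on_segment.
    split.
    - move=> x; rewrite in_itv /= => /andP[x1 x2].
      by apply: (der_derivable (dF x _)); rewrite (ltW x1) (ltW x2).
    - by apply: cvg_at_right_filter; apply: cF; rewrite lexx ab.
    - by apply: cvg_at_left_filter; apply: cF; rewrite lexx ab.
  move=> x; rewrite in_itv /= => /andP[x1 x2].
  by apply: der_derive1; apply: dF; rewrite (ltW x1) (ltW x2).
rewrite /Rintegral h -EFinB /=; ring.
Qed.

Lemma cvg_Rintegral_segment a f : L1 `[a, +oo[ f ->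
  (fun n : nat => \int[mu]_(x in `[a, a + n%:R]) f x) @ \oo --> \int[mu]_(x in `[a, +oo[) f x.
Proof.
move=> hf.
have mJ : measurable (`[a, +oo[%classic : set (measurableTypeR R)) by [].
have mI n : measurable (`[a, a + n%:R]%classic : set (measurableTypeR R)) by [].
have sub n : `[a, a + n%:R]%classic `<=` `[a, +oo[%classic.
  by apply: subset_itvl; rewrite bnd_simp.
have mf := measurable_int _ hf.
have mfn n : measurable_fun `[a, +oo[ (EFin \o (f \_ `[a, a + n%:R])).
  apply/measurable_EFinP; apply: (measurable_funS measurableT) => //.
  apply/(measurable_restrictT _ (mI n)); exact: (L1_measurable (@L1_segment a (a + n%:R) f hf)).
have e n : (\int[mu]_(x in `[a, (a + n%:R)%R]) (f x)%:E =
    \int[mu]_(x in `[a, +oo[) ((f \_ `[a, (a + n%:R)%R]) x)%:E)%E.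
  rewrite -{1}(setIidr (sub n)) integral_mkcondr.
  by apply: eq_integral => x _; rewrite /= !patchE; case: ifP.
have [||_ _ h] := dominated_convergence mJ mfn mf _ (integrable_abse hf) _.
- apply: aeW => x /=; rewrite in_itv /= andbT => ax.
  apply: cvg_near_cst; near=> n; rewrite /= patchE ifT// inE /= in_itv /= ax /=.
  rewrite -lerBlDl; near: n; exact: nbhs_infty_ger.
- apply: aeW => x n _ /=; rewrite patchE; case: ifP => _ //=.
  by rewrite normr0 lee_fin.
rewrite [X in _ --> X](_ : _ = fine (\int[mu]_(x in `[a, +oo[) (EFin \o f) x)%E)//.
rewrite (_ : (fun n : nat => _) = fine \o
  (fun n => \int[mu]_(x in `[a, +oo[) (EFin \o (f \_ `[a, (a + n%:R)%R])) x)%E).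
  apply: fine_cvg; rewrite fineK; first exact: h.
  exact: integrable_fin_num.
by apply/funext => n /=; rewrite /Rintegral e.
Unshelve. all: by end_near.
Qed.

Lemma L1_ipow2 (R0 : R) : L1 `[R0, +oo[ (ipow R0 2).
Proof.
have p0 x : R0 <= x -> 0 <= ipow R0 2 x by move=> hx; exact: (ltW (ipow_gt0 2 hx)).
have hd x : R0 <= x -> der (fun y => - ipow R0 1 y) x (ipow R0 2 x).
  move=> hx; apply: (der_eq (derN (der_ipow 1 _))); first by lra.
  by rewrite opprK mul1r.
have cf : {within `[R0, +oo[, continuous (ipow R0 2)}.
  apply: continuous_in_subspaceT => x; rewrite inE /= in_itv /= andbT => hx.
  by apply: der_continuous; apply: der_ipow; lra.
have lim0 : (fun y => - ipow R0 1 y) x @[x --> +oo%R] --> (0 : R).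
  rewrite -[X in _ --> X]oppr0; apply: cvgN; apply/cvgrPdist_le => e e0.
  near=> x; have hx : R0 + e^-1 <= x by near: x; apply: nbhs_pinfty_ge; exact: num_real.
  have ei : 0 < e^-1 by rewrite invr_gt0.
  have hx' : R0 <= x by lra.
  rewrite sub0r normrN (gtr0_norm (ipow_gt0 1 hx')) /ipow expr1 -[e]invrK.
  rewrite lef_pV2 ?posrE//; lra.
have dF : {in `]R0, +oo[, (fun y => - ipow R0 1 y)^`()%classic =1 ipow R0 2}.
  by move=> x; rewrite in_itv /= andbT => hx; apply: der_derive1; exact: hd (ltW hx).
have h := ge0_continuous_FTC2y p0 cf lim0 (fun x hx => der_derivable (hd x (ltW hx)))
  (cvg_at_right_filter (der_continuous (hd R0 (lexx R0)))) dF.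
apply/integrableP; split.
  apply/measurable_EFinP; exact: subspace_continuous_measurable_fun.
have -> : (\int[mu]_(x in `[R0, +oo[) `|(EFin \o ipow R0 2) x| =
    \int[mu]_(x in `[R0, +oo[) (ipow R0 2 x)%:E)%E.
  apply: eq_integral => x; rewrite inE /= in_itv /= andbT => hx.
  by rewrite ger0_norm// p0.
by rewrite h -EFinB ltry.
Unshelve. all: by end_near.
Qed.

Lemma Rintegral_ipow2_le (R0 b : R) : R0 <= b -> \int[mu]_(x in `[R0, b]) ipow R0 2 x <= 1.
Proof.
move=> hb.
have hd x : R0 <= x <= b -> der (fun y => - ipow R0 1 y) x (ipow R0 2 x).
  move=> /andP[hx _]; apply: (der_eq (derN (der_ipow 1 _))); first by lra.
  by rewrite opprK mul1r.
have cf x : R0 <= x <= b -> {for x, continuous (ipow R0 2)}.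
  by move=> /andP[hx _]; apply: der_continuous; apply: der_ipow; lra.
have h := der_primitive hb hd cf.
have e : ipow R0 1 R0 = 1 by rewrite /ipow subrr addr0 expr1n invr1.
have := ipow_gt0 1 hb; move: h; rewrite e; lra.
Qed.

(** Cauchy-Schwarz after bounding the weight from below. It underlies both the Hardy-type bounds
    along a ray and the Poincare inequality in the angle. *)
Lemma weighted_primitive_sq a b (rho f : R -> R) rho0 : a <= b -> 0 < rho0 ->
  (forall x, a <= x <= b -> rho0 <= rho x) ->
  L1 `[a, b] f -> L1 `[a, b] (fun x => rho x * f x ^+ 2) ->
  rho0 * (\int[mu]_(x in `[a, b]) f x) ^+ 2
    <= (b - a) * \int[mu]_(x in `[a, b]) (rho x * f x ^+ 2).
Proof.
move=> ab r0 hr hf hrf; have mI : measurable (`[a, b]%classic : set (measurableTypeR R)) by [].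
move: (ab); rewrite le_eqVlt => /orP[/eqP <-|ab'].
  by rewrite set_itv1 !Rintegral_set1 subrr mul0r expr0n mulr0.
have le x : `[a, b]%classic x -> rho0 * f x ^+ 2 <= rho x * f x ^+ 2.
  by rewrite /= in_itv /= => hx; apply: ler_wpM2r; [exact: sqr_ge0|exact: hr].
have hf2 : L1 `[a, b] (fun x => f x ^+ 2).
  apply: (@L1_le _ _ _ (fun x => rho0^-1 * (rho x * f x ^+ 2)) mI).
  - by apply: measurable_funX; exact: L1_measurable hf.
  - exact: L1Z.
  - move=> x hx; rewrite (ger0_norm (sqr_ge0 _)) mulrC ler_pdivlMr// mulrC; exact: le.
have h := cauchy_schwarz_interval ab' hf hf2.
apply: (@le_trans _ _ (rho0 * ((b - a) * \int[mu]_(x in `[a, b]) (f x ^+ 2)))).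
  by apply: ler_wpM2l => //; exact: ltW.
rewrite mulrCA; apply: ler_wpM2l; first by rewrite subr_ge0.
rewrite -RintegralZl//; apply: le_Rintegral => //; exact: (L1Z rho0 mI hf2).
Qed.

End half_line_integrals.

(** * The inequality on a ray *)

Section weight.
Context {R : realType}.
Variables (R0 delta eps : R).
Hypotheses (hR0 : 0 < R0) (hdelta : 0 <= delta <= 1) (heps : 0 < eps) (hs1 : Num.sqrt eps <= 1).
Local Notation s := (Num.sqrt eps).
Local Notation r := (r_of R0 eps).
Local Notation rho x := (r x `^ delta).
Implicit Types (x : R).

Lemma r_of_ge x : R0 <= x -> R0 <= r x.
Proof. by move=> hx; rewrite /r_of lerDl mulr_ge0 ?sqrtr_ge0// subr_ge0. Qed.

Lemma r_of_le x : R0 <= x -> r x <= x.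
Proof.
move=> hx; have : s * (x - R0) <= x - R0 by apply: ler_piMl => //; rewrite subr_ge0.
rewrite /r_of; lra.
Qed.

Lemma r_of_pos x : R0 <= x -> 0 < r x.
Proof. by move=> /r_of_ge; exact: lt_le_trans. Qed.

Lemma rpow_ge x : R0 <= x -> R0 `^ delta <= rho x.
Proof.
move=> hx; have /andP[d0 _] := hdelta.
by apply: ge0_ler_powR => //; [exact: ltW|exact: (ltW (r_of_pos hx))|exact: r_of_ge].
Qed.

(** Since [delta <= 1], the function [r^(delta - 1)] is nonincreasing. *)
Lemma rpow_le x : R0 <= x -> R0 * rho x <= R0 `^ delta * r x.
Proof.
move=> hx; have /andP[_ d1] := hdelta.
have rx := r_of_ge hx.
have q1 : 1 <= r x / R0 by rewrite ler_pdivlMr// mul1r.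
have -> : rho x = R0 `^ delta * (r x / R0) `^ delta.
  rewrite -powRM; [|exact: ltW|exact: (le_trans ler01)].
  by congr (_ `^ _); rewrite mulrC divfK// gt_eqF.
have := ler1_powR q1 d1; rewrite ler_pdivlMr// => h.
rewrite mulrCA; apply: ler_wpM2l; first exact: powR_ge0.
by rewrite mulrC.
Qed.

Lemma der_rpow x : R0 <= x -> der (fun y => rho y) x (delta * s * (rho x / r x)).
Proof.
move=> hx; have r0 := r_of_pos hx.
have h : der (fun y : R => y `^ delta) (r x) (delta * r x `^ (delta - 1)) := is_derive1_powR _ r0.
apply: (der_eq (der_comp h (der_r_of R0 eps x))).
rewrite powRB; last by rewrite (gt_eqF r0) implybT.
rewrite powRr1; last exact: ltW.
by move: (rho x / r x) => k; ring.
Qed.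

Local Notation m := (Num.max 1 R0^-1).

Lemma rpow_le_linear x : R0 <= x -> rho x <= R0 `^ delta * (m * (1 + (r x - R0))).
Proof.
move=> hx; have rx := r_of_ge hx.
have m1 : 1 <= m by rewrite le_max lexx.
have m2 : R0^-1 <= m by rewrite le_max lexx orbT.
have : rho x <= R0 `^ delta * (r x / R0).
  by rewrite mulrA ler_pdivlMr// mulrC; exact: rpow_le.
move=> /le_trans; apply; apply: ler_wpM2l; first exact: powR_ge0.
have -> : r x / R0 = 1 + R0^-1 * (r x - R0) by field; rewrite gt_eqF.
have z0 : 0 <= r x - R0 by rewrite subr_ge0.
rewrite [m * _]mulrDr mulr1; apply: lerD => //; exact: ler_wpM2r.
Qed.

Lemma ipow42 x : R0 <= x -> ipow R0 4 x * (1 + (x - R0)) ^+ 2 = ipow R0 2 x.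
Proof. by move=> hx; rewrite (ipowS 2 hx) (ipowS 3 hx) -mulrA -expr2. Qed.

End weight.

(** * Energy identity and Hardy-type estimate on one ray *)

Section profile_inequality.
Context {R : realType}.
Notation mu := (@lebesgue_measure R).
Variables (R0 delta eps c0 A C : R).
Hypotheses (hR0 : 0 < R0) (hdelta : 0 <= delta <= 1) (heps : 0 < eps) (hs1 : Num.sqrt eps <= 1).
Hypotheses (hc0 : 0 < c0) (hA : 0 <= A) (hC : 0 <= C).
Local Notation s := (Num.sqrt eps).
Local Notation r := (r_of R0 eps).
Local Notation rho x := (r x `^ delta).
Local Notation m := (Num.max 1 R0^-1).
Local Notation M := (Num.max 1 R0).
Local Notation ip := (ipow R0).

(** [u] is the profile at a fixed angle with its derivatives [u1] and [u2]; [q] stands for [r v],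
    the primitive of [p] that vanishes at [R0]. *)
Variables (u u1 u2 q p v : R -> R).
Hypothesis u_der : forall x, der u x (u1 x).
Hypothesis u1_der : forall x, der u1 x (u2 x).
Hypothesis u2_cont : continuous u2.
Hypothesis u_lower : forall x, R0 <= x -> c0 <= u x.
Hypothesis u1_upper : forall x, R0 <= x -> `|u1 x| <= A * (s * ip 4 (r x) + ip 4 x).
Hypothesis u2_upper : forall x, R0 <= x -> `|u2 x| <= C * ip 4 x.
Hypothesis p_int : forall b, R0 <= b -> L1 `[R0, b] p.
Hypothesis q_prim : forall x, R0 <= x -> q x = \int[mu]_(y in `[R0, x]) p y.
Hypothesis q_v : forall x, R0 <= x -> q x = r x * v x.
Hypothesis D_int : L1 `[R0, +oo[ (fun x => rho x * p x ^+ 2).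
Hypothesis E_int : L1 `[R0, +oo[ (fun x => eps * v x ^+ 2 * rho x).

Local Notation D := (\int[mu]_(x in `[R0, +oo[) (rho x * p x ^+ 2)).
Local Notation E := (\int[mu]_(x in `[R0, +oo[) (eps * v x ^+ 2 * rho x)).

Let rho0 : 0 < R0 `^ delta. Proof. exact: powR_gt0. Qed.
Let m0 : 0 < m. Proof. by rewrite lt_max ltr01. Qed.
Let M0 : 0 < M. Proof. by rewrite lt_max ltr01. Qed.
Let s_ge0 : 0 <= s. Proof. exact: sqrtr_ge0. Qed.

Let p2_ge0 x : R0 <= x -> 0 <= rho x * p x ^+ 2.
Proof. by move=> hx; apply: mulr_ge0; [exact: powR_ge0|exact: sqr_ge0]. Qed.

Let v2_ge0 x : R0 <= x -> 0 <= eps * v x ^+ 2 * rho x.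
Proof.
move=> _; apply: mulr_ge0; last exact: powR_ge0.
by apply: mulr_ge0; [exact: ltW|exact: sqr_ge0].
Qed.

Lemma dissipation_ge0 : 0 <= D.
Proof. by apply: Rintegral_ge0 => x /=; rewrite in_itv /= andbT; exact: p2_ge0. Qed.

Let D0 := dissipation_ge0.

Lemma primitive_bound x : R0 <= x -> R0 `^ delta * q x ^+ 2 <= (x - R0) * D.
Proof.
move=> hx; rewrite q_prim//.
have hw y : R0 <= y <= x -> R0 `^ delta <= rho y by move=> /andP[hy _]; exact: rpow_ge.
apply: (le_trans (weighted_primitive_sq hx rho0 hw (p_int hx) (L1_segment x D_int))).
by apply: ler_wpM2l; [rewrite subr_ge0|exact: Rintegral_segment_le].
Qed.

Lemma weighted_primitive_bound x : R0 <= x ->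
  rho x * q x ^+ 2 <= m * D * ((1 + (r x - R0)) * (x - R0)).
Proof.
move=> hx; have rx := r_of_ge eps hx.
apply: (@le_trans _ _ ((m * (1 + (r x - R0))) * (R0 `^ delta * q x ^+ 2))).
  rewrite (mulrC (m * _)) mulrAC; apply: ler_wpM2r; first exact: sqr_ge0.
  exact: rpow_le_linear.
have h : 0 <= m * (1 + (r x - R0)) by apply: mulr_ge0; [exact: ltW|lra].
apply: (le_trans (ler_wpM2l h (primitive_bound hx))).
by rewrite le_eqVlt; apply/orP; left; apply/eqP; move: D (m); intros; ring.
Qed.

Let ur x : R0 <= x -> 0 < u x. Proof. by move=> /u_lower; exact: lt_le_trans. Qed.

(** By [weighted_primitive_bound] the weighted square of [q] grows at most quadratically, while [u2]
    decays to fourth order. The bound serves the integrability of the potential, so [C] does not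
    reach the final constant. *)
Lemma potential_bound x : R0 <= x ->
  `|rho x * (q x / u x) ^+ 2 * (u x * u2 x)| <= C * m / c0 * D * ip 2 x.
Proof.
move=> hx; have rx := r_of_ge eps hx; have rx' := r_of_le hs1 hx; have u0 := ur hx.
have -> : rho x * (q x / u x) ^+ 2 * (u x * u2 x) = (rho x * q x ^+ 2) * (u2 x / u x).
  have id (a b c d : R) : c != 0 -> a * (b / c) ^+ 2 * (c * d) = a * b ^+ 2 * (d / c).
    by move=> ?; field.
  by apply: id; rewrite gt_eqF.
have ip0 := ipow_gt0 4 hx.
have z0 : 0 <= x - R0 by rewrite subr_ge0.
have rq0 : 0 <= rho x * q x ^+ 2 by rewrite mulr_ge0 ?powR_ge0 ?sqr_ge0.
have h1 : `|u2 x / u x| <= C * ip 4 x / c0.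
  rewrite normrM normfV (gtr0_norm u0); apply: ler_pM => //.
  - by rewrite invr_ge0 ltW.
  - exact: u2_upper.
  - by rewrite lef_pV2 ?posrE//; exact: u_lower.
rewrite normrM (ger0_norm rq0).
apply: (@le_trans _ _ (m * D * (1 + (x - R0)) ^+ 2 * (C * ip 4 x / c0))).
  apply: ler_pM => //; apply: (le_trans (weighted_primitive_bound hx)).
  have mD : 0 <= m * D by rewrite mulr_ge0// ltW.
  apply: ler_wpM2l => //.
  by rewrite expr2; apply: ler_pM => //; lra.
rewrite -(ipow42 hx) le_eqVlt; apply/orP; left; apply/eqP; move: D (m); intros; field.
by rewrite gt_eqF.
Qed.

Let kappa x := u1 x / u x.

Lemma log_derivative_bound x : R0 <= x -> `|kappa x| <= A / c0 * (s * ip 4 (r x) + ip 4 x).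
Proof.
move=> hx; have u0 := ur hx.
rewrite normrM normfV (gtr0_norm u0) mulrAC.
apply: ler_pM => //; [by rewrite invr_ge0 ltW|exact: u1_upper|].
by rewrite lef_pV2 ?posrE//; exact: u_lower.
Qed.

(** Makes the boundary term of the integration by parts vanish at infinity. In the part of [kappa]
    that decays in [r], the factor [s] turns [x - R0] into [r - R0], which that decay absorbs. *)
Lemma boundary_bound x : R0 <= x ->
  `|rho x * kappa x * q x ^+ 2| <= A * m / c0 * D * (ip 2 (r x) + ip 2 x).
Proof.
move=> hx; have rx := r_of_ge eps hx; have rx' := r_of_le hs1 hx.
rewrite mulrAC normrM (ger0_norm (_ : 0 <= rho x * q x ^+ 2)); last first.
  by rewrite mulr_ge0 ?powR_ge0 ?sqr_ge0.
have i1 := ipow_gt0 4 hx; have i2 := ipow_gt0 4 rx.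
have z0 : 0 <= x - R0 by rewrite subr_ge0.
have w0 : 0 <= r x - R0 by rewrite subr_ge0.
have mD : 0 <= m * D by rewrite mulr_ge0// ltW.
apply: (@le_trans _ _ (m * D * ((1 + (r x - R0)) * (x - R0)) *
    (A / c0 * (s * ip 4 (r x) + ip 4 x)))).
  apply: ler_pM => //; first by rewrite mulr_ge0 ?powR_ge0 ?sqr_ge0.
    exact: weighted_primitive_bound.
  exact: log_derivative_bound.
have -> : m * D * ((1 + (r x - R0)) * (x - R0)) * (A / c0 * (s * ip 4 (r x) + ip 4 x)) =
   A * m / c0 * D * (((1 + (r x - R0)) * (s * (x - R0))) * ip 4 (r x) +
     ((1 + (r x - R0)) * (x - R0)) * ip 4 x).
  move: D (m) (ip 4 (r x)) (ip 4 x) (r x - R0); intros; field; by rewrite gt_eqF.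
apply: ler_wpM2l.
  by apply: mulr_ge0 => //; apply: divr_ge0 => //; [apply: mulr_ge0 => //|]; exact: ltW.
have -> : s * (x - R0) = r x - R0 by rewrite /r_of; ring.
rewrite -(ipow42 hx) -(ipow42 rx) ![_ * ip 4 _]mulrC !expr2.
apply: lerD; apply: ler_wpM2l; try exact: ltW.
  by apply: ler_wpM2l; lra.
by apply: ler_pM => //; lra.
Qed.

Let K4 := A * M / c0.
Let K6 := A / (c0 * R0).

(** In the part of [kappa] that decays in [r], two factors [s] make [eps], [q] is [r v], and the
    spare factor [r] is absorbed by the decay; this gives [K4]. In the part that decays in [x],
    [primitive_bound] leaves an integrable function, and the factor [s] from the derivative of the
    weight remains; this gives [K6]. *)
Lemma weight_term_bound x : R0 <= x ->
  `|delta * s * (rho x / r x) * kappa x * q x ^+ 2|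
    <= K4 * (eps * v x ^+ 2 * rho x) + K6 * s * D * ip 2 x.
Proof.
move=> hx; have rx := r_of_ge eps hx; have rx' := r_of_le hs1 hx.
have r0 := r_of_pos eps hR0 hx.
have i1 := ipow_gt0 4 hx; have i2 := ipow_gt0 4 rx.
have [d0 d1] := andP hdelta.
have rr : 0 <= rho x / r x by rewrite divr_ge0 ?powR_ge0// ltW.
have w0 : 0 <= r x - R0 by rewrite subr_ge0.
have z0 : 0 <= x - R0 by rewrite subr_ge0.
apply: (@le_trans _ _ (s * (rho x / r x) * q x ^+ 2 * (A / c0 * (s * ip 4 (r x) + ip 4 x)))).
  rewrite [X in `|X|](_ : _ = delta * (s * (rho x / r x) * q x ^+ 2 * kappa x)); last first.
    by move: (kappa x) (rho x / r x); intros; ring.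
  rewrite normrM (ger0_norm d0).
  apply: (@le_trans _ _ (1 * `|s * (rho x / r x) * q x ^+ 2 * kappa x|)).
    exact: ler_wpM2r.
  have nn : 0 <= s * (rho x / r x) * q x ^+ 2.
    by apply: mulr_ge0; [exact: mulr_ge0|exact: sqr_ge0].
  by rewrite mul1r normrM (ger0_norm nn); apply: ler_wpM2l => //; exact: log_derivative_bound.
have -> : s * (rho x / r x) * q x ^+ 2 * (A / c0 * (s * ip 4 (r x) + ip 4 x)) =
  A / c0 * (r x * ip 4 (r x)) * (eps * v x ^+ 2 * rho x)
  + A / c0 * s * ip 4 x * (rho x / r x * q x ^+ 2).
  rewrite (q_v hx); have := sqr_sqrtr (ltW heps).
  move: (ip 4 (r x)) (ip 4 x) (rho x) (v x) (r x) (Num.sqrt eps) r0 => a b c d e f e0 <-; field.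
  by rewrite !gt_eqF.
apply: lerD.
  apply: ler_wpM2r; first exact: v2_ge0.
  rewrite /K4 [A * M / c0]mulrAC; apply: ler_wpM2l; first by rewrite divr_ge0// ltW.
  apply: (@le_trans _ _ (M * ((1 + (r x - R0)) * ip 4 (r x)))).
    rewrite mulrA; apply: ler_wpM2r; first exact: ltW.
    have M1 : 1 <= M by rewrite le_max lexx.
    have MR : R0 <= M by rewrite le_max lexx orbT.
    rewrite -[X in X <= _](subrKC R0) mulrDr mulr1; apply: lerD => //.
    exact: ler_peMl.
  apply: ler_piMr; first exact: ltW.
  by rewrite mulrC -ipowS// ipow_le1.
have h : rho x / r x * q x ^+ 2 <= R0^-1 * ((x - R0) * D).
  apply: (@le_trans _ _ (R0^-1 * (R0 `^ delta * q x ^+ 2))).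
    rewrite [R0^-1 * _]mulrA; apply: ler_wpM2r; first exact: sqr_ge0.
    rewrite ler_pdivrMr// -mulrA -ler_pdivrMl ?invr_gt0// invrK.
    exact: rpow_le.
  by apply: ler_wpM2l; [rewrite invr_ge0 ltW|exact: primitive_bound].
have k0 : 0 <= A / c0 * s * ip 4 x.
  apply: mulr_ge0; last exact: ltW.
  by apply: mulr_ge0 => //; apply: divr_ge0 => //; exact: ltW.
apply: (le_trans (ler_wpM2l k0 h)).
have -> : A / c0 * s * ip 4 x * (R0^-1 * ((x - R0) * D)) = K6 * s * D * (ip 4 x * (x - R0)).
  by rewrite /K6; move: D (ip 4 x); intros; field; rewrite !gt_eqF.
apply: ler_wpM2l.
  do 2 (apply: mulr_ge0 => //).
  by apply: divr_ge0 => //; apply: mulr_ge0; exact: ltW.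
rewrite -(ipow42 hx); apply: ler_wpM2l; first exact: ltW.
have : 0 <= (x - R0) ^+ 2 by exact: sqr_ge0.
by move: (x - R0) z0 => y y0 y2; rewrite sqrrD expr1n mul1r mulr2n; lra.
Qed.

Let rho_cont x : R0 <= x -> {for x, continuous (fun y => rho y)}.
Proof. by move=> hx; apply: der_continuous; exact: der_rpow. Qed.

Let u_cont x : {for x, continuous u}. Proof. exact: der_continuous (u_der x). Qed.

Let uV_cont x : R0 <= x -> {for x, continuous (fun y => (u y)^-1)}.
Proof. by move=> hx; apply: cvgV; [rewrite gt_eqF// ur|exact: u_cont]. Qed.

Let kappa_der x : R0 <= x -> der kappa x (u2 x / u x - kappa x ^+ 2).
Proof.
move=> hx; have u0 : u x != 0 by rewrite gt_eqF// ur.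
apply: (der_eq (der_div (u1_der x) (u_der x) u0)).
by rewrite /kappa; move: (u x) (u1 x) (u2 x) u0 => a b c a0; field.
Qed.

Let kappa_cont x : R0 <= x -> {for x, continuous kappa}.
Proof. by move=> hx; exact: der_continuous (kappa_der hx). Qed.

(** The derivative of the weight [rho]. *)
Let slope x := delta * s * (rho x / r x).

Let slope_cont x : R0 <= x -> {for x, continuous slope}.
Proof.
move=> hx; apply: cvgM; first exact: cvg_cst.
apply: cvgM; first exact: rho_cont.
apply: cvgV; first by rewrite gt_eqF// r_of_pos.
exact: der_continuous (der_r_of R0 eps x).
Qed.

Local Notation pot x := (rho x * (q x / u x) ^+ 2 * (u x * u2 x)).
Local Notation wt x := (slope x * kappa x * q x ^+ 2).
Local Notation sq x := (rho x * (p x - kappa x * q x) ^+ 2).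
Local Notation ker x := (s * ip 2 (r x) + ip 2 x).

Section truncated.
Variable b : R.
Hypothesis hb : R0 < b.
Let hb' := ltW hb.

Let mI : measurable (`[R0, b]%classic : set (measurableTypeR R)). Proof. by []. Qed.

Let inI x : `[R0, b]%classic x -> R0 <= x.
Proof. by rewrite /= in_itv /= => /andP[]. Qed.

Let cont_I (f : R -> R) : (forall x, R0 <= x -> {for x, continuous f}) ->
  {within `[R0, b], continuous f}.
Proof. by move=> hf; apply: continuous_on_segment => x /andP[hx _]; exact: hf. Qed.

Let q0 : q R0 = 0. Proof. by rewrite q_prim// set_itv1 Rintegral_set1. Qed.

Let q_prim' x : R0 <= x <= b -> q x = q R0 + \int[mu]_(y in `[R0, x]) p y.
Proof. by move=> /andP[hx _]; rewrite q0 add0r; exact: q_prim. Qed.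

Let q_within : {within `[R0, b], continuous q}.
Proof. by apply: (primitive_continuous_within hb' (p_int hb')) => x hx; exact: q_prim'. Qed.

Let pq_int : L1 `[R0, b] (fun x => q x * p x).
Proof. exact: L1_continuous_mul hb' (p_int hb') q_within. Qed.

Let q2_int : L1 `[R0, b] (fun x => q x ^+ 2).
Proof.
have hq : L1 `[R0, b] q by apply: continuous_compact_integrable => //; exact: segment_compact.
exact: L1_continuous_mul hb' hq q_within.
Qed.

Let q2_prim x : R0 <= x <= b -> q x ^+ 2 = \int[mu]_(y in `[R0, x]) (2 * (q y * p y)).
Proof.
move=> /andP[hx hxb]; move: (hx); rewrite le_eqVlt => /orP[/eqP <-|hx'].
  by rewrite q0 set_itv1 Rintegral_set1 expr0n.
rewrite expr2 -(integration_by_parts_ac hx' (p_int hx) (p_int hx) (F := q) (G := q)).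
- by apply: eq_Rintegral => y _; move: (p y) (q y) => c d; ring.
- by move=> y /andP[hy _]; exact: q_prim.
- by move=> y /andP[hy hyx]; apply: q_prim'; rewrite hy /=; exact: le_trans hxb.
Qed.

Let pot_int : L1 `[R0, b] (fun x => pot x).
Proof.
have cF : {within `[R0, b], continuous (fun x => rho x * (u2 x * (u x)^-1))}.
  apply: cont_I => x hx; apply: cvgM; first exact: rho_cont.
  by apply: cvgM; [exact: u2_cont|exact: uV_cont].
apply: (L1_eq mI _ (L1_continuous_mul hb' q2_int cF)) => x /inI hx.
have := ur hx; move: (u x) (rho x) (q x) (u2 x) => d e f g d0; field.
by rewrite gt_eqF.
Qed.

Let wt_int : L1 `[R0, b] (fun x => wt x).
Proof.
apply: (L1_continuous_mul hb' q2_int (F := fun x => slope x * kappa x)).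
by apply: cont_I => x hx; apply: cvgM; [exact: slope_cont|exact: kappa_cont].
Qed.

(** The derivative of [rho * kappa]. *)
Let Gd x := slope x * kappa x + rho x * (u2 x / u x - kappa x ^+ 2).

Let Gd_cont x : R0 <= x -> {for x, continuous Gd}.
Proof.
move=> hx; apply: cvgD; first by apply: cvgM; [exact: slope_cont|exact: kappa_cont].
apply: cvgM; first exact: rho_cont.
apply: cvgB; first by apply: cvgM; [exact: u2_cont|exact: uV_cont].
by apply: cvgM; exact: kappa_cont.
Qed.

Let cross_int : L1 `[R0, b]
  (fun x => 2 * (q x * p x) * (rho x * kappa x) + q x ^+ 2 * Gd x).
Proof.
have c1 : {within `[R0, b], continuous (fun x => rho x * kappa x)}.
  by apply: cont_I => x hx; apply: cvgM; [exact: rho_cont|exact: kappa_cont].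
have i1 := L1_continuous_mul hb' (L1Z 2 mI pq_int) c1.
have i2 := L1_continuous_mul hb' q2_int (cont_I Gd_cont).
apply: (L1_eq mI _ (L1D mI i1 i2)) => x _.
by rewrite [X in X + _]mulrC [X in _ + X]mulrC.
Qed.

Lemma cross_term :
  \int[mu]_(x in `[R0, b]) (2 * (q x * p x) * (rho x * kappa x) + q x ^+ 2 * Gd x)
  = q b ^+ 2 * (rho b * kappa b).
Proof.
apply: (@integration_by_parts_ac _ R0 b (fun x => 2 * (q x * p x)) Gd
  (fun x => q x ^+ 2) (fun x => rho x * kappa x) hb).
- exact: L1Z.
- by apply: L1_continuous => x /andP[hx _]; exact: Gd_cont.
- exact: q2_prim.
- move=> x /andP[hx _]; apply: (der_primitive (F := fun x => rho x * kappa x) hx) => y /andP[hy _].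
    apply: (der_eq (derM (der_rpow delta eps hR0 hy) (kappa_der hy))).
    by rewrite /Gd /slope addrC.
  exact: Gd_cont.
Qed.

(** The energy identity before integration: the subtracted bracket is the derivative of the product
    of [q ^+ 2] and [rho * kappa]. *)
Let sq_eq x : R0 <= x -> rho x * p x ^+ 2 + pot x + wt x
  + -1 * (2 * (q x * p x) * (rho x * kappa x) + q x ^+ 2 * Gd x) = sq x.
Proof.
move=> hx; have := ur hx; rewrite /Gd.
move: (slope x) (kappa x) (rho x) (u x) (u2 x) (q x) (p x) => a d e f g h i f0; field.
by rewrite gt_eqF.
Qed.

Let D_int_b : L1 `[R0, b] (fun x => rho x * p x ^+ 2). Proof. exact: L1_segment. Qed.

Let sq_int : L1 `[R0, b] (fun x => sq x).
Proof.
apply: (L1_eq mI (fun x hx => sq_eq (inI hx))).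
apply: (L1D mI); last exact: (L1Z (-1) mI).
by apply: (L1D mI) => //; exact: (L1D mI).
Qed.

Lemma energy_identity : \int[mu]_(x in `[R0, b]) sq x =
  \int[mu]_(x in `[R0, b]) (rho x * p x ^+ 2) + \int[mu]_(x in `[R0, b]) pot x
  + \int[mu]_(x in `[R0, b]) wt x - rho b * kappa b * q b ^+ 2.
Proof.
rewrite -(RintegralD mI D_int_b pot_int).
have i1 : L1 `[R0, b] (fun x => rho x * p x ^+ 2 + pot x) by exact: (L1D mI).
rewrite -(RintegralD mI i1 wt_int).
have i2 : L1 `[R0, b] (fun x => rho x * p x ^+ 2 + pot x + wt x) by exact: (L1D mI).
rewrite (_ : - _ = -1 * (q b ^+ 2 * (rho b * kappa b))); last first.
  by move: (kappa b) => k; ring.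
rewrite -cross_term -(Rintegral_linear (-1) mI i2 cross_int).
by apply: eq_Rintegral => x; rewrite inE => /inI hx; rewrite -sq_eq.
Qed.

Local Notation H := (\int[mu]_(x in `[R0, b]) sq x).

Let sq_ge0 x : 0 <= sq x.
Proof. by apply: mulr_ge0; [exact: powR_ge0|exact: sqr_ge0]. Qed.

Let H0 : 0 <= H. Proof. by apply: Rintegral_ge0 => x _; exact: sq_ge0. Qed.

(** The analogue of [primitive_bound] for [q / u]. The weight is now [rho * u ^+ 2], still bounded
    below, and the right-hand side contains the integral [H] of the square instead of [D], which is
    what lets the square control the dissipation. *)
Lemma quotient_bound x : R0 <= x <= b ->
  R0 `^ delta * c0 ^+ 2 * (q x / u x) ^+ 2 <= (x - R0) * H.
Proof.
move=> /andP[hx hxb].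
have mx : measurable (`[R0, x]%classic : set (measurableTypeR R)) by [].
have inx y : `[R0, x]%classic y -> R0 <= y by rewrite /= in_itv /= => /andP[].
have sub : `[R0, x]%classic `<=` `[R0, b]%classic by apply: subset_itvl; rewrite bnd_simp.
have cV : {within `[R0, x], continuous (fun y => (u y)^-1)}.
  by apply: continuous_on_segment => y /andP[hy _]; exact: uV_cont.
have cK : {within `[R0, x], continuous (fun y => - (u1 y / u y ^+ 2))}.
  apply: continuous_on_segment => y /andP[hy _]; apply: cvgN; apply: cvgM.
    exact: der_continuous (u1_der y).
  apply: cvgV; first by rewrite expf_neq0// gt_eqF// ur.
  by apply: cvgM; exact: u_cont.
have iK : L1 `[R0, x] (fun y => - (u1 y / u y ^+ 2)).
  by apply: continuous_compact_integrable => //; exact: segment_compact.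
have qx : L1 `[R0, x] q by apply: (L1_sub mx mI sub); apply: continuous_compact_integrable => //; exact: segment_compact.
have e : q x / u x = \int[mu]_(y in `[R0, x]) ((p y - kappa y * q y) / u y).
  move: (hx); rewrite le_eqVlt => /orP[/eqP <-|hx'].
    by rewrite q0 mul0r set_itv1 Rintegral_set1.
  rewrite -(integration_by_parts_ac hx' (p_int hx) iK (F := q) (G := fun y => (u y)^-1)).
  - apply: eq_Rintegral => y; rewrite inE => /inx hy; rewrite /kappa.
    have := ur hy; move: (u y) (p y) (q y) (u1 y) => d f g h d0; field.
    by rewrite gt_eqF.
  - by move=> y /andP[hy _]; exact: q_prim.
  - move=> y /andP[hy hyx]; apply: (der_primitive (F := fun y => (u y)^-1) hy) => t /andP[ht hty].
      have ut : u t != 0 by rewrite gt_eqF// ur.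
      by apply: (der_eq (derV (u_der t) ut)); rewrite mulNr.
    apply: cvgN; apply: cvgM; first exact: der_continuous (u1_der t).
    apply: cvgV; first by rewrite expf_neq0// gt_eqF// ur.
    by apply: cvgM; exact: u_cont.
have es y : `[R0, x]%classic y -> sq y = (rho y * u y ^+ 2) * ((p y - kappa y * q y) / u y) ^+ 2.
  move=> /inx hy; have := ur hy; move: (u y) (rho y) (kappa y) (p y) (q y) => d f g h i d0; field.
  by rewrite gt_eqF.
have i1 : L1 `[R0, x] (fun y => (p y - kappa y * q y) / u y).
  have ck : {within `[R0, x], continuous (fun y => -1 * kappa y)}.
    apply: continuous_on_segment => y /andP[hy _].
    by apply: cvgM; [exact: cvg_cst|exact: kappa_cont].
  have h := L1D mx (p_int hx) (L1_continuous_mul hx qx ck).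
  apply: (L1_eq mx _ (L1_continuous_mul hx h cV)) => y _.
  by rewrite mulrC mulN1r mulNr.
have i2 : L1 `[R0, x] (fun y => (rho y * u y ^+ 2) * ((p y - kappa y * q y) / u y) ^+ 2).
  by apply: (L1_eq mx es); exact: (L1_sub mx mI sub sq_int).
have w0 : 0 < R0 `^ delta * c0 ^+ 2 by rewrite mulr_gt0// exprn_gt0.
have hw y : R0 <= y <= x -> R0 `^ delta * c0 ^+ 2 <= rho y * u y ^+ 2.
  move=> /andP[hy _]; apply: ler_pM.
  - exact: powR_ge0.
  - exact: sqr_ge0.
  - exact: rpow_ge.
  - by apply: lerXn2r; rewrite ?nnegrE ?(ltW hc0) ?(ltW (ur hy)) ?u_lower.
rewrite e; apply: (le_trans (weighted_primitive_sq hx w0 hw i1 i2)).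
apply: ler_wpM2l; first by rewrite subr_ge0.
have <- : \int[mu]_(y in `[R0, x]) sq y =
    \int[mu]_(y in `[R0, x]) (rho y * u y ^+ 2 * ((p y - kappa y * q y) / u y) ^+ 2).
  by apply: eq_Rintegral => y; rewrite inE => hy; exact: es.
exact: (Rintegral_subset mx mI sub sq_int).
Qed.

(** The square of a sum gives [2 * A ^+ 2], the growth of the weight gives [m], and the lower bound
    of [u] in [quotient_bound] gives the denominator. *)
Let K1 := 2 * A ^+ 2 * m / c0 ^+ 2.

(** Of the two factors [s] in the squared slow part of [u1], one turns [x - R0] into [r - R0] and
    the other stays in [ker], whose integral is therefore bounded uniformly in [eps]. *)
Lemma log_derivative_term x : R0 <= x <= b ->
  rho x * (kappa x * q x) ^+ 2 <= K1 * H * ker x.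
Proof.
move=> hxb; have /andP[hx _] := hxb.
have rx := r_of_ge eps hx; have rx' := r_of_le hs1 hx; have u0 := ur hx.
have i1 := ipow_gt0 4 hx; have i2 := ipow_gt0 4 rx.
have j1 := ipow_le1 4 hx; have j2 := ipow_le1 4 rx.
have z0 : 0 <= x - R0 by rewrite subr_ge0.
have w0 : 0 <= r x - R0 by rewrite subr_ge0.
have -> : rho x * (kappa x * q x) ^+ 2 = rho x * u1 x ^+ 2 * (q x / u x) ^+ 2.
  by rewrite /kappa; move: (u x) (u1 x) (q x) (rho x) u0 => d f g h d0; field; rewrite gt_eqF.
have hu1 : u1 x ^+ 2 <= 2 * A ^+ 2 * (s ^+ 2 * ip 4 (r x) ^+ 2 + ip 4 x ^+ 2).
  rewrite -(real_normK (num_real _)).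
  apply: (@le_trans _ _ ((A * (s * ip 4 (r x) + ip 4 x)) ^+ 2)).
    apply: lerXn2r; rewrite ?nnegrE//; last exact: u1_upper.
    by apply: mulr_ge0 => //; apply: addr_ge0; [apply: mulr_ge0 => //|]; exact: ltW.
  have : 0 <= A ^+ 2 * (s * ip 4 (r x) - ip 4 x) ^+ 2 by rewrite mulr_ge0 ?sqr_ge0.
  move: (ip 4 (r x)) (ip 4 x) (Num.sqrt eps) => d f g h; rewrite -subr_ge0.
  by rewrite (_ : _ - _ = A ^+ 2 * (g * d - f) ^+ 2)//; ring.
have hq := quotient_bound hxb.
set Q := (q x / u x) ^+ 2 in hq *; have Q0 : 0 <= Q by exact: sqr_ge0.
have c2 : 0 < c0 ^+ 2 by rewrite exprn_gt0.
apply: (@le_trans _ _ (R0 `^ delta * (m * (1 + (r x - R0))) *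
    (2 * A ^+ 2 * (s ^+ 2 * ip 4 (r x) ^+ 2 + ip 4 x ^+ 2)) * Q)).
  apply: ler_wpM2r => //; apply: ler_pM => //; [exact: powR_ge0|exact: sqr_ge0|].
  exact: rpow_le_linear.
set B := s ^+ 2 * ip 4 (r x) ^+ 2 + ip 4 x ^+ 2.
have B0 : 0 <= B.
  by apply: addr_ge0; [apply: mulr_ge0|]; exact: sqr_ge0.
apply: (@le_trans _ _ (2 * A ^+ 2 * m / c0 ^+ 2 * (1 + (r x - R0)) * B * ((x - R0) * H))).
  have k0 : 0 <= 2 * A ^+ 2 * m / c0 ^+ 2 * (1 + (r x - R0)) * B.
    apply: mulr_ge0 => //; apply: mulr_ge0; last by lra.
    by apply: divr_ge0; [apply: mulr_ge0; [rewrite mulr_ge0 ?sqr_ge0|exact: ltW]|exact: ltW].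
  apply: le_trans (ler_wpM2l k0 hq).
  rewrite le_eqVlt; apply/orP; left; apply/eqP.
  clear hq k0 B0 Q0; clearbody B Q.
  by move: H (m) (R0 `^ delta) (r x - R0) => h1 h2 h3 h4; field; rewrite gt_eqF.
have -> : 2 * A ^+ 2 * m / c0 ^+ 2 * (1 + (r x - R0)) * B * ((x - R0) * H) =
    K1 * H * ((1 + (r x - R0)) * (x - R0) * B).
  by rewrite /K1; clear B0; clearbody B; move: H B (m) (r x - R0) => h1 h2 h3 h4; ring.
apply: ler_wpM2l.
  apply: mulr_ge0 => //.
  by apply: divr_ge0; [apply: mulr_ge0; [rewrite mulr_ge0 ?sqr_ge0|exact: ltW]|exact: ltW].
have -> : (1 + (r x - R0)) * (x - R0) * B =
   s * ((1 + (r x - R0)) * (s * (x - R0)) * ip 4 (r x) * ip 4 (r x)) +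
   (1 + (r x - R0)) * (x - R0) * ip 4 x * ip 4 x.
  by rewrite /B; move: (ip 4 (r x)) (ip 4 x) (r x - R0) (Num.sqrt eps); intros; ring.
have -> : s * (x - R0) = r x - R0 by rewrite /r_of; ring.
rewrite -(ipow42 hx) -(ipow42 rx); apply: lerD.
  apply: ler_wpM2l => //; apply: (@le_trans _ _ ((1 + (r x - R0)) * (r x - R0) * ip 4 (r x))).
    by apply: ler_piMr => //; rewrite !mulr_ge0 ?(ltW i2)//; lra.
  rewrite mulrC; apply: ler_wpM2l; first exact: ltW.
  by rewrite expr2; apply: ler_wpM2l; lra.
apply: (@le_trans _ _ ((1 + (r x - R0)) * (x - R0) * ip 4 x)).
  by apply: ler_piMr => //; rewrite !mulr_ge0 ?(ltW i1)//; lra.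
rewrite mulrC; apply: ler_wpM2l; first exact: ltW.
by rewrite expr2; apply: ler_pM => //; lra.
Qed.

Let ker_cont x : R0 <= x -> {for x, continuous (fun y => ker y)}.
Proof.
move=> hx; have rx := r_of_ge eps hx; apply: cvgD.
  apply: cvgM; first exact: cvg_cst.
  apply: (@continuous_comp _ _ _ r (ip 2)).
    exact: der_continuous (der_r_of R0 eps x).
  by apply: der_continuous; apply: der_ipow; lra.
by apply: der_continuous; apply: der_ipow; lra.
Qed.

(** By the substitution [dr = s dx] each of the two terms contributes at most one. *)
Lemma kernel_integral : \int[mu]_(x in `[R0, b]) ker x <= 2.
Proof.
have hd x : R0 <= x <= b -> der (fun y => - ip 1 (r y) - ip 1 y) x (ker x).
  move=> /andP[hx _]; have rx := r_of_ge eps hx.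
  have x1 : R0 - 1 < x by lra.
  have x2 : R0 - 1 < r x by lra.
  apply: (der_eq (derB (derN (der_comp (der_ipow 1 x2) (der_r_of R0 eps x))) (der_ipow 1 x1))).
  by move: (ip 2 (r x)) (ip 2 x) (Num.sqrt eps); intros; ring.
have hc x : R0 <= x <= b -> {for x, continuous (fun y => ker y)}.
  by move=> /andP[hx _]; exact: ker_cont.
have h := der_primitive hb' hd hc.
have rR : r R0 = R0 by rewrite /r_of subrr mulr0 addr0.
have e : ip 1 R0 = 1 by rewrite /ipow subrr addr0 expr1n invr1.
have := ipow_gt0 1 hb'; have := ipow_gt0 1 (r_of_ge eps hb').
move: h; rewrite rR e; lra.
Qed.

Lemma dissipation_le_square :
  \int[mu]_(x in `[R0, b]) (rho x * p x ^+ 2) <= (2 + 4 * K1) * H.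
Proof.
have K10 : 0 <= K1.
  by apply: divr_ge0; [apply: mulr_ge0; [rewrite mulr_ge0 ?sqr_ge0|exact: ltW]|exact: sqr_ge0].
have ik : L1 `[R0, b] (fun x => ker x).
  by apply: L1_continuous => x /andP[hx _]; exact: ker_cont.
have i2 := L1Z 2 mI sq_int.
apply: (@le_trans _ _ (\int[mu]_(x in `[R0, b]) (2 * sq x + (2 * (K1 * H)) * ker x))).
  apply: le_Rintegral => //; first exact: (L1D mI i2 (L1Z _ mI ik)).
  move=> x hx; have hx' : R0 <= x <= b by move: hx; rewrite /= in_itv.
  apply: (@le_trans _ _ (2 * sq x + 2 * (rho x * (kappa x * q x) ^+ 2))).
    rewrite -subr_ge0.
    rewrite (_ : _ - _ = rho x * (p x - 2 * (kappa x * q x)) ^+ 2); last by move: (kappa x) (rho x) => k l; ring.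
    by apply: mulr_ge0; [exact: powR_ge0|exact: sqr_ge0].
  apply: lerD => //; rewrite -mulrA; apply: ler_wpM2l => //; exact: log_derivative_term.
rewrite (Rintegral_linear _ mI i2 ik) RintegralZl//.
rewrite [(2 + _) * _]mulrDl; apply: lerD => //.
have -> : 4 * K1 * H = 2 * (K1 * H) * 2 by move: H; intros; ring.
by apply: ler_wpM2l; [apply: mulr_ge0 => //; exact: mulr_ge0|exact: kernel_integral].
Qed.

Lemma truncated_inequality : \int[mu]_(x in `[R0, b]) (rho x * p x ^+ 2) <=
  (2 + 4 * K1) * (\int[mu]_(x in `[R0, b]) (rho x * p x ^+ 2)
    + \int[mu]_(x in `[R0, b]) pot x
    + (K4 * E + K6 * s * D) + A * m / c0 * D * (ip 2 (r b) + ip 2 b)).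
Proof.
have K10 : 0 <= K1.
  by apply: divr_ge0; [apply: mulr_ge0; [rewrite mulr_ge0 ?sqr_ge0|exact: ltW]|exact: sqr_ge0].
apply: (le_trans dissipation_le_square); apply: ler_wpM2l; first by rewrite addr_ge0// mulr_ge0.
rewrite energy_identity; apply: lerD; last first.
  apply: le_trans (boundary_bound hb').
  by rewrite -normrN; exact: ler_norm.
apply: lerD => //.
have iE := L1_segment b E_int.
have ii : L1 `[R0, b] (ip 2) := L1_segment b (L1_ipow2 R0).
have K40 : 0 <= K4 by apply: divr_ge0; [apply: mulr_ge0 => //|]; exact: ltW.
have K60 : 0 <= K6 * s * D.
  by do 2 (apply: mulr_ge0 => //); apply: divr_ge0 => //; apply: mulr_ge0; exact: ltW.
apply: (@le_trans _ _ (\int[mu]_(x in `[R0, b]) (K4 * (eps * v x ^+ 2 * rho x) + K6 * s * D * ip 2 x))).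
  apply: le_Rintegral => //; first exact: (L1D mI (L1Z _ mI iE) (L1Z _ mI ii)).
  by move=> x /inI hx; apply: le_trans (weight_term_bound hx); exact: ler_norm.
rewrite (Rintegral_linear _ mI (L1Z _ mI iE) ii) RintegralZl//; apply: lerD.
  by apply: ler_wpM2l => //; apply: Rintegral_segment_le.
by apply: ler_piMr => //; exact: Rintegral_ipow2_le.
Qed.

End truncated.

Hypothesis P_int : L1 `[R0, +oo[ (fun x => pot x).
Local Notation P := (\int[mu]_(x in `[R0, +oo[) pot x).

(** The truncation is removed along [b n], where [n.+1] keeps [b n] above [R0]. The boundary terms
    are at most a multiple of [harmonic n]; the multiple contains [s^-1], which is allowed because
    the limit is taken at fixed [eps]. *)
Lemma profile_inequality :
  D <= (2 + 4 * (2 * A ^+ 2 * m / c0 ^+ 2)) * (D + P + (K4 * E + K6 * s * D)).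
Proof.
set C1 := 2 + _; set X := K4 * E + K6 * s * D.
pose k := A * m / c0 * D.
pose b (n : nat) := R0 + n.+1%:R.
have bR n : R0 < b n by rewrite ltrDl.
have cD : (fun n : nat => \int[mu]_(x in `[R0, b n]) (rho x * p x ^+ 2)) @ \oo --> D.
  by have h := cvg_Rintegral_segment D_int; rewrite -cvg_shiftS in h; exact: h.
have cP : (fun n : nat => \int[mu]_(x in `[R0, b n]) pot x) @ \oo --> P.
  by have h := cvg_Rintegral_segment P_int; rewrite -cvg_shiftS in h; exact: h.
have s0 : 0 < s by rewrite sqrtr_gt0.
have iple (t : R) n : 0 < t -> t <= 1 -> ip 2 (R0 + t * n.+1%:R) <= t^-1 * harmonic n.
  move=> t0 t1; have tn : 0 < t * n.+1%:R by rewrite mulr_gt0.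
  apply: (@le_trans _ _ (ip 1 (R0 + t * n.+1%:R))).
    by apply: ipow_le => //; rewrite lerDl ltW.
  rewrite /ipow /= expr1 (addrC R0) addrK -invfM lef_pV2 ?posrE//.
    by rewrite lerDr.
  by rewrite addr_gt0.
have hB n : k * (ip 2 (r (b n)) + ip 2 (b n)) <= k * ((s^-1 + 1) * harmonic n).
  apply: ler_wpM2l.
    apply: mulr_ge0 => //; apply: divr_ge0; last exact: ltW.
    by apply: mulr_ge0 => //; exact: ltW.
  rewrite mulrDl; apply: lerD.
    by rewrite /r_of (addrC (b n) (- R0)) /b addKr; exact: iple.
  by have := iple 1 n ltr01 (lexx 1); rewrite mul1r invr1.
apply: (ler_cvg_to cD (g := fun n => C1 * (\int[mu]_(x in `[R0, b n]) (rho x * p x ^+ 2)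
    + \int[mu]_(x in `[R0, b n]) pot x + X + k * ((s^-1 + 1) * harmonic n)))).
  apply: cvgM; first exact: cvg_cst.
  rewrite -[in X in _ --> X](addr0 (D + P + X)).
  apply: cvgD; first by apply: cvgD; [exact: cvgD|exact: cvg_cst].
  rewrite -[X in _ --> X](mulr0 k); apply: cvgM; first exact: cvg_cst.
  rewrite -[X in _ --> X](mulr0 (s^-1 + 1)); apply: cvgM; first exact: cvg_cst.
  exact: cvg_harmonic.
near=> n; apply: (le_trans (truncated_inequality (bR n))).
have C10 : 0 <= C1.
  apply: addr_ge0 => //; apply: mulr_ge0 => //; apply: divr_ge0; last exact: sqr_ge0.
  by apply: mulr_ge0; [apply: mulr_ge0 => //; exact: sqr_ge0|exact: ltW].
apply: ler_wpM2l => //.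
by apply: lerD => //; exact: hB.
Unshelve. all: by end_near.
Qed.

End profile_inequality.

(** * Integration over the sector *)

Section product_integrals.
Context {R : realType}.
Notation mu := (@lebesgue_measure R).
Variables I J : set (measurableTypeR R).
Hypotheses (mI : measurable I) (mJ : measurable J).
Implicit Types (h g : R -> R -> R).

(** Extension by zero to the whole plane, so that the Fubini theorems on the full product apply. *)
Let ext h : measurableTypeR R * measurableTypeR R -> R :=
  (fun z : R * R => h z.1 z.2) \_ (I `*` J).

Definition L1x h := (mu \x mu)%E.-integrable setT (EFin \o ext h).

Let mIJ : measurable (I `*` J). Proof. exact: measurableX. Qed.

Let ext_meas h : measurable_fun (I `*` J) (fun z : R * R => h z.1 z.2) ->
  measurable_fun setT (ext h).
Proof. by move=> mh; apply/(measurable_restrictT _ mIJ). Qed.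

Let ext1 h w : I w -> (fun x => ext h (w, x)) = h w \_ J.
Proof.
move=> Iw; apply/funext => x; rewrite /ext !patchE in_setX /=.
by rewrite mem_set.
Qed.

Let ext1N h w : ~ I w -> (fun x => ext h (w, x)) = fun=> 0.
Proof. by move=> Iw; apply/funext => x; rewrite /ext patchE in_setX memNset. Qed.

Let ext2 h x : J x -> (fun w => ext h (w, x)) = h^~ x \_ I.
Proof.
move=> Jx; apply/funext => w; rewrite /ext !patchE in_setX /=.
by rewrite andbC mem_set.
Qed.

Let ext2N h x : ~ J x -> (fun w => ext h (w, x)) = fun=> 0.
Proof. by move=> Jx; apply/funext => w; rewrite /ext patchE in_setX andbC memNset. Qed.

Let int_ext1 h : (fun w => \int[mu]_x (ext h (w, x))%:E)%E =
  (fun w => \int[mu]_(x in J) (h w x)%:E)%E \_ I.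
Proof.
apply/funext => w; rewrite patchE; case: ifPn => [|/negP].
  rewrite inE => Iw; rewrite [RHS]integral_mkcond.
  apply: eq_integral => x _; have /= -> := congr1 (fun f => f x) (ext1 h Iw).
  by rewrite !patchE; case: ifP.
move=> Iw; rewrite integral0_eq// => x _.
by have /= -> := congr1 (fun f => f x) (ext1N h (fun Iw' => Iw (mem_set Iw'))).
Qed.

Let int_ext2 h : (fun x => \int[mu]_w (ext h (w, x))%:E)%E =
  (fun x => \int[mu]_(w in I) (h w x)%:E)%E \_ J.
Proof.
apply/funext => x; rewrite patchE; case: ifPn => [|/negP].
  rewrite inE => Jx; rewrite [RHS]integral_mkcond.
  apply: eq_integral => w _; have /= -> := congr1 (fun f => f w) (ext2 h Jx).
  by rewrite !patchE; case: ifP.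
move=> Jx; rewrite integral0_eq// => w _.
by have /= -> := congr1 (fun f => f w) (ext2N h (fun Jx' => Jx (mem_set Jx'))).
Qed.

Lemma L1x_lty h : measurable_fun (I `*` J) (fun z : R * R => h z.1 z.2) ->
  (\int[mu]_(w in I) \int[mu]_(x in J) `|h w x|%:E < +oo)%E -> L1x h.
Proof.
move=> mh hfin; apply/integrable12ltyP; first by apply/measurable_EFinP; exact: ext_meas.
rewrite integral_mkcond -(int_ext1 (fun w x => `|h w x|)) in hfin.
congr (_ < _)%E : hfin; apply: eq_integral => w _; apply: eq_integral => x _ /=.
by congr EFin; rewrite /ext !patchE; case: ifP; rewrite ?normr0.
Qed.

Lemma L1x_le h g : measurable_fun (I `*` J) (fun z : R * R => h z.1 z.2) -> L1x g ->
  (forall w x, I w -> J x -> `|h w x| <= g w x) -> L1x h.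
Proof.
move=> mh ig hg; apply: (le_integrable measurableT _ _ ig).
  by apply/measurable_EFinP; exact: ext_meas.
move=> [w x] _ /=; rewrite lee_fin /ext !patchE.
case: ifP => [|_]; last by rewrite normr0.
rewrite inE => -[/= Iw Jx]; apply: (le_trans (hg w x Iw Jx)); exact: ler_norm.
Qed.

Lemma L1x_section1 h : L1x h -> {ae mu, forall w : R, I w -> L1 J (h w)}.
Proof.
move=> ih; have := ae_integrable1 ih; apply: filterS => w hw Iw.
apply/(@integrable_mkcond _ _ _ mu J (EFin \o h w) mJ).
rewrite restrict_EFin -(ext1 h Iw); exact: hw.
Qed.

Lemma L1x_section2 h : L1x h -> {ae mu, forall x : R, J x -> L1 I (h^~ x)}.
Proof.
move=> ih; have := ae_integrable2 ih; apply: filterS => x hx Jx.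
apply/(@integrable_mkcond _ _ _ mu I (EFin \o h^~ x) mI).
rewrite restrict_EFin -(ext2 h Jx); exact: hx.
Qed.

(** Inner integrals are extended reals, finite almost everywhere; [fine] alters them on a null set
    only. *)
Let fine_integrable (D : set (measurableTypeR R)) (F : R -> \bar R) : measurable D ->
  mu.-integrable D F -> L1 D (fine \o F) /\ (\int[mu]_(x in D) F x = (\int[mu]_(x in D) fine (F x))%:E)%E.
Proof.
move=> mD iF; have mF := measurable_int _ iF.
have ae : ae_eq mu D F (EFin \o (fine \o F)).
  have := integrable_ae mD iF; apply: filterS => x hx Dx /=.
  by rewrite fineK//; exact: hx.
have mfF : measurable_fun D (EFin \o (fine \o F)).
  by apply/measurable_EFinP; apply: measurableT_comp mF.
have i : L1 D (fine \o F).
  apply: (le_integrable mD mfF _ iF) => x _ /=.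
  by case: (F x) => [t| |] /=; rewrite ?normr0 ?lexx ?leey.
split => //; rewrite (ae_eq_integral _ _ mD mF mfF ae) /Rintegral fineK//.
by apply: integrable_fin_num.
Qed.

Lemma L1x_int1 h : L1x h -> L1 I (fun w => \int[mu]_(x in J) h w x) /\
  (\int[mu]_(w in I) \int[mu]_(x in J) (h w x)%:E
   = (\int[mu]_(w in I) \int[mu]_(x in J) h w x)%:E)%E.
Proof.
move=> ih; apply: (fine_integrable mI).
apply/(@integrable_mkcond _ _ _ mu I _ mI); rewrite -int_ext1.
exact: integrable_fubini_F ih.
Qed.

Lemma L1x_int2 h : L1x h -> L1 J (fun x => \int[mu]_(w in I) h w x) /\
  (\int[mu]_(w in I) \int[mu]_(x in J) (h w x)%:E
   = (\int[mu]_(x in J) \int[mu]_(w in I) h w x)%:E)%E.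
Proof.
move=> ih.
have iG : mu.-integrable J (fun x => \int[mu]_(w in I) (h w x)%:E)%E.
  apply/(@integrable_mkcond _ _ _ mu J _ mJ); rewrite -int_ext2.
  have mf : measurable_fun setT (EFin \o ext h) := measurable_int _ ih.
  apply/integrableP; split; first exact: measurable_fubini_G ih.
  have hfin : (\int[mu]_x \int[mu]_w `|(EFin \o ext h) (w, x)| < +oo)%E.
    exact/(integrable21ltyP _ _ mf).
  apply: le_lt_trans hfin.
  apply: ge0_le_integral; [exact: measurableT|by []| | |].
  - by apply: measurableT_comp => //; exact: measurable_fubini_G ih.
  - apply: (measurable_fun_fubini_tonelli_G (abse \o (EFin \o ext h))).
      exact: measurableT_comp.
    by move=> z; exact: abse_ge0.
  - move=> x _; apply: le_abse_integral => //.
    exact: (measurableT_comp mf (pair2_measurable x)).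
have [i e] := fine_integrable mJ iG; split => //.
rewrite -e integral_mkcond [RHS]integral_mkcond -int_ext1 -int_ext2; exact: (Fubini ih).
Qed.

(** A product majorant for almost every [w] suffices: iterated integration bounds the whole by the
    integral of [K] times that of [k], up to absolute values. *)
Lemma L1x_dominated h (K k : R -> R) :
  measurable_fun (I `*` J) (fun z : R * R => h z.1 z.2) -> L1 I K -> L1 J k ->
  {ae mu, forall w : R, I w -> forall x, J x -> `|h w x| <= K w * k x} -> L1x h.
Proof.
move=> mh iK ik hae; apply: L1x_lty => //.
have iK' : L1 I (fun w => `|K w|) := integrable_norm iK.
have ik' : L1 J (fun x => `|k x|) := integrable_norm ik.
pose c := \int[mu]_(x in J) `|k x|.
have mabs : measurable_fun (I `*` J) (fun z : R * R => `|h z.1 z.2|) by exact: measurableT_comp.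
have mF : measurable_fun I (fun w => \int[mu]_(x in J) `|h w x|%:E)%E.
  apply/(measurable_restrictT _ mI); rewrite -(int_ext1 (fun w x => `|h w x|)).
  apply: (measurable_fun_fubini_tonelli_F (EFin \o ext (fun w x => `|h w x|))).
    by apply/measurable_EFinP; exact: ext_meas mabs.
  by move=> z /=; rewrite lee_fin /ext patchE; case: ifP.
have icK : L1 I (fun w => c * `|K w|) by exact: L1Z.
apply: (@le_lt_trans _ _ (\int[mu]_(w in I) (c * `|K w|)%:E)%E); last first.
  by apply: integrable_lty => //; exact: icK.
apply: ae_ge0_le_integral => //.
- by move=> w _; apply: integral_ge0 => x _; rewrite lee_fin.
- by move=> w _; rewrite lee_fin mulr_ge0//; exact: Rintegral_ge0.
- by apply/measurable_EFinP; exact: L1_measurable icK.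
apply: (@filterS _ _ (ae_filter_ringOfSetsType mu) _ _ _ hae) => w hw Iw.
have -> : (c * `|K w|)%:E = (\int[mu]_(x in J) (`|K w| * `|k x|)%:E)%E.
  rewrite mulrC /c -RintegralZl// /Rintegral fineK//.
  by apply: integrable_fin_num => //; exact: (L1Z _ mJ ik').
apply: ge0_le_integral => //.
- apply/measurable_EFinP.
  have mw : measurable_fun setT ((fun x => ext (fun w x => `|h w x|) (w, x))).
    exact: (measurableT_comp (ext_meas mabs) (pair1_measurable w)).
  by apply/(measurable_restrictT _ mJ); rewrite -(ext1 (fun w x => `|h w x|) Iw); exact: mw.
- by apply/measurable_EFinP; exact: (L1_measurable (L1Z _ mJ ik')).
- move=> x Jx; rewrite lee_fin -normrM; apply: (le_trans (hw Iw x Jx)); exact: ler_norm.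
Qed.

End product_integrals.

(** * Comparison almost everywhere and measurability *)

Section almost_everywhere.
Context {R : realType}.
Notation mu := (@lebesgue_measure R).

Lemma ae_le_Rintegral (D : set (measurableTypeR R)) (f g : R -> R) : measurable D ->
  L1 D f -> L1 D g -> {ae mu, forall x : R, D x -> f x <= g x} ->
  \int[mu]_(x in D) f x <= \int[mu]_(x in D) g x.
Proof.
move=> mD hf hg hae; rewrite -subr_ge0 -RintegralB//.
have hB : L1 D (fun x => g x - f x).
  have := L1D mD hg (L1Z (-1) mD hf).
  by apply: L1_eq => // x _; rewrite mulN1r.
have hN : L1 D (fun x => `|g x - f x|) := integrable_norm hB.
have -> : \int[mu]_(x in D) (g x - f x) = \int[mu]_(x in D) `|g x - f x|.
  congr fine; apply: (ae_eq_integral _ _ mD); [exact: measurable_int hB|exact: measurable_int hN|].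
  apply: (@filterS _ _ (ae_filter_ringOfSetsType mu) _ _ _ hae) => x hx Dx.
  by rewrite /= ger0_norm// subr_ge0 hx.
exact: Rintegral_ge0.
Qed.

(** For the product structure on the plane, each superlevel set is a countable union of rational
    rectangles contained in it. *)
Lemma cont2_measurable (a b c : R) (g : R -> R -> R) :
  (forall w x, a < w < b -> c < x -> cont2 g w x) ->
  measurable_fun (`]a, b[ `*` `]c, +oo[) (fun z : R * R => g z.1 z.2).
Proof.
move=> gc mD; apply: (measurability _ (RGenOInfty.measurableE R)) => //.
move=> /= _ [_ [t ->] <-]; rewrite preimage_itvoy.
pose inside (p1 p2 q1 q2 : rat) : Prop := forall w x : R,
  ratr p1 < w < ratr p2 -> ratr q1 < x < ratr q2 -> [/\ a < w < b, c < x & t < g w x].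
pose box (p1 p2 q1 q2 : rat) : set (R * R) :=
  if `[< inside p1 p2 q1 q2 >] then `]ratr p1, ratr p2[ `*` `]ratr q1, ratr q2[ else set0.
rewrite [X in measurable X](_ : _ = \bigcup_(p1 : rat) \bigcup_(p2 : rat)
    \bigcup_(q1 : rat) \bigcup_(q2 : rat) box p1 p2 q1 q2).
  do 4 (apply: bigcupT_measurable_rat => ?).
  by rewrite /box; case: ifP => _; [apply: measurableX|].
apply/seteqP; split.
  move=> [w x] [[/= wI xJ] tg]; move: wI xJ; rewrite !in_itv /= andbT => wI xJ.
  have e0 : 0 < g w x - t by rewrite subr_gt0.
  have [d d0 hd] := cont2_dist e0 (gc w x wI xJ).
  have /andP[wa wb] := wI.
  pose m := Num.min d (Num.min (w - a) (Num.min (b - w) (x - c))).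
  have m0 : 0 < m by rewrite !lt_min d0 !subr_gt0 wa wb.
  have mm : [/\ m <= d, m <= w - a, m <= b - w & m <= x - c].
    by split; rewrite /m !ge_min lexx ?orbT.
  have [m1 m2 m3 m4] := mm.
  have l1 : w - m < w by lra.
  have l2 : w < w + m by lra.
  have l3 : x - m < x by lra.
  have l4 : x < x + m by lra.
  have [p1] := rat_in_itvoo l1; rewrite in_itv /= => /andP[p11 p12].
  have [p2] := rat_in_itvoo l2; rewrite in_itv /= => /andP[p21 p22].
  have [q1] := rat_in_itvoo l3; rewrite in_itv /= => /andP[q11 q12].
  have [q2] := rat_in_itvoo l4; rewrite in_itv /= => /andP[q21 q22].
  exists p1 => //; exists p2 => //; exists q1 => //; exists q2 => //.
  rewrite /box ifT; first by split => /=; rewrite in_itv /= ?p12 ?p21 ?q12 ?q21.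
  apply/asboolP => w' x' /andP[w1 w2] /andP[x1 x2].
  have hw : `|w' - w| < d by rewrite ltr_norml; apply/andP; split; lra.
  have hx : `|x' - x| < d by rewrite ltr_norml; apply/andP; split; lra.
  have := hd w' x' hw hx; rewrite ltr_norml => /andP[h1 h2].
  clear gc hd e0 wI; split; [apply/andP; split| |]; lra.
move=> [w x] [p1 _ [p2 _ [q1 _ [q2 _]]]]; rewrite /box; case: ifP => // /asboolP ins [/=].
rewrite !in_itv /= => hw hx; have [h1 h2 h3] := ins w x hw hx.
split; last exact: h3.
by split => /=; rewrite ?in_itv /= ?h1 ?h2.
Qed.

End almost_everywhere.

(** * The inequality on the sector *)

Section integrated_inequality.
Context {R : realType}.
Notation mu := (@lebesgue_measure R).
Variables (R0 delta eps c0 A C th : R).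
Hypotheses (hR0 : 0 < R0) (hdelta : 0 <= delta <= 1) (heps : 0 < eps) (hs1 : Num.sqrt eps <= 1).
Hypotheses (hc0 : 0 < c0) (hA : 0 <= A) (hC : 0 <= C) (hth : 0 < th).
Local Notation s := (Num.sqrt eps).
Local Notation r := (r_of R0 eps).
Local Notation rho x := (r x `^ delta).
Local Notation m := (Num.max 1 R0^-1).
Local Notation M := (Num.max 1 R0).
Local Notation ip := (ipow R0).
Local Notation I := (`]0, th[%classic : set (measurableTypeR R)).
Local Notation J := (`]R0, +oo[%classic : set (measurableTypeR R)).

Variables u u1 u2 v : R -> R -> R.
Hypothesis u_der : forall w x, der (u w) x (u1 w x).
Hypothesis u1_der : forall w x, der (u1 w) x (u2 w x).
Hypothesis u_cont : forall w x, 0 < w -> cont2 u w x.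
Hypothesis u2_cont : forall w x, 0 < w -> cont2 u2 w x.
Hypothesis u_lower : forall w x, 0 < w < th -> R0 <= x -> c0 <= u w x.
Hypothesis u1_upper : forall w x, 0 < w < th -> R0 <= x ->
  `|u1 w x| <= A * (s * ip 4 (r x) + ip 4 x).
Hypothesis u2_upper : forall w x, 0 < w < th -> R0 <= x -> `|u2 w x| <= C * ip 4 x.
Hypothesis hv : spaceB0 R0 th eps delta v.

Local Notation q := (mul_r R0 eps v).
Local Notation p := (d2 (mul_r R0 eps v)).
Let dD w x := rho x * p w x ^+ 2.
Let dF w x := eps * (d1 v w x) ^+ 2 * rho x.
Let dE w x := eps * (v w x) ^+ 2 * rho x.
Let dN w x := rho x * `|p w x| ^+ 2 + eps * (d1 v w x) ^+ 2 * rho x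
  + eps * (v w x) ^+ 2 * rho x.
Let pot w x := rho x * (q w x / u w x) ^+ 2 * (u w x * u2 w x).

Let mI : measurable I. Proof. by []. Qed.
Let mJ : measurable J. Proof. by []. Qed.

Let dD_ge0 w x : 0 <= dD w x.
Proof. by apply: mulr_ge0; [exact: powR_ge0|exact: sqr_ge0]. Qed.
Let dF_ge0 w x : 0 <= dF w x.
Proof.
by apply: mulr_ge0; [apply: mulr_ge0; [exact: ltW|exact: sqr_ge0]|exact: powR_ge0].
Qed.
Let dE_ge0 w x : 0 <= dE w x.
Proof.
by apply: mulr_ge0; [apply: mulr_ge0; [exact: ltW|exact: sqr_ge0]|exact: powR_ge0].
Qed.

Let dNE w x : dN w x = dD w x + dF w x + dE w x.
Proof. by rewrite /dN /dD real_normK// num_real. Qed.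

Local Notation meas g := (measurable_fun (I `*` J) (fun z : R * R => g z.1 z.2)).

Let m_r : meas (fun _ x => r x).
Proof.
apply: (@cont2_measurable _ 0 th R0 (fun _ x => r x)) => w x _ _.
by apply: cont2_of_snd; exact: der_continuous (der_r_of R0 eps x).
Qed.

Let m_rho : meas (fun _ x => rho x).
Proof. exact: measurableT_comp (measurable_powR delta) m_r. Qed.

Let m_dD : meas dD.
Proof.
by apply: measurable_funM; [exact: m_rho|apply: measurable_funX; exact: (spaceB0_meas2 hv)].
Qed.

Let m_dF : meas dF.
Proof.
apply: measurable_funM; [apply: measurable_funM => //|exact: m_rho].
by apply: measurable_funX; exact: (spaceB0_meas1 hv).
Qed.

Let m_dE : meas dE.
Proof.
apply: measurable_funM; [apply: measurable_funM => //|exact: m_rho].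
by apply: measurable_funX; exact: (spaceB0_meas hv).
Qed.

Let m_dN : meas dN.
Proof.
rewrite (_ : dN = fun w x => dD w x + dF w x + dE w x); last first.
  by apply/funext => w; apply/funext => x; exact: dNE.
by apply: measurable_funD; [apply: measurable_funD|]; [exact: m_dD|exact: m_dF|exact: m_dE].
Qed.

Let i_dN : L1x I J dN.
Proof.
apply: L1x_lty => //.
rewrite (_ : (\int[mu]_(w in I) _)%E = normB2 R0 th eps delta v); first exact: spaceB0_norm hv.
apply: eq_integral => w _; apply: eq_integral => x _.
by rewrite ger0_norm// dNE !addr_ge0.
Qed.

Let i_dD : L1x I J dD.
Proof.
apply: (L1x_le mI mJ m_dD i_dN) => w x _ _; rewrite ger0_norm// dNE.
by rewrite -addrA lerDl addr_ge0.
Qed.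

Let i_dF : L1x I J dF.
Proof.
apply: (L1x_le mI mJ m_dF i_dN) => w x _ _; rewrite ger0_norm// dNE.
by rewrite (addrC (dD w x)) -addrA lerDl addr_ge0.
Qed.

Let i_dE : L1x I J dE.
Proof.
apply: (L1x_le mI mJ m_dE i_dN) => w x _ _; rewrite ger0_norm// dNE.
by rewrite lerDr addr_ge0.
Qed.

Let inI w : I w -> 0 < w < th. Proof. by rewrite /= in_itv. Qed.
Let inJ x : J x -> R0 < x. Proof. by rewrite /= in_itv /= andbT. Qed.

(** The angles to which the inequality on a ray applies; they have full measure by Fubini and by the
    absolute continuity in [spaceB0]. *)
Let good w := [/\ 0 < w < th, forall b, R0 < b -> abs_cont R0 b (q w),
  L1 J (dD w) & L1 J (dE w)].

Let ae_good : {ae mu, forall w : R, I w -> good w}.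
Proof.
have h1 := L1x_section1 mJ i_dD; have h2 := L1x_section1 mJ i_dE.
have h3 := spaceB0_ac2 hv.
apply: (@filterS3 _ _ (ae_filter_ringOfSetsType mu) _ _ _ _ _ h1 h2 h3).
by move=> w g1 g2 g3 Iw; split; [exact: inI|apply: g3; exact: inI|exact: g1|exact: g2].
Qed.

Let good_int w : good w -> forall b, R0 <= b -> L1 `[R0, b] (p w).
Proof.
move=> [_ ac _ _] b hb; have hb1 : R0 < b + 1 by lra.
have [i _] := ac _ hb1.
by apply: (L1_sub _ _ _ i) => //; apply: subset_itvl; rewrite bnd_simp lerDl ler01.
Qed.

Let good_prim w : good w -> forall x, R0 <= x -> q w x = \int[mu]_(y in `[R0, x]) p w y.
Proof.
move=> [hw ac _ _] x hx; have hx1 : R0 < x + 1 by lra.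
have [_ e] := ac _ hx1; rewrite e; last by rewrite hx lerDl ler01.
by rewrite {1}/mul_r (spaceB0_bottom hv hw) mulr0 add0r.
Qed.

Let K5 := C * m / c0.
Let Dw w := \int[mu]_(x in J) dD w x.
Let Ew w := \int[mu]_(x in J) dE w x.
Let Pw w := \int[mu]_(x in J) pot w x.

Let pot_le w : good w -> forall x, J x -> `|pot w x| <= (K5 * Dw w) * ip 2 x.
Proof.
move=> gw x /inJ hx; have [hw _ iD _] := gw; have iD' := L1_obnd_cbnd iD.
rewrite /Dw (Rintegral_itv_obnd_cbnd iD).
exact: (potential_bound hR0 hdelta hs1 hc0 (fun y hy => u_lower hw hy)
  (fun y hy => u2_upper hw hy) (good_int gw) (good_prim gw) iD' (ltW hx)).
Qed.

Let m_q : meas q.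
Proof. by apply: measurable_funM; [exact: m_r|exact: spaceB0_meas hv]. Qed.

Let m_u : meas u.
Proof. by apply: cont2_measurable => w x /andP[w0 _] _; exact: u_cont. Qed.

Let m_u2 : meas u2.
Proof. by apply: cont2_measurable => w x /andP[w0 _] _; exact: u2_cont. Qed.

Let m_uV : meas (fun w x => (u w x)^-1).
Proof.
apply: cont2_measurable => w x hw hx; apply: cvgV.
  by rewrite gt_eqF//; exact: lt_le_trans (u_lower hw (ltW hx)).
by apply: u_cont; case/andP: hw.
Qed.

Let m_pot : meas pot.
Proof.
apply: measurable_funM; last by apply: measurable_funM; [exact: m_u|exact: m_u2].
apply: measurable_funM; first exact: m_rho.
by apply: measurable_funX; apply: measurable_funM; [exact: m_q|exact: m_uV].
Qed.

(** The majorant is the dissipation of the ray times [ip 2], a product of integrable functions. The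
    potential has no sign, so its absolute integrability must precede any use of its iterated
    integral. *)
Let i_pot : L1x I J pot.
Proof.
have [iDw _] := L1x_int1 mI i_dD.
have i2 : L1 J (ip 2).
  by apply: (L1_sub _ _ _ (L1_ipow2 R0)) => //; apply: subset_itvr; rewrite bnd_simp.
apply: (L1x_dominated mI mJ m_pot (L1Z K5 mI iDw) i2).
apply: (@filterS _ _ (ae_filter_ringOfSetsType mu) _ _ _ ae_good) => w gw Iw.
exact: pot_le (gw Iw).
Qed.

Let C1 := 2 + 4 * (2 * A ^+ 2 * m / c0 ^+ 2).
Let K4 := A * M / c0.
Let K6 := A / (c0 * R0).

Let section_inequality : {ae mu, forall w : R, I w ->
  Dw w <= C1 * (Dw w + Pw w + (K4 * Ew w + K6 * s * Dw w))}.
Proof.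
have h := L1x_section1 mJ i_pot.
apply: (@filterS2 _ _ (ae_filter_ringOfSetsType mu) _ _ _ _ ae_good h) => w gw iP Iw.
have {}gw := gw Iw; have {}iP := iP Iw; have [hw _ iD iE] := gw.
rewrite /Dw /Ew /Pw (Rintegral_itv_obnd_cbnd iD) (Rintegral_itv_obnd_cbnd iE)
  (Rintegral_itv_obnd_cbnd iP).
have hw0 : 0 < w by case/andP: hw.
have u2c : continuous (u2 w).
  move=> x.
  apply: (@continuous_comp _ _ _ (fun x => (w, x)) (fun z : R * R => u2 z.1 z.2)); last exact: u2_cont.
  by apply: (@cvg_pair _ _ _ _ (nbhs w) (nbhs x)); [exact: cvg_cst|exact: cvg_id].
exact: (profile_inequality hR0 hdelta heps hs1 hc0 hA (u_der w) (u1_der w) u2c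
  (fun y hy => u_lower hw hy) (fun y hy => u1_upper hw hy) (good_int gw) (good_prim gw)
  (fun y _ => erefl) (L1_obnd_cbnd iD) (L1_obnd_cbnd iE) (L1_obnd_cbnd iP)).
Qed.

Let F2 x := \int[mu]_(w in I) dF w x.
Let E2 x := \int[mu]_(w in I) dE w x.

(** One factor [th] comes from Cauchy-Schwarz starting at [w = 0], where [v] vanishes, the other
    from integrating the pointwise bound over the angle. *)
Let poincare_section x : R0 < x -> abs_cont 0 th (v^~ x) -> L1 I (dF^~ x) -> L1 I (dE^~ x) ->
  E2 x <= th ^+ 2 * F2 x.
Proof.
move=> hx [i0 ac] iF iE.
have pt w : I w -> dE w x <= th * F2 x.
  move=> Iw; have [w0 wth] := andP (inI Iw); have w0' := ltW w0.
  have mw : measurable (`[0, w]%classic : set (measurableTypeR R)) by [].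
  have i1 : L1 `[0, w] (derive1 (v^~ x)).
    by apply: (L1_sub _ _ _ i0) => //; apply: subset_itvl; rewrite bnd_simp ltW.
  have mo : measurable (`]0, w]%classic : set (measurableTypeR R)) by [].
  have sub : `]0, w]%classic `<=` `]0, th[%classic by apply: subset_itvl; rewrite bnd_simp.
  have io : L1 `]0, w] (dF^~ x) := L1_sub mo mI sub iF.
  have e0 y : dF y x = (eps * rho x) * derive1 (v^~ x) y ^+ 2.
    by rewrite /dF mulrAC.
  have ic : L1 `[0, w] (fun y => eps * rho x * derive1 (v^~ x) y ^+ 2).
    have := L1_obnd_cbnd io; apply: L1_eq => // y _; exact: e0.
  have er0 : 0 < eps * rho x by rewrite mulr_gt0// powR_gt0// r_of_pos// ltW.
  have h := weighted_primitive_sq w0' er0 (fun y _ => lexx _) i1 ic.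
  have ev : v w x = \int[mu]_(y in `[0, w]) derive1 (v^~ x) y.
    by rewrite ac ?w0' ?(ltW wth)// (spaceB0_left hv hx) add0r.
  rewrite /dE mulrAC ev; apply: (le_trans h); rewrite subr0.
  apply: ler_pM; [exact: w0'| |exact: ltW|].
    by apply: Rintegral_ge0 => y _; rewrite -e0.
  have -> : \int[mu]_(y in `[0, w]) (eps * rho x * derive1 (v^~ x) y ^+ 2) =
     \int[mu]_(y in `]0, w]) dF y x.
    by rewrite (Rintegral_itv_obnd_cbnd io); apply: eq_Rintegral => y _; rewrite e0.
  exact: (Rintegral_subset mo mI sub iF).
apply: (@le_trans _ _ (\int[mu]_(w in I) (th * F2 x))).
  apply: le_Rintegral => //.
  have mc : measurable (`[0, th]%classic : set (measurableTypeR R)) by [].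
  by apply: (L1_sub mI mc (@subset_itv_oo_cc _ R 0 th)); exact: L1_cst.
rewrite Rintegral_cst//= lebesgue_measure_itv/= lte_fin hth /= subr0.
by rewrite le_eqVlt; apply/orP; left; apply/eqP; rewrite expr2; ring.
Qed.

Let poincare : \int[mu]_(x in J) E2 x <= th ^+ 2 * \int[mu]_(x in J) F2 x.
Proof.
have [iF _] := L1x_int2 mJ i_dF; have [iE _] := L1x_int2 mJ i_dE.
rewrite -RintegralZl//; apply: ae_le_Rintegral => //; first exact: L1Z.
have h1 := L1x_section2 mI i_dF; have h2 := L1x_section2 mI i_dE; have h3 := spaceB0_ac1 hv.
apply: (@filterS3 _ _ (ae_filter_ringOfSetsType mu) _ _ _ _ _ h1 h2 h3) => x g1 g2 g3 Jx.
by apply: poincare_section; [exact: inJ|apply: g3; exact: inJ|exact: g1|exact: g2].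
Qed.

(** The two smallness conditions turn the errors into parts of the norm:
    [K4 * E <= K4 * th ^+ 2 * F <= th * F] by the Poincare inequality, and
    [K6 * s * D <= th * D]. *)
Lemma integrated_inequality : K4 * th <= 1 -> K6 * s <= th ->
  (iint R0 th dD <= C1%:E * (iint R0 th dD + iint R0 th pot + th%:E * normB2 R0 th eps delta v))%E.
Proof.
move=> hK4 hK6.
have [iD eD] := L1x_int1 mI i_dD.
have [iP eP] := L1x_int1 mI i_pot.
have [iE eE] := L1x_int1 mI i_dE.
have [_ eE'] := L1x_int2 mJ i_dE.
have [iF eF] := L1x_int1 mI i_dF.
have [_ eF'] := L1x_int2 mJ i_dF.
have [iN eN] := L1x_int1 mI i_dN.
have nN : normB2 R0 th eps delta v = (\int[mu]_(w in I) \int[mu]_(x in J) dN w x)%:E := eN.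
have nD : iint R0 th dD = (\int[mu]_(w in I) Dw w)%:E := eD.
have nP : iint R0 th pot = (\int[mu]_(w in I) Pw w)%:E := eP.
rewrite nN nD nP; suff : \int[mu]_(w in I) Dw w <= C1 * (\int[mu]_(w in I) Dw w
    + \int[mu]_(w in I) Pw w + th * \int[mu]_(w in I) \int[mu]_(x in J) dN w x).
  by rewrite -lee_fin.
set D := \int[mu]_(w in I) Dw w; set P := \int[mu]_(w in I) Pw w.
set N := \int[mu]_(w in I) _.
pose E := \int[mu]_(w in I) Ew w; pose F := \int[mu]_(w in I) \int[mu]_(x in J) dF w x.
have DN : D + F + E <= N.
  rewrite /D /E /F -!RintegralD//; last exact: L1D.
  apply: ae_le_Rintegral => //; first by apply: L1D => //; exact: L1D.
  have h1 := L1x_section1 mJ i_dD; have h2 := L1x_section1 mJ i_dF.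
  have h3 := L1x_section1 mJ i_dE.
  apply: (@filterS3 _ _ (ae_filter_ringOfSetsType mu) _ _ _ _ _ h1 h2 h3) => w g1 g2 g3 Iw.
  have {}g1 := g1 Iw; have {}g2 := g2 Iw; have {}g3 := g3 Iw.
  rewrite /Dw /Ew -(RintegralD mJ g1 g2) -(RintegralD mJ (L1D mJ g1 g2) g3).
  by rewrite le_eqVlt; apply/orP; left; apply/eqP; apply: eq_Rintegral => x _; rewrite dNE.
have PE : E <= th ^+ 2 * F.
  have eE2 : E = \int[mu]_(x in J) E2 x := EFin_inj (etrans (esym eE) eE').
  have eF2 : F = \int[mu]_(x in J) F2 x := EFin_inj (etrans (esym eF) eF').
  by rewrite eE2 eF2.
have main : D <= C1 * (D + P + (K4 * E + K6 * s * D)).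
  have iX : L1 I (fun w => C1 * (Dw w + Pw w + (K4 * Ew w + K6 * s * Dw w))).
    apply: L1Z => //; apply: L1D => //; first exact: L1D.
    by apply: L1D => //; exact: L1Z.
  have h := ae_le_Rintegral mI iD iX section_inequality.
  apply: (le_trans h).
  rewrite RintegralZl//; last first.
    apply: L1D => //; first exact: L1D.
    by apply: L1D => //; exact: L1Z.
  rewrite RintegralD//; [|exact: L1D|by apply: L1D => //; exact: L1Z].
  rewrite RintegralD// RintegralD//; [|exact: L1Z|exact: L1Z].
  by rewrite !RintegralZl.
apply: (le_trans main).
have C10 : 0 <= C1.
  apply: addr_ge0 => //; apply: mulr_ge0 => //; apply: divr_ge0; last exact: sqr_ge0.
  by apply: mulr_ge0; [apply: mulr_ge0 => //; exact: sqr_ge0|rewrite le_max ler01].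
apply: ler_wpM2l; first exact: C10.
have D0 : 0 <= D by apply: Rintegral_ge0 => w _; apply: Rintegral_ge0.
have F0 : 0 <= F by apply: Rintegral_ge0 => w _; apply: Rintegral_ge0.
have E0 : 0 <= E by apply: Rintegral_ge0 => w _; apply: Rintegral_ge0.
have K40 : 0 <= K4 by apply: divr_ge0; [apply: mulr_ge0 => //; rewrite le_max ler01|exact: ltW].
clear main; clearbody D P N E F K4 K6; apply: lerD; first exact: lexx.
apply: (@le_trans _ _ (th * F + th * D)).
  apply: lerD; last exact: ler_wpM2r.
  apply: (le_trans (ler_wpM2l K40 PE)).
  rewrite expr2 !mulrA; apply: ler_wpM2r => //.
  by apply: ler_piMl => //; exact: ltW.
rewrite -mulrDr; apply: ler_wpM2l; first exact: ltW.
by apply: le_trans DN; rewrite (addrC F) lerDl.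
Qed.

End integrated_inequality.

(** * Choice of the constants *)

Theorem lemma1p12 (R : realType) (R0 ub thb K delta : R)
    (ue0 ubar0 ub1 chi : R -> R) (up : R -> R -> R) (vp0 : R -> R)
    (hR0 : 0 < R0) (hub : 0 < ub) (hthb : 0 < thb)
    (hdelta : 0 <= delta <= 1)
    (hue0 : euler0 R0 ue0)
    (hubar0 : smooth_exp_decay R0 ubar0)
    (hub1 : smooth_exp_decay R0 ub1)
    (hmin : 0 < Num.min ub (inf [set ue0 R0 + ubar0 x | x in `[R0, +oo[]))
    (hup : prandtl0 R0 ub thb ue0 ubar0 up vp0)
    (hchi : cutoff chi) :
  exists C th_star : R, 0 < C /\ 0 < th_star <= thb /\
  forall th : R, 0 < th <= th_star ->
  forall Vb0 Vb1 : R -> R, euler1_data R0 th K vp0 Vb0 Vb1 ->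
  exists eps_star : R, 0 < eps_star <= 1 /\
  forall eps : R, 0 < eps <= eps_star ->
  forall ve1 : R -> R -> R, euler1 R0 th eps ue0 vp0 Vb0 Vb1 chi ve1 ->
  let u := us R0 eps ue0 ub1 up ve1 in
  (exists m : R, 0 < m /\
     forall w x : R, 0 <= w <= th -> R0 <= x -> m <= u w x) ->
  forall v : R -> R -> R, spaceB0 R0 th eps delta v ->
  let dissipation := iint R0 th (fun w x =>
    r_of R0 eps x `^ delta * `|d2 (mul_r R0 eps v) w x| ^+ 2) in
  let potential := iint R0 th (fun w x =>
    r_of R0 eps x `^ delta * (mul_r R0 eps v w x / u w x) ^+ 2
    * (u w x * d2 (d2 u) w x)) in
  (dissipation <= C%:E *
    (dissipation + potential + th%:E * normB2 R0 th eps delta v))%E.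
Proof.
have [c0 [A [ths [hc0 hA /andP[ths0 thsb] H]]]] :=
  us_bounds K hR0 hthb hue0 hubar0 hub1 hmin hup hchi.
pose K4 := A * Num.max 1 R0 / c0; pose K6 := A / (c0 * R0).
have K40 : 0 < K4 by rewrite divr_gt0// mulr_gt0// lt_max ltr01.
have K60 : 0 < K6 by rewrite divr_gt0// mulr_gt0.
have m0 : 0 < Num.max 1 R0^-1 by rewrite lt_max ltr01.
(* [c0] and [A] were fixed before [th], the lateral data and [eps], so this constant is independent
   of them all. *)
exists (2 + 4 * (2 * A ^+ 2 * Num.max 1 R0^-1 / c0 ^+ 2)), (Num.min ths K4^-1).
split; first by rewrite addr_gt0// mulr_gt0// divr_gt0 ?mulr_gt0 ?exprn_gt0.
split; first by rewrite lt_min ths0 invr_gt0 K40 ge_min thsb.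
move=> th /andP[th0]; rewrite le_min => /andP[th1 th2] Vb0 Vb1 hdata.
have hth : 0 < th <= ths by rewrite th0.
have [s0 /andP[s00 s01] Hs] := H th hth Vb0 Vb1 hdata.
(* The entry [th / K6] secures [K6 * sqrt eps <= th]. Both entries limit [sqrt eps], so the
   threshold for [eps] is the square of [e]. *)
pose e := Num.min s0 (th / K6).
have e0 : 0 < e by rewrite lt_min s00 divr_gt0.
have e1 : e <= 1 by rewrite ge_min s01.
exists (e ^+ 2); split.
  by rewrite exprn_gt0//= expr_le1// ltW.
move=> eps /andP[eps0 epse] ve1 hve u _ v hv; lazy zeta.
have hse : Num.sqrt eps <= e
  by have := ler_wsqrtr epse; rewrite sqrtr_sqr (gtr0_norm e0).
have [hs0 hs6] : Num.sqrt eps <= s0 /\ Num.sqrt eps <= th / K6.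
  by move: hse; rewrite le_min => /andP.
have [hb [C C0 hC]] := Hs eps eps0 hs0 ve1 hve.
have [sue0 _ _] := hue0; have [sub1 _] := hub1.
have cup := prandtl0_class hup; have cve := euler1_class hve.
pose u1 := us_d R0 eps ue0 ub1 up ve1; pose u2 := us_dd R0 eps ue0 ub1 up ve1.
have du w x : der (u w) x (u1 w x) := der_us R0 eps sue0 sub1 cup cve w x.
have du1 w x : der (u1 w) x (u2 w x) := der_us_d R0 eps sue0 sub1 cup cve w x.
have cu w x : 0 < w -> cont2 u w x := @cont_us _ R0 eps _ _ _ _ sue0 sub1 cup cve w x.
have cu2 w x : 0 < w -> cont2 u2 w x := @cont_us_dd _ R0 eps _ _ _ _ sue0 sub1 cup cve w x.
have hw' w : 0 < w < th -> 0 <= w <= th by move=> /andP[w1 w2]; rewrite !ltW.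
have ipc n y : R0 <= y -> {for y, continuous (ipow R0 n)}.
  by move=> hy; apply: der_continuous; apply: der_ipow; lra.
have rR : r_of R0 eps R0 = R0 by rewrite /r_of subrr mulr0 addr0.
(* The profile bounds are known for [R0 < x]; right limits extend this one and the next two to the
   wall. *)
have lower w x : 0 < w < th -> R0 <= x -> c0 <= u w x.
  move=> hw; rewrite le_eqVlt => /orP[/eqP <-|hx]; last exact: (hb w x (hw' w hw) hx).1.
  apply: (@right_limit_bound _ (fun=> c0) (u w)); first exact: cvg_cst.
    exact: der_continuous (du w R0).
  by move=> y hy; exact: (hb w y (hw' w hw) hy).1.
have upper1 w x : 0 < w < th -> R0 <= x ->
    `|u1 w x| <= A * (Num.sqrt eps * ipow R0 4 (r_of R0 eps x) + ipow R0 4 x).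
  move=> hw; rewrite le_eqVlt => /orP[/eqP <-|hx]; last exact: (hb w x (hw' w hw) hx).2.
  apply: (@right_limit_bound _ (fun y => `|u1 w y|)
    (fun y => A * (Num.sqrt eps * ipow R0 4 (r_of R0 eps y) + ipow R0 4 y))).
  - by apply: cvg_norm; exact: der_continuous (du1 w R0).
  - apply: cvgM; first exact: cvg_cst.
    apply: cvgD; last exact: ipc.
    apply: cvgM; first exact: cvg_cst.
    apply: (@continuous_comp _ _ _ (r_of R0 eps) (ipow R0 4)).
      exact: der_continuous (der_r_of R0 eps R0).
    by rewrite rR; exact: ipc.
  - by move=> y hy; exact: (hb w y (hw' w hw) hy).2.
have upper2 w x : 0 < w < th -> R0 <= x -> `|u2 w x| <= C * ipow R0 4 x.
  move=> hw; rewrite le_eqVlt => /orP[/eqP <-|hx]; last exact: hC (hw' w hw) hx.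
  apply: (@right_limit_bound _ (fun y => `|u2 w y|) (fun y => C * ipow R0 4 y)).
  - apply: cvg_norm; have w0 : 0 < w by case/andP: hw.
    apply: (@continuous_comp _ _ _ (fun x => (w, x)) (fun z : R * R => u2 z.1 z.2)); last exact: cu2.
    by apply: (@cvg_pair _ _ _ _ (nbhs w) (nbhs R0)); [exact: cvg_cst|exact: cvg_id].
  - by apply: cvgM; [exact: cvg_cst|exact: ipc].
  - by move=> y hy; exact: hC (hw' w hw) hy.
have s1 : Num.sqrt eps <= 1 by exact: le_trans hs0 s01.
have h4 : K4 * th <= 1 by rewrite mulrC -ler_pdivlMr// div1r.
have h6 : K6 * Num.sqrt eps <= th by rewrite mulrC -ler_pdivlMr.
have := integrated_inequality hR0 hdelta eps0 s1 hc0 (ltW hA) th0 du du1 cu cu2 lower upper1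
  upper2 hv h4 h6.
have -> : iint R0 th (fun w x => r_of R0 eps x `^ delta * `|d2 (mul_r R0 eps v) w x| ^+ 2) =
    iint R0 th (fun w x => r_of R0 eps x `^ delta * d2 (mul_r R0 eps v) w x ^+ 2).
  apply: eq_integral => w _; apply: eq_integral => x _.
  by rewrite real_normK// num_real.
by rewrite /u d22_us.
Qed.
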